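(* Let $\mathsf{k}$ be a commutative ring, $A$ a countable set, and $\diamond$ a commutative associative $\mathsf{k}$-bilinear product on $\mathsf{k}A$. Let $J$ be the Jacobi--Trudi function on $\mathcal{Y}^{\mathrm{diag}}$. (1) $J:\mathcal{Y}^{\mathrm{diag}}\to\mathcal{Y}^{\mathrm{diag}}$ is a Hopf algebra homomorphism. (2) For every $\mathbf h\in\mathcal{Y}^{\mathrm{diag}}$ we have $J(\mathbf h)-\mathbf h\in\ker L_\diamond$. Equivalently, for a diagonal constant tableau $\mathbf h$ of shape $\lambda/\mu$ with diagonal entries $a_n$ ($n\in\mathbb Z$) and $s=\lambda_1$, $$L_\diamond(\mathbf h)=\det\left[a_{-\mu'_j+j-1}\,a_{-\mu'_j+j-2}\cdots a_{-\mu'_j+j-(\lambda'_i-\mu'_j-i+j)}\right]_{1\le i,j\le s},$$ where the matrix entries are words and the determinant is evaluated in the commutative algebra $(\mathsf{k}\langle A\rangle,\ast_\diamond)$; the word is $\mathbf 1$ if $\lambda'_i-\mu'_j-i+j=0$ and the entry is $0$ if $\lambda'_i-\mu'_j-i+j<0$.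
   Context: $\mathsf{k}A$ is the free $\mathsf{k}$-module with basis $A$; $\mathsf{k}\langle A\rangle$ is the free associative $\mathsf{k}$-algebra on $A$ (basis: words, $\mathbf 1$ the empty word). The quasi-shuffle product $\ast_\diamond$ on $\mathsf{k}\langle A\rangle$ is the (commutative) bilinear product with $\mathbf 1\ast_\diamond w=w\ast_\diamond\mathbf 1=w$ and $aw\ast_\diamond bv=a(w\ast_\diamond bv)+b(aw\ast_\diamond v)+(a\diamond b)(w\ast_\diamond v)$ for $a,b\in A$ and words $w,v$. Tableaux. For partitions $\mu\subseteq\lambda$ (padded by zeros), $D(\lambda/\mu)=\{(i,j):\mu_i<j\le\lambda_i\}$ ($i$ row index increasing downwards, $j$ column index). A Young tableau of shape $\mathrm{sh}(\mathbf h)=\lambda/\mu$ with entries in $A$ is any family $\mathbf h=(h_{i,j})_{(i,j)\in D(\lambda/\mu)}$; $\mathrm{YT}(A)$ is the set of all of them; $\mathbf 1$ is the empty tableau. For $\mathbf h$ of shape $\lambda/\mu$, $\lambda=(\lambda_1,\dots,\lambda_r)$, cut $\mathbf h$ after every row $i$ with $\mu_i\ge\lambda_{i+1}$ ($\lambda_{r+1}:=0$); translate each resulting piece up and to the left so that it starts in row $1$ and as far left as possible (a piece without boxes becomes $\mathbf 1$). The resulting multiset is $\mathrm{SC}(\mathbf h)$. $\mathcal{Y}$ (written $\mathsf{k}\boxed{A}$ in the paper) is the commutative algebra $\mathsf{k}[\mathrm{YT}(A)]$ modulo the relations $\mathbf h=\prod_{\mathbf i\in\mathrm{SC}(\mathbf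 h)}\mathbf i$, with $\mathbf 1$ the unit; its product is $\ast$. It is a connected graded (by number of boxes) commutative Hopf algebra with coproduct $\Delta_{cut}(w)=\sum_{\mu\subseteq\eta\subseteq\lambda}w_{\eta/\mu}\otimes w_{\lambda/\eta}$ for a tableau $w$ of shape $\lambda/\mu$ ($w_\alpha$ = restriction to $D(\alpha)$) and counit $\epsilon(\mathbf 1)=1$, $\epsilon(w)=0$ for $w$ nonempty. A tableau $\mathbf h$ is diagonal constant if $h_{i,j}=h_{k,l}$ whenever $i-j=k-l$; then $a_n:=h_{i,i+n}$ denotes the common entry on the diagonal $j-i=n$. $\mathcal{Y}^{\mathrm{diag}}\subseteq\mathcal{Y}$ is the subalgebra generated by (equivalently, the $\mathsf{k}$-span of) the diagonal constant tableaux; it is a Hopf subalgebra. Jacobi--Trudi function. $J:\mathcal{Y}^{\mathrm{diag}}\to\mathcal{Y}^{\mathrm{diag}}$ is the $\mathsf{k}$-linear map which on a diagonal constant tableau $\mathbf h$ of shape $\lambda/\mu$, with $s=\lambda_1$ and conjugate partitions $\lambda'=(\lambda'_1,\dots,\lambda'_s)$, $\mu'=(\mu'_1,\dots,\mu'_s)$ (zero parts allowed), is $J(\mathbf h)=\det[T_{i,j}]_{1\le i,j\le s}$ (determinant in $(\mathcal{Y},\ast)$), where $T_{i,j}$ is the one-column tableau with $m_{i,j}=\lambda'_i-\mu'_j-i+j$ boxes whose entries from top to bottom are $a_{-\mu'_j+j-1},a_{-\mu'_j+j-2},\dots,a_{-\mu'_j+j-m_{i,j}}$; $T_{i,j}=\mathbf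 1$ if $m_{i,j}=0$ and $T_{i,j}=0$ if $m_{i,j}<0$. Matrix entries involving an $a_n$ for a diagonal not meeting $\lambda/\mu$ are set to $0$ (also in the determinant of words). $J(\mathbf 1)=\mathbf 1$. Linearization. A skew shape is a horizontal strip if no column contains two boxes. $\mathrm{SSD}(\lambda/\mu)$ is the set of tuples $(D_1,\dots,D_r)$, $D_t=D(\eta^{(t)}/\eta^{(t-1)})$, coming from chains of partitions $\mu=\eta^{(0)}\subsetneq\cdots\subsetneq\eta^{(r)}=\lambda$ with every $\eta^{(t)}/\eta^{(t-1)}$ a horizontal strip (the empty chain if $\lambda=\mu$). $L_\diamond:\mathcal{Y}\to\mathsf{k}\langle A\rangle$ is the $\mathsf{k}$-linear map $L_\diamond(\mathbf h)=\sum_{(D_1,\dots,D_r)\in\mathrm{SSD}(\mathrm{sh}(\mathbf h))}|\mathbf h_{D_1}|_\diamond\cdots|\mathbf h_{D_r}|_\diamond$ (concatenation), $|\mathbf h_D|_\diamond\in\mathsf{k}A$ being the $\diamond$-product of all $h_{i,j}$, $(i,j)\in D$, and $L_\diamond(\mathbf 1)=\mathbf 1$. *)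

(* Defs.v *)
From HB Require Import structures.
From mathcomp Require Import all_boot all_order all_algebra.
From mathcomp Require Import perm.
From mathcomp Require Import finmap.
From mathcomp Require Import boolp.
From mathcomp.multinomials Require Import monalg.

Set Implicit Arguments.
Unset Strict Implicit.
Unset Printing Implicit Defensive.

Import GRing.Theory.
Local Open Scope ring_scope.
Local Open Scope quotient_scope.

(* Skew tableaux.  Rows and columns are numbered from 0, which leaves the
   diagonal index j - i unchanged.  Row i of a tableau of shape lam/mu is stored
   as the pair (mu_i, entries), so that lam_i = mu_i + size entries. *)

Section Tableaux.
Variable A : countType.

Definition trow := (nat * seq A)%type.
Definition row_start (r : trow) : nat := r.1.
Definition row_end (r : trow) : nat := (r.1 + size r.2)%N.

Definition skew_rows (t : seq trow) : bool :=
  sorted geq (map row_start t) && sorted geq (map row_end t).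

(* Asking all parts of lam to be positive makes lam, hence the padded mu,
   unique. *)
Definition valid_rows (t : seq trow) : bool :=
  skew_rows t && all (fun r => 0 < row_end r)%N t.

Record tableau := Tableau { rows :> seq trow; rowsP : valid_rows rows }.
HB.instance Definition _ := [isSub for rows].
HB.instance Definition _ := [Countable of tableau by <:].

Definition empty_tab : tableau := @Tableau [::] isT.

Definition trim (t : seq trow) : seq trow :=
  [seq r <- t | 0 < row_end r]%N.

(* The default value is never reached when skew_rows t holds (rows_mktab), and
   mktab is only used on such t. *)
Definition mktab (t : seq trow) : tableau := insubd empty_tab (trim t).

Lemma rows_mktab t : skew_rows t -> rows (mktab t) = trim t.
Proof.
move=> /andP[s1 s2]; rewrite val_insubd ifT // /valid_rows filter_all andbT.
have geqT : transitive geq by move=> a b c /= ab ca; apply: leq_trans ca ab.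
apply/andP; split.
  by move: s1; rewrite !sorted_map; apply: sorted_filter => a b c; apply: geqT.
by move: s2; rewrite !sorted_map; apply: sorted_filter => a b c; apply: geqT.
Qed.

Implicit Types h : tableau.

Definition inner h : seq nat := map row_start h.
Definition outer h : seq nat := map row_end h.
Definition nboxes h : nat := sumn [seq size r.2 | r <- rows h].

Definition entry h (i j : nat) : option A :=
  let r := nth (0%N, [::]) (rows h) i in
  if (r.1 <= j)%N then onth r.2 (j - r.1) else None.

Definition diagonal_constant h : Prop :=
  forall i j k l a b, entry h i j = Some a -> entry h k l = Some b ->
    (i + l = k + j)%N -> a = b.

(* The entry a_n of the diagonal j - i = n, if that diagonal meets the shape:
   the first one found, going down the rows. *)
Definition diag_entry h (n : int) : option A :=
  ohead (pmap (fun i : nat => if n + i%:Z is Posz j then entry h i j else None)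
              (iota 0 (size (rows h)))).

(* Restriction to D(f/e), for partitions inner h <= e <= f <= outer h padded to
   the number of rows of h. *)
Definition restrict_rows h (e f : seq nat) : seq trow :=
  [seq let r := nth (0%N, [::]) (rows h) i in
       let d x := (nth 0%N x i - r.1)%N in
       (nth 0%N e i, drop (d e) (take (d f) r.2))
  | i <- iota 0 (size (rows h))].
Definition restrict h e f : tableau := mktab (restrict_rows h e f).

(* The test row_end r' <= row_start r reads lam_(i+1) <= mu_i. *)
Fixpoint cut_rows (t : seq trow) : seq (seq trow) :=
  match t with
  | [::] => [::]
  | r :: t' =>
      let c := cut_rows t' in
      if t' is r' :: _ then
        if (row_end r' <= row_start r)%N then [:: r] :: c
        else (r :: head [::] c) :: behead c
      else [:: [:: r]]
  end.

(* The last row of a piece has the smallest mu; a piece without boxes is a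
   single row, which is moved to (0, [::]) and then trimmed away. *)
Definition shift_rows (t : seq trow) : seq trow :=
  let m := last 0%N (map row_start t) in [seq ((r.1 - m)%N, r.2) | r <- t].

Definition SC h : seq tableau := [seq mktab (shift_rows p) | p <- cut_rows h].

Definition column (s : seq A) : tableau := mktab [seq (0%N, [:: a]) | a <- s].

End Tableaux.

Arguments row_start {A} r.
Arguments row_end {A} r.

Section Pieces.
Variable A : countType.
Implicit Types (t : seq (trow A)) (h : tableau A).

Lemma cut_rows_cons2 (r r' : trow A) t : cut_rows [:: r, r' & t] =
  let c := cut_rows (r' :: t) in
  if (row_end r' <= row_start r)%N then [:: r] :: c
  else (r :: head [::] c) :: behead c.
Proof. by []. Qed.

Lemma flatten_cut_rows t : flatten (cut_rows t) = t.
Proof.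
elim: t => [//|r [//|r' t] IH]; rewrite cut_rows_cons2.
move: (cut_rows (r' :: t)) IH => c IH /=.
case: ifP => _ /=; first by rewrite IH.
by case: c IH => [//|p c] /= ->.
Qed.

Lemma skew_rows_subseq s t : subseq s t -> skew_rows t -> skew_rows s.
Proof.
have geqT : transitive geq by move=> a b c /= ab ca; apply: leq_trans ca ab.
move=> st /andP[t1 t2]; apply/andP; split.
  by apply: subseq_sorted t1 => //; apply: map_subseq.
by apply: subseq_sorted t2 => //; apply: map_subseq.
Qed.

Lemma skew_rows_piece t p : skew_rows t -> p \in cut_rows t -> skew_rows p.
Proof.
move=> st pc; apply: skew_rows_subseq st; rewrite -[X in subseq _ X]flatten_cut_rows.
elim: (cut_rows t) pc => [//|q c IH]; rewrite inE => /orP[/eqP->|/IH pc] /=.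
  exact: prefix_subseq.
exact: subseq_trans pc (suffix_subseq _ _).
Qed.

Lemma skew_rows_shift t : skew_rows t -> skew_rows (shift_rows t).
Proof.
case/andP=> s1 s2; rewrite /skew_rows /shift_rows; set m := last _ _.
have le_m r : r \in t -> (m <= r.1)%N.
  move=> rt; rewrite /m; elim: t s1 {s2 m} rt => [//|x t IH] /= s1.
  have geqT : transitive geq by move=> a b c /= ab ca; apply: leq_trans ca ab.
  have all_x := order_path_min geqT s1.
  rewrite inE => /orP[/eqP->|rt].
    have := mem_last (row_start x) (map row_start t).
    by rewrite inE => /orP[/eqP->//|/(allP all_x)].
  have := IH (path_sorted s1) rt.
  by case: t rt {IH s1 all_x} => [|y t].
apply/andP; split.
  have -> : map row_start [seq ((r.1 - m)%N, r.2) | r <- t] =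
      map (fun x => x - m)%N (map row_start t) by rewrite -!map_comp.
  by rewrite sorted_map; apply: sub_sorted s1 => x y; apply: leq_sub2r.
have -> : map row_end [seq ((r.1 - m)%N, r.2) | r <- t] =
    map (fun x => x - m)%N (map row_end t).
  rewrite -!map_comp; apply/eq_in_map => r rt.
  by rewrite /= /row_end /= addnBAC // le_m.
by rewrite sorted_map; apply: sub_sorted s2 => x y; apply: leq_sub2r.
Qed.

Definition boxless t : bool := all (fun r => size r.2 == 0)%N t.

Lemma boxless_SC h : all (fun p : tableau A => boxless p) (SC h) = boxless h.
Proof.
have skh : skew_rows h by case/andP: (rowsP h).
rewrite /SC all_map -[in RHS](flatten_cut_rows h).
have -> c : boxless (flatten c) = all boxless c.
  by elim: c => //= p c IH; rewrite -IH -all_cat.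
apply: eq_in_all => p pc /=.
rewrite rows_mktab ?skew_rows_shift ?(skew_rows_piece skh pc) //.
rewrite /boxless all_filter all_map; apply: eq_all => r /=.
by rewrite /row_end /=; case: r.2 => [|? ?]; rewrite ?implybT //= addnS.
Qed.

End Pieces.

Section LinearExtension.
Variables (R : comNzRingType) (K : choiceType) (V : lmodType R) (f : K -> V).

Definition mlift (g : {malg R[K]}) : V := \sum_(x <- msupp g) g@_x *: f x.

Lemma mliftEw (d : {fset K}) g : (msupp g `<=` d)%fset ->
  mlift g = \sum_(x <- d) g@_x *: f x.
Proof.
move=> le; rewrite /mlift (big_fset_incl _ le) //= => x xd /mcoeff_outdom ->.
by rewrite scale0r.
Qed.

Lemma mlift_linear : linear mlift.
Proof.
move=> c g1 g2; set d := (msupp (c *: g1 + g2) `|` (msupp g1 `|` msupp g2))%fset.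
rewrite !(@mliftEw d) ?/d ?fsubsetUl //; last first.
- by apply: fsubset_trans (fsubsetUr _ _); apply: fsubsetUl.
- by apply: fsubset_trans (fsubsetUr _ _); apply: fsubsetUr.
rewrite scaler_sumr -big_split /=; apply: eq_bigr => x _.
by rewrite mcoeffD mcoeffZ scalerDl scalerA.
Qed.

HB.instance Definition _ :=
  GRing.isLinear.Build R {malg R[K]} V _ mlift mlift_linear.

Lemma mliftU x : mlift << x >> = f x.
Proof.
by rewrite (mliftEw msuppU_le) big_seq_fset1 mcoeffUU scale1r.
Qed.

End LinearExtension.

Section Tensor.
Variables (R : comNzRingType) (M N : lmodType R).

(* The submodule of the free module on M * N expressing bilinearity. *)
Inductive tens_rel : {malg R[(M * N)%type]} -> Prop :=
| tens_rel_l c x x' y :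
    tens_rel (<< (c *: x + x', y) >> - (c *: << (x, y) >> + << (x', y) >>))
| tens_rel_r c x y y' :
    tens_rel (<< (x, c *: y + y') >> - (c *: << (x, y) >> + << (x, y') >>))
| tens_rel0 : tens_rel 0
| tens_rel_lin c u v : tens_rel u -> tens_rel v -> tens_rel (c *: u + v).

Definition tens_pred : pred {malg R[(M * N)%type]} := fun u => `[< tens_rel u >].

Fact tens_zmod : zmod_closed tens_pred.
Proof.
split=> [|x y /asboolP hx /asboolP hy]; apply/asboolP; first exact: tens_rel0.
by rewrite addrC -scaleN1r; apply: tens_rel_lin.
Qed.
HB.instance Definition _ :=
  GRing.isZmodClosed.Build {malg R[(M * N)%type]} tens_pred tens_zmod.

Definition tens_sub : zmodClosed {malg R[(M * N)%type]} :=
  GRing.ZmodClosed.clone _ tens_pred _.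
Definition tens : Type := {ideal_quot tens_sub}.
HB.instance Definition _ := GRing.Zmodule.on tens.
HB.instance Definition _ := EqQuotient.on tens.
HB.instance Definition _ := ZmodQuotient.on tens.

Definition tens_pi (u : {malg R[(M * N)%type]}) : tens := \pi_tens u.

Lemma tens_piP u v : tens_pi u = tens_pi v <-> tens_rel (u - v).
Proof.
split=> [/eqP|H]; last apply/eqP.
  by rewrite -Quotient.idealrBE => /asboolP.
by rewrite -Quotient.idealrBE; apply/asboolP.
Qed.

Lemma tens_piB : {morph tens_pi : u v / u - v}.
Proof. by move=> u v; rewrite /tens_pi raddfB. Qed.

Definition tens_scale (c : R) (t : tens) : tens := tens_pi (c *: repr t).

Lemma tens_scale_pi c u : tens_scale c (tens_pi u) = tens_pi (c *: u).
Proof.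
apply/tens_piP; rewrite -scalerBr -[_ *: _]addr0; apply: tens_rel_lin; last first.
  exact: tens_rel0.
by apply/tens_piP; rewrite /tens_pi reprK.
Qed.

Lemma tens_pi_repr t : tens_pi (repr t) = t.
Proof. exact: reprK. Qed.

Fact tens_scaleA a b t : tens_scale a (tens_scale b t) = tens_scale (a * b) t.
Proof. by rewrite -[t]tens_pi_repr !tens_scale_pi scalerA. Qed.

Fact tens_scale1 : left_id 1 tens_scale.
Proof. by move=> t; rewrite -[t]tens_pi_repr tens_scale_pi scale1r. Qed.

Lemma tens_piD : {morph tens_pi : u v / u + v}.
Proof. by move=> u v; rewrite /tens_pi raddfD. Qed.

Fact tens_scaleDr : right_distributive tens_scale +%R.
Proof.
move=> c t u; rewrite -[t]tens_pi_repr -[u]tens_pi_repr -tens_piD.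
by rewrite !tens_scale_pi scalerDr tens_piD.
Qed.

Fact tens_scaleDl t : {morph tens_scale^~ t : a b / a + b}.
Proof.
move=> a b; rewrite -[t]tens_pi_repr !tens_scale_pi.
by rewrite scalerDl tens_piD.
Qed.

HB.instance Definition _ := GRing.Zmodule_isLmodule.Build R tens
  tens_scaleA tens_scale1 tens_scaleDr tens_scaleDl.

Fact tens_pi_linear : linear tens_pi.
Proof. by move=> c u v; rewrite tens_piD -tens_scale_pi. Qed.
HB.instance Definition _ :=
  GRing.isLinear.Build R {malg R[(M * N)%type]} tens _ tens_pi tens_pi_linear.

Definition tpure (x : M) (y : N) : tens := tens_pi << (x, y) >>.

Lemma tpure_linear_l y : linear (tpure^~ y).
Proof.
move=> c x x'; rewrite /tpure -linearP; apply/tens_piP.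
exact: tens_rel_l.
Qed.

Lemma tpure_linear_r x : linear (tpure x).
Proof.
move=> c y y'; rewrite /tpure -linearP; apply/tens_piP.
exact: tens_rel_r.
Qed.

Section Lift.
Variables (V : lmodType R) (b : M -> N -> V).

(* Meaningful for bilinear b only (tlift_linear, tlift_pure). *)
Definition tlift (t : tens) : V := mlift (fun p => b p.1 p.2) (repr t).

Hypothesis b_l : forall y, linear (b^~ y).
Hypothesis b_r : forall x, linear (b x).

Lemma tlift_pi u : tlift (tens_pi u) = mlift (fun p => b p.1 p.2) u.
Proof.
apply/eqP; rewrite -subr_eq0 -linearB /=; apply/eqP.
have: tens_rel (repr (tens_pi u) - u) by apply/tens_piP; rewrite /tens_pi reprK.
elim=> [c x x' y|c x y y'||c v w _ IHv _ IHw].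
- by rewrite linearB linearP /= !mliftU /= b_l subrr.
- by rewrite linearB linearP /= !mliftU /= b_r subrr.
- exact: linear0.
- by rewrite linearP /= IHv IHw scaler0 addr0.
Qed.

Lemma tlift_linear : linear tlift.
Proof.
move=> c t u; rewrite -[t]tens_pi_repr -[u]tens_pi_repr -linearP /=.
by rewrite !tlift_pi linearP.
Qed.

Lemma tlift_pure x y : tlift (tpure x y) = b x y.
Proof. by rewrite tlift_pi mliftU. Qed.

End Lift.

End Tensor.


Definition tmap (R : comNzRingType) (M N M' N' : lmodType R)
    (f : M -> M') (g : N -> N') : tens M N -> tens M' N' :=
  tlift (fun x y => tpure (f x) (g y)).

Lemma tmap_linear (R : comNzRingType) (M N M' N' : lmodType R)
    (f : {linear M -> M'}) (g : {linear N -> N'}) : linear (tmap f g).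
Proof.
apply: tlift_linear => [y c x x'|x c y y']; rewrite linearP.
  exact: tpure_linear_l.
exact: tpure_linear_r.
Qed.

Lemma tmap_pure (R : comNzRingType) (M N M' N' : lmodType R)
    (f : {linear M -> M'}) (g : {linear N -> N'}) x y :
  tmap f g (tpure x y) = tpure (f x) (g y).
Proof.
apply: (tlift_pure (b := fun x y => tpure (f x) (g y))) => [z c u v|z c u v];
  rewrite linearP; [exact: tpure_linear_l|exact: tpure_linear_r].
Qed.

(* The variable attached to h in the polynomial ring with one variable per
   tableau. *)
HB.lock Definition tvar (k : comNzRingType) (A : countType) (h : tableau A) :
  {malg k[{cmonom (tableau A)}]} := << ucm h >>.

Section CutIdeal.
Variables (k : comNzRingType) (A : countType).
Local Notation tpoly := {malg k[{cmonom (tableau A)}]}.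
Local Notation tvar := (@tvar k A).

Inductive cut_ideal : tpoly -> Prop :=
| cut_ideal_unit : cut_ideal (tvar (empty_tab A) - 1)
| cut_ideal_SC h : cut_ideal (tvar h - \prod_(i <- SC h) tvar i)
| cut_ideal0 : cut_ideal 0
| cut_idealB p q : cut_ideal p -> cut_ideal q -> cut_ideal (p - q)
| cut_idealM p q : cut_ideal q -> cut_ideal (p * q).

Definition cut_pred : pred tpoly := fun p => `[< cut_ideal p >].

(* Sending boxless tableaux to 1 and the others to 0 shows that the ideal is
   proper. *)
Definition boxless_monom (m : {cmonom (tableau A)}) : k :=
  (all (fun h : tableau A => boxless h) (finsupp m))%:R.

Fact boxless_monom_morph : mmorphism boxless_monom.
Proof.
split=> [m n|]; last by rewrite /boxless_monom mdom1.
rewrite /boxless_monom mdomD -natrM mulnb; congr (nat_of_bool _)%:R.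
apply/allP/andP => [H|[/allP H1 /allP H2] h].
  by split; apply/allP => h hm; apply: H; rewrite in_fsetU hm ?orbT.
by rewrite in_fsetU => /orP[/H1|/H2].
Qed.
HB.instance Definition _ :=
  monalg.isMultiplicative.Build _ k boxless_monom boxless_monom_morph.

Lemma cut_ideal1 : ~ cut_ideal 1.
Proof.
have [phi phiX] : exists phi : {rmorphism tpoly -> k},
    forall h, phi (tvar h) = (boxless h)%:R.
  exists (mmap (idfun : {rmorphism k -> k}) boxless_monom) => h.
  rewrite tvar.unlock /= mmapU /= mul1r /boxless_monom mdomU; congr (nat_of_bool _)%:R.
  apply/allP/idP => [H|hb x]; first by apply: H; rewrite in_fset1.
  by rewrite in_fset1 => /eqP->.
suff phi0 p : cut_ideal p -> phi p = 0.
  by move/phi0/eqP; rewrite rmorph1 oner_eq0.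
elim=> [|h||x y _ IHx _ IHy|x y _ IHy].
- have := phiX (empty_tab A); move: (tvar _) => v /= phiv.
  by rewrite rmorphB phiv (rmorph1 phi) subrr.
- rewrite rmorphB phiX rmorph_prod -boxless_SC /=.
  rewrite (eq_bigr (fun i : tableau A => (boxless i)%:R)) => [|i _]; last exact: phiX.
  elim: (SC h) => [|i s IH] /=; first by rewrite big_nil mulr1n subrr.
  rewrite big_cons; case: (boxless i) => /=; last by rewrite mul0r subrr.
  by rewrite mul1r.
- exact: rmorph0.
- by rewrite rmorphB IHx IHy subrr.
- by rewrite rmorphM IHy mulr0.
Qed.

Fact cut_idealr : idealr_closed cut_pred.
Proof.
split; first by apply/asboolP; apply: cut_ideal0.
  by apply/asboolP; apply: cut_ideal1.
move=> a x y /asboolP hx /asboolP hy; apply/asboolP.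
rewrite -[y]opprK; apply: cut_idealB; first exact: cut_idealM.
by rewrite -mulN1r; apply: cut_idealM.
Qed.
HB.instance Definition _ := isIdealr.Build tpoly cut_pred cut_idealr.

Definition cut_sub : idealr tpoly := Idealr.clone _ cut_pred _.

Definition tabalg : Type := {ideal_quot cut_sub}.
HB.instance Definition _ := GRing.ComNzRing.on tabalg.
HB.instance Definition _ := EqQuotient.on tabalg.
HB.instance Definition _ := NzRingQuotient.on tabalg.

Definition tabalg_pi (p : tpoly) : tabalg := \pi_tabalg p.

Fact tabalg_pi_zmod : zmod_morphism tabalg_pi.
Proof. by move=> p q; rewrite /tabalg_pi raddfB. Qed.
Fact tabalg_pi_monoid : monoid_morphism tabalg_pi.
Proof. by rewrite /tabalg_pi; split=> [|p q]; rewrite (rmorph1, rmorphM). Qed.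
HB.instance Definition _ :=
  GRing.isZmodMorphism.Build tpoly tabalg tabalg_pi tabalg_pi_zmod.
HB.instance Definition _ :=
  GRing.isMonoidMorphism.Build tpoly tabalg tabalg_pi tabalg_pi_monoid.

Lemma tabalg_pi_repr x : tabalg_pi (repr x) = x.
Proof. exact: reprK. Qed.

Definition tabalg_C (c : k) : tabalg := tabalg_pi c%:A.
Definition tabalg_scale (c : k) (x : tabalg) : tabalg := tabalg_C c * x.

Lemma tabalg_CM a b : tabalg_C (a * b) = tabalg_C a * tabalg_C b.
Proof.
have abE : a%:A * b%:A = (a * b)%:A :> tpoly by rewrite mulr_algl scalerA.
rewrite /tabalg_C -abE; exact: (rmorphM (tabalg_pi : {rmorphism tpoly -> tabalg})).
Qed.

Fact tabalg_scaleA a b x :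
  tabalg_scale a (tabalg_scale b x) = tabalg_scale (a * b) x.
Proof. by rewrite [RHS]/tabalg_scale tabalg_CM; apply: mulrA. Qed.
Fact tabalg_scale1 : left_id 1 tabalg_scale.
Proof.
move=> x; rewrite /tabalg_scale.
have -> : tabalg_C 1 = 1 by rewrite /tabalg_C scale1r (rmorph1 tabalg_pi).
exact: mul1r.
Qed.
Fact tabalg_scaleDr : right_distributive tabalg_scale +%R.
Proof. by move=> a x y; apply: mulrDr. Qed.
Fact tabalg_scaleDl x : {morph tabalg_scale^~ x : a b / a + b}.
Proof.
move=> a b; rewrite /tabalg_scale.
have -> : tabalg_C (a + b) = tabalg_C a + tabalg_C b.
  by rewrite /tabalg_C scalerDl (rmorphD tabalg_pi).
exact: mulrDl.
Qed.
HB.instance Definition _ := GRing.Zmodule_isLmodule.Build k tabalg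
  tabalg_scaleA tabalg_scale1 tabalg_scaleDr tabalg_scaleDl.
Fact tabalg_scaleAl (a : k) (x y : tabalg) : a *: (x * y) = (a *: x) * y.
Proof. exact: mulrA. Qed.
HB.instance Definition _ :=
  GRing.Lmodule_isLalgebra.Build k tabalg tabalg_scaleAl.
HB.instance Definition _ := GRing.Lalgebra_isComAlgebra.Build k tabalg.

End CutIdeal.

HB.lock Definition tcls (k : comNzRingType) (A : countType) (h : tableau A) :
  tabalg k A := tabalg_pi (tvar k h).

Section DiagonalSubalgebra.
Variables (k : comNzRingType) (A : countType).
Local Notation tabalg := (tabalg k A).
Local Notation tcls := (@tcls k A).

Inductive diag_gen : tabalg -> Prop :=
| diag_gen_cls h : diagonal_constant h -> diag_gen (tcls h)
| diag_gen1 : diag_gen 1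
| diag_gen_lin c x y : diag_gen x -> diag_gen y -> diag_gen (c *: x + y)
| diag_genM x y : diag_gen x -> diag_gen y -> diag_gen (x * y).

Definition diag_pred : pred tabalg := fun x => `[< diag_gen x >].

Fact diag_subalg : subalg_closed diag_pred.
Proof.
split=> [|c x y /asboolP hx /asboolP hy|x y /asboolP hx /asboolP hy];
  apply/asboolP; [exact: diag_gen1|exact: diag_gen_lin|exact: diag_genM].
Qed.
HB.instance Definition _ := GRing.isSubalgClosed.Build k tabalg diag_pred diag_subalg.

Record diagalg : Type :=
  DiagAlg { diagval :> tabalg; diagvalP : diagval \in diag_pred }.
HB.instance Definition _ := [isSub for diagval].
HB.instance Definition _ := [Choice of diagalg by <:].
HB.instance Definition _ := [SubChoice_isSubLalgebra of diagalg by <:].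
HB.instance Definition _ := [SubNzRing_isSubComNzRing of diagalg by <:].
HB.instance Definition _ := GRing.Lalgebra_isComAlgebra.Build k diagalg.

(* The class of a diagonal constant tableau (junk on other tableaux). *)
Definition dcls (h : tableau A) : diagalg := insubd 0 (tcls h).

Lemma diagval_dcls h : diagonal_constant h -> diagval (dcls h) = tcls h.
Proof.
by move=> hd; rewrite /dcls val_insubd ifT //; apply/asboolP/diag_gen_cls.
Qed.

End DiagonalSubalgebra.

Section HopfMorphism.
Variable k : comNzRingType.

Definition is_antipode (H : comAlgType k) (Delta : H -> tens H H) (eps : H -> k)
    (S : H -> H) : Prop :=
  forall x, tlift (fun a b => S a * b) (Delta x) = (eps x)%:A /\
            tlift (fun a b => a * S b) (Delta x) = (eps x)%:A.

(* Antipodes are unique when they exist, so the last clause quantifies over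
   them. *)
Definition hopf_morphism (H H' : comAlgType k)
    (Delta : H -> tens H H) (eps : H -> k)
    (Delta' : H' -> tens H' H') (eps' : H' -> k) (f : {linear H -> H'}) : Prop :=
  [/\ monoid_morphism f,
      forall x, Delta' (f x) = tmap f f (Delta x),
      forall x, eps' (f x) = eps x
    & forall (S : {linear H -> H}) (S' : {linear H' -> H'}),
        is_antipode Delta eps S -> is_antipode Delta' eps' S' ->
        forall x, f (S x) = S' (f x)].

End HopfMorphism.

Section IntermediateShapes.
Variable A : countType.
Implicit Types h : tableau A.

Definition largest_part h : nat := head 0%N (outer h).

(* Partitions contained in outer h, padded with zeros to as many parts as
   there are rows. *)
Definition box h : finType :=
  ((size (rows h)).-tuple 'I_(largest_part h).+1)%type.
Definition parts h (e : box h) : seq nat := map val (tval e).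

Definition part_sub (e f : seq nat) : bool := all2 leq e f.

Definition between h (e : seq nat) : bool :=
  [&& sorted geq e, part_sub (inner h) e & part_sub e (outer h)].

Definition horizontal_strip (f e : seq nat) : bool :=
  all (fun j => count (fun i => nth 0 e i <= j < nth 0 f i)
                      (iota 0 (size f)) <= 1)%N
      (iota 0 (head 0%N f)).

Definition strip_step (e f : seq nat) : bool :=
  [&& sorted geq f, part_sub e f, e != f & horizontal_strip f e].

(* c lists eta^(1), ..., eta^(r); the initial eta^(0) is inner h. *)
Definition strip_chain h (c : seq (seq nat)) : bool :=
  path strip_step (inner h) c && (last (inner h) c == outer h).

Definition conj_part (l : seq nat) (j : nat) : nat := count (ltn j) l.

Definition jt_length h (i j : nat) : int :=
  (conj_part (outer h) i)%:Z - (conj_part (inner h) j)%:Z - i%:Z + j%:Z.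

(* The word in position (i, j) of the Jacobi--Trudi matrix; None stands for the
   entry 0. *)
Definition jt_word h (i j : nat) : option (seq A) :=
  if jt_length h i j is Posz m then
    let s := [seq diag_entry h (j%:Z - (conj_part (inner h) j)%:Z - l%:Z)
             | l <- iota 0 m] in
    if all isSome s then Some (pmap id s) else None
  else None.

End IntermediateShapes.

Section HopfStructure.
Variables (k : comNzRingType) (A : countType).
Local Notation D := (diagalg k A).

Definition is_cut_coproduct (Delta : D -> tens D D) : Prop :=
  forall h, diagonal_constant h ->
    Delta (dcls k h) = \sum_(e : box h | between h (parts e))
      tpure (dcls k (restrict h (inner h) (parts e)))
            (dcls k (restrict h (parts e) (outer h))).

(* A tableau of shape lam/lam has no boxes and its class is 1. *)
Definition is_cut_counit (eps : D -> k) : Prop :=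
  forall h : tableau A, diagonal_constant h ->
    eps (dcls k h) = (nboxes h == 0%N)%:R.

Definition jt_det (h : tableau A) : tabalg k A :=
  \det (\matrix_(i < largest_part h, j < largest_part h)
          oapp (fun w => tcls k (column w)) 0 (jt_word h i j)).

Definition is_jacobi_trudi (J : D -> D) : Prop :=
  forall h, diagonal_constant h -> diagval (J (dcls k h)) = jt_det h.

End HopfStructure.

Section Words.
Variables (k : comNzRingType) (A : countType).
Variable dia : {malg k[A]} -> {malg k[A]} -> {malg k[A]}.

(* The product of this algebra is concatenation. *)
Definition words : Type := {malg k[{fmonom A}]}.
HB.instance Definition _ := GRing.Lalgebra.on words.

Definition word (w : seq A) : words := << FMonom w >>.

Definition letters : {malg k[A]} -> words := mlift (fun a => word [:: a]).

Fixpoint qsh_word (w : seq A) : seq A -> words :=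
  match w with
  | [::] => word
  | a :: w' =>
      fix qsh_a (v : seq A) : words :=
        match v with
        | [::] => word w
        | b :: v' => word [:: a] * qsh_word w' v + word [:: b] * qsh_a v'
                     + letters (dia << a >> << b >>) * qsh_word w' v'
        end
  end.

Definition qsh (x y : words) : words :=
  mlift (fun w : {fmonom A} => mlift (fun v : {fmonom A} => qsh_word w v) y) x.

(* Leibniz formula, \det being tied to the ring product (concatenation). *)
Definition qsh_det n (M : 'M[words]_n) : words :=
  \sum_(s : 'S_n) (-1) ^+ s *: \big[qsh/word [::]]_(i < n) M i (s i).

(* The empty product is junk: it is only used on nonempty sequences. *)
Definition dia_prod (s : seq A) : {malg k[A]} :=
  if s is a :: s' then foldl (fun x b => dia x << b >>) << a >> s' else 0.

(* Each step of a chain adds a box, so chains have at most nboxes h steps. *)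
Definition lin_tab (h : tableau A) : words :=
  \sum_(r < (nboxes h).+1)
   \sum_(c : r.-tuple (box h) | strip_chain h (map (@parts A h) c))
     \prod_(x <- pairmap
              (fun e f => letters (dia_prod (flatten (map snd (restrict_rows h e f)))))
              (inner h) (map (@parts A h) c)) x.

Definition is_linearization (L : tabalg k A -> words) : Prop :=
  forall h, L (tcls k h) = lin_tab h.

Definition jt_word_det (h : tableau A) : words :=
  qsh_det (\matrix_(i < largest_part h, j < largest_part h)
            oapp word 0 (jt_word h i j)).

End Words.

(* Main.v *)
Require Import Defs.
From HB Require Import structures.
From mathcomp Require Import all_boot all_order all_algebra.
From mathcomp Require Import perm finmap boolp ssrAC zify.
From mathcomp.multinomials Require Import monalg.

Set Implicit Arguments.
Unset Strict Implicit.
Unset Printing Implicit Defensive.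

Import GRing.Theory.
Local Open Scope ring_scope.

(* A function of skew tableaux which is 1 on shapes without boxes, ignores
   horizontal translations and turns every cut between two rows into a product
   factors through the tableau algebra.  The sum of the tensors in the cut
   coproduct, the linearization and the Jacobi--Trudi determinant in the columns
   are such functions; this gives Delta, L and J as algebra morphisms.

   With x_j = n + j - mu'_j and y_i = n + i - lam'_i, the (i, j) entry of the
   Jacobi--Trudi matrix is the column read along the diagonals x_j, x_j - 1, ...,
   y_i + 1, and deconcatenating a column cuts this interval.  The Cauchy--Binet
   formula therefore turns any algebra morphism compatible with deconcatenation
   into a sum over the shapes eta between mu and lam, so that J is a coalgebra
   map.  It commutes with antipodes because convolution inverses are unique.

   Both L h and the determinant of words satisfy one recursion.  The map
   a w |-> 1 (x) a w + a (x) w is an algebra morphism from quasi-shuffles to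
   (k + kA) (x) k<A>, and it determines a word up to its constant term.  On L h it
   splits off the first horizontal strip.  On the determinant Cauchy--Binet gives
   in k + kA a determinant of columns of length at most 1, whose Leibniz formula
   reduces to the diagonal term: the product of the entries of a horizontal strip,
   and 0 if some column has two boxes. *)

(** * Tensor products and quasi-shuffles *)

(** Cutting leaves the world of tableaux: [top t e] and [bot t e] may have rows without boxes and
    need not touch the first column. Hence the work is done on bare row lists, and
    [multiplicative_rows] says when a function forgets this extra data.

    Two pieces separated by a cut occupy disjoint sets of diagonals, so diagonal constancy is itself
    compatible with cuts ([diagonal_cat]). Therefore [dcl] and [jtrows] may be set to 0 on all other
    row lists and still give morphisms on the whole tableau algebra, the one that comes with a
    presentation; Delta and J are restrictions of these.

    The delicate point in using Cauchy--Binet is the convention that an entry involving a missing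
    diagonal is 0. A piece meets fewer diagonals than the whole, so its own matrix has more zeros
    than the minor produced by the formula. The determinants still agree: a permutation all of whose
    entries have nonnegative length reads only diagonals met by the shape ([seg_det_column],
    [jt_ext]).

    Multiplicativity of L is not checked on chains of strips: it follows from the recursion and the
    injectivity of the splitting ([alin_cat]). *)

Section LinearFunctions.
Variables (R : comNzRingType) (U V : lmodType R) (f : U -> V).
Hypothesis lf : linear f.

Lemma linear_fun0 : f 0 = 0.
Proof. by have := lf (-1) 0 0; rewrite !scaleN1r !addNr. Qed.

Lemma linear_funD x y : f (x + y) = f x + f y.
Proof. by have := lf 1 x y; rewrite !scale1r. Qed.

Lemma linear_funZ c x : f (c *: x) = c *: f x.
Proof. by have := lf c x 0; rewrite linear_fun0 !addr0. Qed.

End LinearFunctions.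

Section TensorInduction.
Variables (R : comNzRingType).

Lemma malg_ind (K : choiceType) (P : {malg R[K]} -> Prop) :
    P 0 -> (forall c x u, P u -> P (c *: << x >> + u)) -> forall u, P u.
Proof.
move=> P0 PD u; rewrite (monalgE u).
elim: (enum_fset (msupp u)) => [|x s IH]; first by rewrite big_nil.
rewrite big_cons.
have -> : << u@_x *g x >> = u@_x *: << x >> :> {malg R[K]}.
  by apply/malgP => y; rewrite mcoeffZ !mcoeffU mulr_natr.
exact: PD.
Qed.

Variables (M N : lmodType R).

Lemma tpureDl (x x' : M) (y : N) : tpure (x + x') y = tpure x y + tpure x' y.
Proof. by have /= := tpure_linear_l y 1 x x'; rewrite !scale1r. Qed.

Lemma tpure0l (y : N) : tpure (0 : M) y = 0.
Proof. by have := tpureDl 0 0 y; rewrite addr0 -{1}[tpure 0 y]addr0 => /addrI. Qed.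

Lemma tpureZl c (x : M) (y : N) : tpure (c *: x) y = c *: tpure x y.
Proof. by have /= := tpure_linear_l y c x 0; rewrite tpure0l !addr0. Qed.

Lemma tpureDr (x : M) (y y' : N) : tpure x (y + y') = tpure x y + tpure x y'.
Proof. by have /= := tpure_linear_r x 1 y y'; rewrite !scale1r. Qed.

Lemma tens_ind (P : tens M N -> Prop) :
    P 0 -> (forall x y t, P t -> P (tpure x y + t)) -> forall t, P t.
Proof.
move=> P0 PD t; rewrite -[t]tens_pi_repr.
elim/malg_ind: (repr t) => [|c [x y] u IH].
  by rewrite -/(tens_pi 0) linear0.
have -> : tens_pi (c *: << (x, y) >> + u) = tpure (c *: x) y + tens_pi u.
  rewrite linearP /=; congr (_ + _).
  by rewrite tpureZl.
exact: PD.
Qed.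

Lemma tens_linear_eq (V : lmodType R) (f g : tens M N -> V) :
    linear f -> linear g -> (forall x y, f (tpure x y) = g (tpure x y)) ->
  f =1 g.
Proof.
move=> lf lg fg; elim/tens_ind => [|x y t IH]; first by rewrite (linear_fun0 lf) (linear_fun0 lg).
by rewrite -[tpure x y]scale1r lf lg fg IH.
Qed.

End TensorInduction.

(** The identity behind the fact that a linear combination of two linear maps is linear;
    commutativity of [R] enters here. *)
Lemma scaler_interchange (R : comNzRingType) (V : lmodType R) (a b : R) (u v w x : V) :
  a *: (b *: u + v) + (b *: w + x) = b *: (a *: u + w) + (a *: v + x).
Proof. by rewrite !scalerDr !scalerA [b * a]mulrC addrACA. Qed.

Section TensorAlgebra.
Variables (R : comNzRingType) (M N : comAlgType R).

(** A separate name, so that the product is attached only to tensor products of algebras. The ring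
    may be trivial, since two nonzero algebras can have zero tensor product; this is why many rings
    below are only [comPzRingType]. *)
Definition talg : Type := tens M N.
HB.instance Definition _ := GRing.Lmodule.on talg.
Implicit Types t u v : talg.

Definition tmul_pure_l (a : M) (b : N) u : talg :=
  tlift (fun c d => tpure (a * c) (b * d) : tens M N) u.
Definition tmul t u : talg := tlift (fun a b => tmul_pure_l a b u) t.

Lemma tmul_pure_lE a b c d : tmul_pure_l a b (tpure c d) = tpure (a * c) (b * d).
Proof.
apply: (tlift_pure (b := fun c d => tpure (a * c) (b * d))) => [y e x x'|x e y y'];
  rewrite mulrDr -scalerAr; [exact: tpure_linear_l|exact: tpure_linear_r].
Qed.

Lemma tmul_pure_l_linear a b : linear (tmul_pure_l a b).
Proof.
by apply: tlift_linear => [y e x x'|x e y y']; rewrite mulrDr -scalerAr;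
  [apply: tpure_linear_l|apply: tpure_linear_r].
Qed.

Lemma tmul_pure_l_bilinear u :
  (forall y, linear (fun a => tmul_pure_l a y u)) /\
  (forall x, linear (fun b => tmul_pure_l x b u)).
Proof.
split=> y e x x'; move: u; apply: tens_linear_eq.
- exact: tmul_pure_l_linear.
- by move=> c u v /=; rewrite !tmul_pure_l_linear; apply: scaler_interchange.
- move=> c d; rewrite !tmul_pure_lE mulrDl -scalerAl; exact: tpure_linear_l.
- exact: tmul_pure_l_linear.
- by move=> c u v /=; rewrite !tmul_pure_l_linear; apply: scaler_interchange.
- move=> c d; rewrite !tmul_pure_lE mulrDl -scalerAl; exact: tpure_linear_r.
Qed.

Lemma tmul_linear_r t : linear (tmul t).
Proof.
move=> c u v; rewrite /tmul /tlift /mlift scaler_sumr -big_split.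
apply: eq_bigr => -[a b] _ /=.
by rewrite tmul_pure_l_linear scalerDr !scalerA mulrC.
Qed.

Lemma tmul_linear_l u : linear (tmul^~ u).
Proof. by apply: tlift_linear => y; apply (tmul_pure_l_bilinear u). Qed.

Lemma tmul_pure a b c d : tmul (tpure a b) (tpure c d) = tpure (a * c) (b * d).
Proof.
by rewrite /tmul tlift_pure ?tmul_pure_lE // => y; apply (tmul_pure_l_bilinear _).
Qed.

Lemma tmulC : commutative tmul.
Proof.
move=> t u; move: t; apply: tens_linear_eq; [exact: tmul_linear_l|exact: tmul_linear_r|].
move=> a b; move: u; apply: tens_linear_eq; [exact: tmul_linear_r|exact: tmul_linear_l|].
by move=> c d; rewrite !tmul_pure [c * a]mulrC [d * b]mulrC.
Qed.

Lemma tmulA : associative tmul.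
Proof.
move=> t u v; move: t; apply: tens_linear_eq.
- exact: tmul_linear_l.
- by move=> c x y; rewrite !tmul_linear_l.
move=> a b; move: u; apply: tens_linear_eq.
- by move=> c x y; rewrite tmul_linear_l tmul_linear_r.
- by move=> c x y; rewrite tmul_linear_r tmul_linear_l.
move=> c d; move: v; apply: tens_linear_eq.
- by move=> e x y; rewrite !tmul_linear_r.
- exact: tmul_linear_r.
by move=> e f; rewrite !tmul_pure !mulrA.
Qed.

Lemma tmul1 : left_id (tpure 1 1) tmul.
Proof.
apply: tens_linear_eq; [exact: tmul_linear_r|by []|].
by move=> a b; rewrite tmul_pure !mul1r.
Qed.

Lemma tmulZl c t u : c *: tmul t u = tmul (c *: t) u.
Proof. exact: (esym (linear_funZ (tmul_linear_l u) c t)). Qed.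

Lemma tmulDl : left_distributive tmul +%R.
Proof. by move=> t u v; rewrite -[t]scale1r tmul_linear_l !scale1r. Qed.

HB.instance Definition _ :=
  GRing.Zmodule_isComPzRing.Build talg tmulA tmulC tmul1 tmulDl.

End TensorAlgebra.

Lemma malg_linear_eq (R : comNzRingType) (K : choiceType) (V : lmodType R)
    (f g : {malg R[K]} -> V) :
  linear f -> linear g -> (forall x, f << x >> = g << x >>) -> f =1 g.
Proof.
move=> lf lg fg; elim/malg_ind => [|c x u IH]; first by rewrite (linear_fun0 lf) (linear_fun0 lg).
by rewrite lf lg fg IH.
Qed.

(* The words algebra is abstracted here to modules V and W with bases e and wd:
   unification would otherwise unfold the concrete monoid algebra. *)
Section AbstractQuasiShuffle.
Variables (k : comNzRingType) (A : Type) (V W : lmodType k).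
Variables (e : A -> V) (wd : seq A -> W).
Variables (d : V -> V -> V) (cat : V -> W -> W) (m : W -> W -> W).
Hypothesis extV : forall f g : V -> W, linear f -> linear g ->
  (forall a, f (e a) = g (e a)) -> f =1 g.
Hypothesis extW : forall f g : W -> W, linear f -> linear g ->
  (forall u, f (wd u) = g (wd u)) -> f =1 g.
Hypothesis d_linear_l : forall y, linear (fun x => d x y).
Hypothesis d_linear_r : forall x, linear (d x).
Hypothesis dC : commutative d.
Hypothesis dA : associative d.
Hypothesis cat_linear_l : forall w, linear (fun x => cat x w).
Hypothesis cat_linear_r : forall x, linear (cat x).
Hypothesis cat_word : forall a u, cat (e a) (wd u) = wd (a :: u).
Hypothesis m_linear_l : forall y, linear (fun x => m x y).
Hypothesis m_linear_r : forall x, linear (m x).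
Local Notation "x # y" := (m x y) (at level 40, left associativity).
Hypothesis m_nil_l : forall u, wd [::] # wd u = wd u.
Hypothesis m_nil_r : forall u, wd u # wd [::] = wd u.
Hypothesis m_cons : forall a u b v, wd (a :: u) # wd (b :: v) =
  cat (e a) (wd u # wd (b :: v)) + cat (e b) (wd (a :: u) # wd v)
  + cat (d (e a) (e b)) (wd u # wd v).
Implicit Types (x y z : V) (u v w : W).

Lemma abs_mDl u v w : (u + v) # w = u # w + v # w.
Proof. by have /= := m_linear_l w 1 u v; rewrite !scale1r. Qed.

Lemma abs_mZl c u v : (c *: u) # v = c *: (u # v).
Proof.
have m0 : 0 # v = 0 by have /= := m_linear_l v (-1) 0 0; rewrite !scaleN1r !addNr.
by have /= := m_linear_l v c u 0; rewrite m0 !addr0.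
Qed.

Lemma abs_mDr u v w : u # (v + w) = u # v + u # w.
Proof. by have := m_linear_r u 1 v w; rewrite !scale1r. Qed.

Lemma abs_catDr x v w : cat x (v + w) = cat x v + cat x w.
Proof. by have := cat_linear_r x 1 v w; rewrite !scale1r. Qed.

Lemma abs_m1 w : wd [::] # w = w.
Proof. by move: w; apply: extW => [||u]; [exact: m_linear_r|by []|exact: m_nil_l]. Qed.

(** Extending the recursion from letters and words to all of [V] and [W] makes it applicable again
    to the products which it creates, and these are no longer words. *)
Lemma abs_m_letters x y u v :
  cat x u # cat y v = cat x (u # cat y v) + cat y (cat x u # v) + cat (d x y) (u # v).
Proof.
have scalerDD c (a b a0 a' b' a0' : W) :
    c *: (a + b + a0) + (a' + b' + a0') = c *: a + a' + (c *: b + b') + (c *: a0 + a0').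
  by rewrite !scalerDr addrACA [_ + _ + (a' + b')]addrACA.
move: x; apply: extV => [c x x'|c x x'|a].
- by rewrite cat_linear_l (m_linear_l (cat y v)).
- by rewrite scalerDD !cat_linear_l d_linear_l cat_linear_l (m_linear_l v) cat_linear_r.
move: y; apply: extV => [c y y'|c y y'|b].
- by rewrite cat_linear_l m_linear_r.
- by rewrite scalerDD !cat_linear_l d_linear_r cat_linear_l m_linear_r cat_linear_r.
move: u; apply: extW => [c u u'|c u u'|u].
- by rewrite cat_linear_r (m_linear_l (cat _ v)).
- by rewrite scalerDD cat_linear_r !(m_linear_l _ c) !cat_linear_r.
move: v; apply: extW => [c v v'|c v v'|v].
- by rewrite cat_linear_r m_linear_r.
- by rewrite scalerDD cat_linear_r !m_linear_r !cat_linear_r.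
by rewrite !cat_word m_cons.
Qed.

Lemma abs_m_wordC (u v : seq A) : wd u # wd v = wd v # wd u.
Proof.
elim: u v => [|a u IHu]; first by move=> v; rewrite m_nil_l m_nil_r.
elim=> [|b v IHv]; first by rewrite m_nil_l m_nil_r.
by rewrite !m_cons -IHv !IHu dC [X in X + _]addrC.
Qed.

Lemma abs_mC : commutative m.
Proof.
move=> x y; move: x; apply: extW; [exact: m_linear_l|exact: m_linear_r|].
move=> u; move: y; apply: extW; [exact: m_linear_r|exact: m_linear_l|].
by move=> v; apply: abs_m_wordC.
Qed.

(** The seven terms correspond to the nonempty subsets of the three leading letters: the letters of
    the subset are merged by [d] and put in front. *)
Lemma abs_m_letters3 x y z u v w :
  let xu := cat x u in let yv := cat y v in let zw := cat z w in
  xu # (yv # zw) =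
    cat x (u # (yv # zw)) + cat y (xu # (v # zw)) + cat z (xu # (yv # w)) +
    (cat (d x y) (u # (v # zw)) + cat (d x z) (u # (yv # w)) +
     cat (d y z) (xu # (v # w))) +
    cat (d x (d y z)) (u # (v # w)).
Proof.
move=> xu yv zw; rewrite {1}/yv {1}/zw abs_m_letters -/yv -/zw !abs_mDr.
rewrite ![xu # cat _ _]abs_m_letters -/xu.
by rewrite !abs_catDr [LHS](AC (3*3*3) ((1*4*7)*2*5*(3*6*8)*9)).
Qed.

(** Associativity in a form symmetric under rotation: the seven terms of [abs_m_letters3] are
    permuted when the three factors are rotated, and each remaining product has smaller total
    length. *)
Lemma abs_m_word_rot (u v w : seq A) : wd u # (wd v # wd w) = wd w # (wd u # wd v).
Proof.
have [n] := ubnP (size u + size v + size w); elim: n => // n IHn in u v w *.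
case: u => [|a u] le; first by rewrite !abs_m1 abs_m_wordC.
case: v => [|b v] in le *; first by rewrite abs_m1 m_nil_r abs_m_wordC.
case: w => [|c w] in le *; first by rewrite abs_m1 m_nil_r.
rewrite -!cat_word !abs_m_letters3 !cat_word; rewrite /= !addnS !addSn in le.
rewrite (IHn u (b :: v) (c :: w)) ?(IHn (a :: u) v (c :: w)) ?(IHn (a :: u) (b :: v) w)
  ?(IHn u v (c :: w)) ?(IHn u (b :: v) w) ?(IHn (a :: u) v w) ?(IHn u v w) /= ?addnS ?addSn;
  try lia.
rewrite (dC (e c) (d _ _)) -dA ![d (e c) _]dC.
by rewrite [LHS](AC (3*3*1) ((3*1*2)*(5*6*4)*7)).
Qed.

Lemma abs_mA : associative m.
Proof.
move=> x y z; rewrite [RHS]abs_mC.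
move: x; apply: extW; [exact: m_linear_l| |].
  by move=> c x x'; rewrite m_linear_l m_linear_r.
move=> u; move: y; apply: extW.
- by move=> c y y'; rewrite m_linear_l m_linear_r.
- by move=> c y y'; rewrite !m_linear_r.
move=> v; move: z; apply: extW; [|exact: m_linear_l|].
  by move=> c z z'; rewrite !m_linear_r.
by move=> w; apply: abs_m_word_rot.
Qed.

End AbstractQuasiShuffle.

(** Bundled with its axioms because the ring structures below live on types indexed by the
    product. *)
Record comm_product (k : comNzRingType) (A : countType) := CommProduct {
  dia_fun :> {malg k[A]} -> {malg k[A]} -> {malg k[A]};
  dia_linear_l : forall y, linear (fun x => dia_fun x y);
  dia_linear_r : forall x, linear (dia_fun x);
  diaC : commutative dia_fun;
  diaA : associative dia_fun }.

(* Unlike words, whose ring product is concatenation, this copy carries the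
   quasi-shuffle product. *)
Definition qwords (k : comNzRingType) (A : countType) (d : comm_product k A) : Type :=
  words k A.
HB.instance Definition _ k A d := GRing.Lmodule.on (@qwords k A d).

(** The algebra k + kA: a unit is adjoined to kA, which need not have one for the product [d]. The
    scalar component stands for an empty head. *)
Definition unitization (k : comNzRingType) (A : countType) (d : comm_product k A) : Type :=
  (k^o * {malg k[A]})%type.
HB.instance Definition _ k A d := GRing.Lmodule.on (@unitization k A d).

Section Concatenation.
Variables (k : comNzRingType) (A : countType).
Local Notation words := (words k A).
Local Notation word := (@word k A).
Local Notation letters := (@letters k A).

Lemma letters_linear : linear letters.
Proof. exact: mlift_linear. Qed.

Lemma lettersU a : letters << a >> = word [:: a].
Proof. exact: mliftU. Qed.

Lemma word_cat u v : word u * word v = word (u ++ v).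
Proof.
by rewrite /word [LHS]fgmulUU mulr1; congr << _ >>; apply/val_inj; rewrite /= fmM.
Qed.

Lemma word1 : word [::] = 1.
Proof. by rewrite /word -fmoneE. Qed.

Lemma letters_word a w : letters << a >> * word w = word (a :: w).
Proof. by rewrite lettersU word_cat. Qed.

(** Scalars act through the constants [c%:MP], which are central because [k] is commutative,
    although concatenation is not. *)
Lemma concat_scaler c (x w : words) : x * (c *: w) = c *: (x * w).
Proof.
have cx : x * c%:MP = c%:MP * x.
  rewrite [LHS]fgmulgU [RHS]fgmulUg; apply: eq_bigr => u _.
  by rewrite mulm1 mul1m mulrC.
have E (y : words) : c *: y = c%:MP * y by rewrite mul_malgC.
rewrite [X in x * X]E [RHS]E; transitivity (x * c%:MP * w); first exact: mulrA.
by rewrite cx; apply/esym/mulrA.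
Qed.

Definition lcat (x : {malg k[A]}) (w : words) : words := letters x * w.

Lemma lcat_linear_l w : linear (fun x => lcat x w).
Proof. by move=> c x y; rewrite /lcat letters_linear mulrDl -scalerAl. Qed.

Lemma lcat_linear_r x : linear (lcat x).
Proof. by move=> c w w'; rewrite /lcat mulrDr concat_scaler. Qed.

Lemma lcat_word a (u : seq A) : lcat << a >> (word u) = word (a :: u).
Proof. exact: letters_word. Qed.

Lemma words_linear_eq (V : lmodType k) (f g : words -> V) :
  linear f -> linear g -> (forall u, f (word u) = g (word u)) -> f =1 g.
Proof. by move=> lf lg fg; apply: malg_linear_eq => // -[u]; apply: fg. Qed.

End Concatenation.

Section QuasiShuffle.
Variables (k : comNzRingType) (A : countType) (d : comm_product k A).
Local Notation words := (words k A).
Local Notation word := (@word k A).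
Implicit Types u v w : seq A.

Local Notation "x # y" := (qsh d x y) (at level 40, left associativity).

Lemma qsh_word2 u v : word u # word v = qsh_word d u v.
Proof. by rewrite /qsh /word mliftU mliftU. Qed.

Lemma qsh_linear_l (y : words) : linear (fun x => x # y).
Proof. exact: mlift_linear. Qed.

Lemma qsh_linear_r (x : words) : linear (qsh d x).
Proof.
move=> c y z; rewrite /qsh [LHS]/mlift scaler_sumr -big_split /=.
by apply: eq_bigr => u _; rewrite mlift_linear scalerDr !scalerA mulrC.
Qed.

Lemma qsh_nil_l u : word [::] # word u = word u.
Proof. by rewrite qsh_word2. Qed.

Lemma qsh_nil_r u : word u # word [::] = word u.
Proof. by rewrite qsh_word2; case: u. Qed.

Lemma qsh_cons a u b v : word (a :: u) # word (b :: v) =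
  lcat << a >> (word u # word (b :: v)) + lcat << b >> (word (a :: u) # word v)
  + lcat (d << a >> << b >>) (word u # word v).
Proof. by rewrite !qsh_word2 /lcat !lettersU. Qed.

Local Notation qwords := (qwords d).

Definition words_ext := @words_linear_eq k A words.
Definition letters_ext := @malg_linear_eq k A words.

Lemma qshC : commutative (qsh d).
Proof.
exact: (abs_mC words_ext (diaC d) qsh_linear_l qsh_linear_r qsh_nil_l qsh_nil_r qsh_cons).
Qed.

Lemma qshA : associative (qsh d).
Proof.
exact: (abs_mA letters_ext words_ext (dia_linear_l d) (dia_linear_r d) (diaC d) (diaA d)
  (@lcat_linear_l k A) (@lcat_linear_r k A) (@lcat_word k A)
  qsh_linear_l qsh_linear_r qsh_nil_l qsh_nil_r qsh_cons).
Qed.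

Lemma qsh1 : left_id (word [::]) (qsh d).
Proof. exact: (abs_m1 words_ext qsh_linear_r qsh_nil_l). Qed.

Lemma qshDl : left_distributive (qsh d) +%R.
Proof. exact: (abs_mDl qsh_linear_l). Qed.

Lemma word_nil_neq0 : word [::] != 0.
Proof.
apply/eqP => /(congr1 (mcoeff (FMonom [::]))) /eqP.
by rewrite mcoeffU1 eqxx mcoeff0 oner_eq0.
Qed.

HB.instance Definition _ :=
  GRing.Zmodule_isComNzRing.Build qwords qshA qshC qsh1 qshDl word_nil_neq0.

Fact qwords_scaleAl (c : k) (x y : qwords) : c *: (x * y) = (c *: x : qwords) * y.
Proof. exact: (esym (abs_mZl qsh_linear_l c x y)). Qed.
HB.instance Definition _ := GRing.Lmodule_isLalgebra.Build k qwords qwords_scaleAl.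
HB.instance Definition _ := GRing.Lalgebra_isComAlgebra.Build k qwords.

End QuasiShuffle.

Section AbstractUnitization.
Variables (k : comNzRingType) (V : lmodType k) (d : V -> V -> V).
Hypothesis d_linear_l : forall y, linear (fun x => d x y).
Hypothesis dC : commutative d.
Hypothesis dA : associative d.

Definition abs_umul (x y : (k^o * V)%type) : k^o * V :=
  (x.1 * y.1, x.1 *: y.2 + y.1 *: x.2 + d x.2 y.2).

Let dDl x y z : d (x + y) z = d x z + d y z.
Proof. by have /= := d_linear_l z 1 x y; rewrite !scale1r. Qed.
Let dDr x y z : d x (y + z) = d x y + d x z.
Proof. by rewrite ![d x _]dC dDl. Qed.
Let d0l z : d 0 z = 0.
Proof. by have /= := d_linear_l z (-1) 0 0; rewrite !scaleN1r !addNr. Qed.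
Let dZl c x z : d (c *: x) z = c *: d x z.
Proof. by have /= := d_linear_l z c x 0; rewrite d0l !addr0. Qed.
Let dZr c x z : d x (c *: z) = c *: d x z.
Proof. by rewrite ![d x _]dC dZl. Qed.

Lemma abs_umulC : commutative abs_umul.
Proof. by move=> x y; rewrite /abs_umul mulrC [X in (_, X + _)]addrC dC. Qed.

Lemma abs_umulA : associative abs_umul.
Proof.
move=> [a x] [b y] [c z]; rewrite /abs_umul /= mulrA; congr (_, _).
rewrite !(scalerDr, dDl, dDr, dZl, dZr, scalerA, dA) [c * a]mulrC [c * b]mulrC.
by rewrite [LHS](AC (4*3) (1*(2*4*6)*(3*5*7))).
Qed.

Lemma abs_umul1 : left_id (1, 0) abs_umul.
Proof. by move=> [a x]; rewrite /abs_umul /= mul1r scale1r scaler0 d0l !addr0. Qed.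

Lemma abs_umulDl : left_distributive abs_umul +%R.
Proof.
move=> [a x] [b y] [c z]; rewrite /abs_umul /=; congr (_, _); first exact: mulrDl.
rewrite dDl scalerDl scalerDr /=; by rewrite [LHS](AC (2*2*2) ((1*3*5)*(2*4*6))).
Qed.

Lemma abs_umulZl c x y : c *: abs_umul x y = abs_umul (c *: x) y.
Proof.
case: x y => [a x] [b y]; rewrite /abs_umul /=; congr (_, _); first exact: mulrA.
by rewrite dZl !scalerDr !scalerA [c * b]mulrC.
Qed.

End AbstractUnitization.

Section Unitization.
Variables (k : comNzRingType) (A : countType) (d : comm_product k A).

Local Notation unitization := (unitization d).
Lemma umul1_neq0 : (1, 0) != 0 :> unitization.
Proof. by apply/eqP => -[] /eqP; rewrite oner_eq0. Qed.

HB.instance Definition _ := GRing.Zmodule_isComNzRing.Build unitization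
  (abs_umulA (dia_linear_l d) (diaC d) (diaA d)) (abs_umulC (diaC d))
  (abs_umul1 (dia_linear_l d)) (abs_umulDl (dia_linear_l d)) umul1_neq0.

Fact unitization_scaleAl (c : k) (x y : unitization) :
  c *: (x * y) = (c *: x : unitization) * y.
Proof. exact: (abs_umulZl (dia_linear_l d) c x y). Qed.
HB.instance Definition _ :=
  GRing.Lmodule_isLalgebra.Build k unitization unitization_scaleAl.
HB.instance Definition _ := GRing.Lalgebra_isComAlgebra.Build k unitization.

End Unitization.

Section TensorAlgebraPure.
Variables (R : comNzRingType) (M N : comAlgType R).

Definition tpr (x : M) (y : N) : talg M N := tpure x y.

Lemma tprM (x x' : M) (y y' : N) : tpr x y * tpr x' y' = tpr (x * x') (y * y').
Proof. exact: tmul_pure. Qed.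

End TensorAlgebraPure.

Section HeadSplitting.
Variables (k : comNzRingType) (A : countType) (d : comm_product k A).
Local Notation words := (words k A).
Local Notation word := (@word k A).
Local Notation qwords := (qwords d).
Local Notation T := (talg (unitization d) qwords).

Definition uletter (x : {malg k[A]}) : unitization d := (0, x).

Lemma uletterM x y : uletter x * uletter y = uletter (d x y).
Proof. by congr (_, _); rewrite /= ?mulr0 ?scale0r ?addr0 ?add0r. Qed.

Definition headsplit_word (u : seq A) : T :=
  if u is a :: u' then tpr (uletter << a >>) (word u' : qwords) else 0.

Definition headsplit (w : words) : T := mlift (fun u : {fmonom A} => headsplit_word u) w.

Lemma headsplit_linear : linear headsplit.
Proof. exact: mlift_linear. Qed.

Lemma headsplitD x y : headsplit (x + y) = headsplit x + headsplit y.
Proof. by have := headsplit_linear 1 x y; rewrite !scale1r. Qed.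

Lemma headsplit_lcat x w :
  headsplit (lcat x w) = tpr (uletter x) (w : qwords).
Proof.
move: x; apply: malg_linear_eq.
- by move=> c x x'; rewrite lcat_linear_l headsplit_linear.
- move=> c x x'.
  have -> : uletter (c *: x + x') = c *: uletter x + uletter x'.
    by congr (_, _); rewrite /= scaler0 addr0.
  exact: (tpure_linear_l (w : qwords) c (uletter x) (uletter x')).
move=> a; move: w; apply: words_linear_eq.
- by move=> c w w'; rewrite lcat_linear_r headsplit_linear.
- by move=> c w w'; apply: (tpure_linear_r (uletter << a >>) c (w : qwords) w').
by move=> u; rewrite lcat_word /headsplit mliftU.
Qed.

(* The analogue for quasi-shuffles of deconcatenating the first letter; by
   dsplitM it is multiplicative. *)
Definition dsplit (w : qwords) : T := tpr 1 w + headsplit w.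

Lemma dsplit_linear : linear dsplit.
Proof.
move=> c x y; rewrite /dsplit headsplit_linear /tpr.
rewrite (tpure_linear_r (1 : unitization d) c (x : qwords) (y : qwords)).
by rewrite scalerDr [LHS]addrACA.
Qed.

Lemma dsplit_word a u :
  dsplit (word (a :: u)) = tpr 1 (word (a :: u) : qwords) + tpr (uletter << a >>) (word u : qwords).
Proof. by rewrite /dsplit /headsplit mliftU. Qed.

Lemma dsplit1 : dsplit (word [::]) = 1.
Proof. by rewrite /dsplit /headsplit mliftU addr0. Qed.

(** In the product of [1 (x) au + a (x) u] and [1 (x) bv + b (x) v], the three terms other than
    [1 (x) (au * bv)] have heads a, b and the product of a and b. They are the three summands of the
    quasi-shuffle recursion, with the first letter split off. *)
Lemma dsplitM : {morph dsplit : x y / x * y}.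
Proof.
move=> x y; move: x; apply: words_linear_eq.
- by move=> c u v; rewrite -dsplit_linear; congr dsplit; apply: (qsh_linear_l d y c u v).
- by move=> c u v; rewrite dsplit_linear; apply: tmul_linear_l.
move=> u; move: y; apply: words_linear_eq.
- by move=> c v w; rewrite -dsplit_linear; congr dsplit; apply: (qsh_linear_r d (word u) c v w).
- by move=> c v w; rewrite dsplit_linear; apply: tmul_linear_r.
move=> v; case: u => [|a u].
  rewrite dsplit1 mul1r; congr dsplit; exact: qsh1.
case: v => [|b v].
  rewrite dsplit1 mulr1; congr dsplit; exact: qsh_nil_r.
have foil (S : pzRingType) (a1 a2 b1 b2 c0 c1 c2 c3 : S) :
    a1 * b1 = c0 -> a2 * b1 = c1 -> a1 * b2 = c2 -> a2 * b2 = c3 ->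
    (a1 + a2) * (b1 + b2) = c0 + (c1 + c2 + c3).
  by move=> <- <- <- <-; rewrite mulrDr !mulrDl [LHS](AC (2*2) (1*(2*3*4))).
rewrite 2!dsplit_word.
have := @foil T (tpr 1 (word (a :: u) : qwords)) (tpr (uletter << a >>) (word u : qwords))
 (tpr 1 (word (b :: v) : qwords)) (tpr (uletter << b >>) (word v : qwords)) _ _ _ _
  (tprM _ _ _ _) (tprM _ _ _ _) (tprM _ _ _ _) (tprM _ _ _ _).
move=> ->.
rewrite uletterM.
rewrite (mul1r (1 : unitization d)) (mulr1 (uletter << a >>)).
rewrite (mul1r (uletter << b >>)).
rewrite {1}/dsplit; congr (_ + _).
apply: (etrans (congr1 headsplit (qsh_cons d a u b v))).
apply: (etrans (headsplitD _ _)); congr (_ + _); last exact: headsplit_lcat.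
by apply: (etrans (headsplitD _ _)); congr (_ + _); apply: headsplit_lcat.
Qed.

(** Undoes [headsplit] on nonempty words and kills [tpr 1 w], the other summand of [dsplit]. *)
Definition concat_head (t : tens (unitization d) qwords) : words :=
  tlift (fun (m : unitization d) (w : qwords) => lcat m.2 w : words) t.

Lemma concat_head_linear : linear concat_head.
Proof.
apply: tlift_linear => [w c x y|x c v w]; [exact: lcat_linear_l|exact: lcat_linear_r].
Qed.

Lemma concat_head_pure m w : concat_head (tpr m w) = lcat m.2 w.
Proof.
rewrite /concat_head /tpr (tlift_pure (b := fun (m : unitization d) w => lcat m.2 w : words)) //.
  by move=> y c x x'; apply: lcat_linear_l.
by move=> x c v v'; apply: lcat_linear_r.
Qed.

Lemma concat_head_dsplit w :
  concat_head (dsplit w) = w - w@_(FMonom [::]) *: word [::].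
Proof.
move: w; apply: words_linear_eq.
- by move=> c u v; rewrite dsplit_linear concat_head_linear.
- move=> c u v; rewrite mcoeffD mcoeffZ scalerBr scalerDl scalerA opprD.
  by rewrite [LHS]addrACA.
have lcat0 w : lcat 0 w = 0 :> words.
  by have /= := lcat_linear_l w (-1) 0 0; rewrite !scaleN1r !addNr.
have concat_headD x y : concat_head (x + y) = concat_head x + concat_head y.
  by have := concat_head_linear 1 x y; rewrite !scale1r.
move=> u; rewrite /dsplit /headsplit mliftU concat_headD concat_head_pure.
rewrite lcat0 add0r /word mcoeffU1.
case: u => [|a u]; rewrite /headsplit_word.
  rewrite eqxx scale1r subrr.
  by have := concat_head_linear (-1) 0 0; rewrite !scaleN1r !addNr.
have /negPf -> : FMonom (a :: u) != FMonom [::] by rewrite -(inj_eq val_inj).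
by rewrite scale0r subr0 concat_head_pure; apply: lcat_word.
Qed.

End HeadSplitting.

(** * Multiplicative functions of tableaux *)

Lemma geq_trans : transitive geq.
Proof. by move=> a b c /= ab ca; apply: leq_trans ca ab. Qed.

Section Rows.
Variable A : countType.
Implicit Types (r : trow A) (t : seq (trow A)) (e : seq nat).

Definition starts t := map row_start t.
Definition ends t := map row_end t.

(** Asked of all pairs of rows, not only of the two adjacent ones: this form passes to [top] and
    [bot] and also covers an empty [t1] or [t2]. *)
Definition cutok t1 t2 : bool :=
  allrel (fun r1 r2 => row_end r2 <= row_start r1)%N t1 t2.

Definition up m t : seq (trow A) := [seq ((r.1 + m)%N, r.2) | r <- t].

(** For a partition eta given by [e], [top] and [bot] are the restrictions to eta/mu and lam/eta. No
    row is dropped, even if it becomes empty, so that both halves keep the row numbering of [t]. *)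
Definition top t e : seq (trow A) :=
  [seq (p.1.1, take (p.2 - p.1.1) p.1.2) | p <- zip t e].
Definition bot t e : seq (trow A) :=
  [seq (p.2, drop (p.2 - p.1.1) p.1.2) | p <- zip t e].

Definition fits t e : bool :=
  all2 (fun r x => row_start r <= x <= row_end r)%N t e.

Fixpoint boxes t : seq (seq nat) :=
  if t is r :: t' then [seq x :: e | x <- iota r.1 (size r.2).+1, e <- boxes t']
  else [:: [::]].
(** The partitions eta of the cut coproduct, listed from the rows alone so that they make sense for
    untrimmed pieces. *)
Definition cuts t : seq (seq nat) := [seq e <- boxes t | sorted geq e].

Lemma boxes_cons r t :
  boxes (r :: t) = allpairs cons (iota r.1 (size r.2).+1) (boxes t).
Proof. by []. Qed.

Lemma mem_boxes t e : (e \in boxes t) = fits t e.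
Proof.
elim: t e => [|r t IH] e; first by case: e.
rewrite boxes_cons; case: e => [|x e].
  by apply/negbTE/negP => /allpairsP [[y f] [_ _]].
have -> : fits (r :: t) (x :: e) = (row_start r <= x <= row_end r)%N && fits t e by [].
rewrite -IH; apply/allpairsP/andP => [[[y f] [yr ft [-> ->]]]|[xr et]].
  by split=> //; move: yr; rewrite mem_iota addnS ltnS.
by exists (x, e); split=> //; rewrite mem_iota addnS ltnS.
Qed.

Lemma boxes_uniq t : uniq (boxes t).
Proof.
elim: t => [//|r t IH]; rewrite boxes_cons; apply: allpairs_uniq => //.
  exact: iota_uniq.
by move=> [x e] [y f] _ _ /= [-> ->].
Qed.

Lemma mem_cuts t e : (e \in cuts t) = sorted geq e && fits t e.
Proof. by rewrite mem_filter mem_boxes. Qed.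

Lemma cuts_uniq t : uniq (cuts t).
Proof. exact/filter_uniq/boxes_uniq. Qed.

Lemma fits_size t e : fits t e -> size e = size t.
Proof. by rewrite /fits all2E => /andP[/eqP->]. Qed.

Lemma fits_starts t : fits t (starts t).
Proof. by elim: t => //= r t ->; rewrite leqnn leq_addr. Qed.

Lemma fits_ends t : fits t (ends t).
Proof. by elim: t => //= r t ->; rewrite leqnn leq_addr. Qed.

Lemma starts_cuts t : skew_rows t -> starts t \in cuts t.
Proof. by case/andP=> s1 s2; rewrite mem_cuts s1 fits_starts. Qed.

Lemma ends_cuts t : skew_rows t -> ends t \in cuts t.
Proof. by case/andP=> s1 s2; rewrite mem_cuts s2 fits_ends. Qed.

Lemma starts_top t e : fits t e -> starts (top t e) = starts t.
Proof. by elim: t e => [|r t IH] [|x e] //= /andP[_ /IH <-]. Qed.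

Lemma ends_top t e : fits t e -> ends (top t e) = e.
Proof.
elim: t e => [|r t IH] [|x e] //= /andP[/andP[sx xe] /IH]; rewrite /ends /top /= => ->.
congr (_ :: _); rewrite /row_end /= size_takel; first by rewrite subnKC.
by rewrite leq_subLR.
Qed.

Lemma starts_bot t e : fits t e -> starts (bot t e) = e.
Proof. by elim: t e => [|r t IH] [|x e] //= /andP[_ /IH]; rewrite /starts /bot /= => ->. Qed.

Lemma ends_bot t e : fits t e -> ends (bot t e) = ends t.
Proof.
elim: t e => [|r t IH] [|x e] //= /andP[/andP[sx xe] /IH <-]; congr (_ :: _).
rewrite /row_end /= size_drop; rewrite /row_end /row_start in sx xe; lia.
Qed.

Lemma size_top t e : fits t e -> size (top t e) = size t.
Proof. by move=> /fits_size es; rewrite size_map size_zip es minnn. Qed.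

Lemma size_bot t e : fits t e -> size (bot t e) = size t.
Proof. by move=> /fits_size es; rewrite size_map size_zip es minnn. Qed.

Lemma skew_top t e : skew_rows t -> e \in cuts t -> skew_rows (top t e).
Proof.
case/andP=> s1 s2; rewrite mem_cuts /skew_rows => /andP[se fe].
by rewrite -/(starts _) -/(ends _) starts_top // ends_top // s1.
Qed.

Lemma skew_bot t e : skew_rows t -> e \in cuts t -> skew_rows (bot t e).
Proof.
case/andP=> s1 s2; rewrite mem_cuts /skew_rows => /andP[se fe].
by rewrite -/(starts _) -/(ends _) starts_bot // ends_bot // se.
Qed.

Lemma top_starts t : boxless (top t (starts t)).
Proof. by elim: t => //= r t ->; rewrite subnn take0. Qed.

Lemma bot_starts t : bot t (starts t) = t.
Proof. by elim: t => //= -[a s] t; rewrite /bot /= subnn drop0 => ->. Qed.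

Lemma top_ends t : top t (ends t) = t.
Proof. by elim: t => //= -[a s] t; rewrite /top /row_end /= addKn take_size => ->. Qed.

Lemma bot_ends t : boxless (bot t (ends t)).
Proof. by elim: t => //= r t ->; rewrite /row_end addKn drop_size. Qed.

Lemma fits_cat t1 t2 e1 e2 : size e1 = size t1 ->
  fits (t1 ++ t2) (e1 ++ e2) = fits t1 e1 && fits t2 e2.
Proof. by elim: t1 e1 => [|r t IH] [|x e] //= [] /IH ->; rewrite andbA. Qed.

Lemma top_cat t1 t2 e1 e2 : size e1 = size t1 ->
  top (t1 ++ t2) (e1 ++ e2) = top t1 e1 ++ top t2 e2.
Proof. by move=> es; rewrite /top zip_cat // map_cat. Qed.

Lemma bot_cat t1 t2 e1 e2 : size e1 = size t1 ->
  bot (t1 ++ t2) (e1 ++ e2) = bot t1 e1 ++ bot t2 e2.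
Proof. by move=> es; rewrite /bot zip_cat // map_cat. Qed.

Lemma cutokE t1 t2 : cutok t1 t2 = allrel (fun x y => y <= x)%N (starts t1) (ends t2).
Proof. by rewrite /cutok /starts /ends allrel_mapl allrel_mapr. Qed.

Lemma fits_ge t e x : fits t e -> all (leq x) (starts t) -> all (leq x) e.
Proof.
move=> f; elim: t e f => [|r' t IH] [|y e] //= /andP[/andP[ry _] /IH {}IH] /andP[xr /IH ->].
by rewrite (leq_trans xr ry).
Qed.
Lemma fits_le t e x : fits t e -> all (geq x) (ends t) -> all (geq x) e.
Proof.
move=> f; elim: t e f => [|r' t IH] [|y e] //= /andP[/andP[_ ry] /IH {}IH] /andP[xr /IH ->].
by rewrite (leq_trans ry xr).
Qed.

Lemma skew_cat t1 t2 : skew_rows (t1 ++ t2) -> skew_rows t1 /\ skew_rows t2.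
Proof. by move=> st; split; apply: skew_rows_subseq st; [exact: prefix_subseq|exact: suffix_subseq]. Qed.

Lemma cutok_fits t1 t2 e1 e2 : fits t1 e1 -> fits t2 e2 -> cutok t1 t2 ->
  allrel (fun x y => y <= x)%N e1 e2.
Proof.
move=> f1 f2 /allrelP ok; apply/allrelP => x y.
move: f1 f2; rewrite /fits !all2E => /andP[/eqP z1 /all_nthP n1] /andP[/eqP z2 /all_nthP n2].
move=> /(nthP 0%N) [i ilt <-] /(nthP 0%N) [j jlt <-].
have /(_ i) := n1 ((0%N, [::]), 0%N); have /(_ j) := n2 ((0%N, [::]), 0%N).
rewrite !size1_zip ?z1 ?z2 // => /(_ jlt) + /(_ ilt).
rewrite !nth_zip //= => /andP[_ le2] /andP[le1 _].
apply: leq_trans le2 (leq_trans _ le1).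
by apply: ok; apply: mem_nth; rewrite ?z1 ?z2.
Qed.

Lemma cutok_top t1 t2 e1 e2 : fits t1 e1 -> fits t2 e2 -> cutok t1 t2 ->
  cutok (top t1 e1) (top t2 e2).
Proof.
by move=> f1 f2 ok; rewrite cutokE starts_top // ends_top //; apply: cutok_fits ok => //; apply: fits_starts.
Qed.

Lemma cutok_bot t1 t2 e1 e2 : fits t1 e1 -> fits t2 e2 -> cutok t1 t2 ->
  cutok (bot t1 e1) (bot t2 e2).
Proof.
by move=> f1 f2 ok; rewrite cutokE starts_bot // ends_bot //; apply: cutok_fits ok => //; apply: fits_ends.
Qed.

Lemma sorted_cat_geq e1 e2 : allrel (fun x y => y <= x)%N e1 e2 ->
  sorted geq (e1 ++ e2) = sorted geq e1 && sorted geq e2.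
Proof.
move=> h; rewrite !(sorted_pairwise geq_trans) pairwise_cat.
by have -> : allrel geq e1 e2 by exact: h.
Qed.

(** Every part of a partition inside [t1] is at least every part of one inside [t2], so sortedness
    across the joint is automatic and the two partitions are chosen independently. *)
Lemma cuts_cat t1 t2 : cutok t1 t2 ->
  perm_eq (cuts (t1 ++ t2)) [seq e1 ++ e2 | e1 <- cuts t1, e2 <- cuts t2].
Proof.
move=> ok; apply: uniq_perm; first exact: cuts_uniq.
  apply: allpairs_uniq; [exact: cuts_uniq|exact: cuts_uniq|].
  move=> [e1 e2] [f1 f2] /allpairsP[[? ?] [/= + + [-> ->]]] /allpairsP[[? ?] [/= + + [-> ->]]].
  rewrite !mem_cuts => /andP[_ /fits_size z1] _ /andP[_ /fits_size z2] _ /= /eqP.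
  by rewrite eqseq_cat ?z1 ?z2 // => /andP[/eqP-> /eqP->].
move=> e; rewrite mem_cuts; apply/andP/allpairsP => [[se fe]|[[e1 e2] [/= + + ->]]].
  have sz : size (take (size t1) e) = size t1.
    by rewrite size_takel // (fits_size fe) size_cat leq_addr.
  move: se fe; rewrite -(cat_take_drop (size t1) e) fits_cat // => + /andP[f1 f2].
  rewrite sorted_cat_geq; last exact: (cutok_fits f1 f2 ok).
  case/andP=> s1 s2; exists (take (size t1) e, drop (size t1) e).
  by split; rewrite /= ?mem_cuts ?s1 ?s2.
rewrite !mem_cuts => /andP[s1 f1] /andP[s2 f2].
by rewrite fits_cat ?(fits_size f1) // sorted_cat_geq ?s1 ?f1 //; apply: cutok_fits ok.
Qed.

Lemma starts_up m t : starts (up m t) = map (addn m) (starts t).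
Proof. by rewrite /starts /up -!map_comp; apply: eq_map => r /=; rewrite addnC. Qed.

Lemma ends_up m t : ends (up m t) = map (addn m) (ends t).
Proof. by rewrite /ends /up -!map_comp; apply: eq_map => r; rewrite /= /row_end /= [(_ + m)%N]addnC addnA. Qed.

Lemma sorted_addn m e : sorted geq (map (addn m) e) = sorted geq e.
Proof. by rewrite sorted_map; apply: eq_sorted => x y /=; rewrite leq_add2l. Qed.

Lemma skew_up m t : skew_rows (up m t) = skew_rows t.
Proof. by rewrite /skew_rows -/(starts _) -/(ends _) starts_up ends_up !sorted_addn. Qed.

Lemma boxes_up m t : boxes (up m t) = map (map (addn m)) (boxes t).
Proof.
elim: t => [//|r t IH]; rewrite -[up m (r :: t)]/(((r.1 + m)%N, r.2) :: up m t) !boxes_cons IH map_allpairs.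
rewrite -[((r.1 + m)%N, r.2).1]/(r.1 + m)%N -[((r.1 + m)%N, r.2).2]/r.2.
have -> s : iota (r.1 + m) s = map (addn m) (iota r.1 s) by rewrite addnC iotaDl.
rewrite /allpairs -map_comp; congr flatten; apply: eq_map => x.
by rewrite /= -!map_comp.
Qed.

Lemma cuts_up m t : cuts (up m t) = map (map (addn m)) (cuts t).
Proof.
rewrite /cuts boxes_up filter_map; congr map; apply: eq_filter => e /=.
exact: sorted_addn.
Qed.

Lemma top_up m t e : top (up m t) (map (addn m) e) = up m (top t e).
Proof.
elim: t e => [|r t IH] [|x e] //=; rewrite /top /= -/(top _ _) IH; congr ((_, take _ _) :: _).
by rewrite addnC subnDr.
Qed.

Lemma bot_up m t e : bot (up m t) (map (addn m) e) = up m (bot t e).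
Proof.
elim: t e => [|r t IH] [|x e] //=; rewrite /bot /= -/(bot _ _) IH; congr ((_, drop _ _) :: _).
  by rewrite addnC.
by rewrite addnC subnDr.
Qed.

Lemma boxless_up m t : boxless (up m t) = boxless t.
Proof. by rewrite /boxless all_map. Qed.

Lemma boxless_cat t1 t2 : boxless (t1 ++ t2) = boxless t1 && boxless t2.
Proof. exact: all_cat. Qed.

(** Ends decrease down the rows, so the rows ending in 0 come last. *)
Lemma trim_split t : skew_rows t -> t = trim t ++ [seq r <- t | row_end r == 0%N].
Proof.
elim: t => [//|r t IH] st; have [_ st2] := @skew_cat [:: r] t st.
rewrite /trim /=; case: (posnP (row_end r)) => [r0|_] /=; last by rewrite -/(trim t) -IH.
have ends0 r' : r' \in t -> row_end r' = 0%N.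
  move=> r't; case/andP: st => _ /(order_path_min geq_trans) /allP /(_ (row_end r')).
  by rewrite map_f // => /(_ isT) /=; rewrite r0 leqn0 => /eqP.
have -> : [seq r0 <- t | (0 < row_end r0)%N] = [::].
  by rewrite (eq_in_filter (a2 := pred0)) ?filter_pred0 // => r' /ends0 ->.
by rewrite (eq_in_filter (a2 := predT)) ?filter_predT // => r' /ends0 ->.
Qed.

End Rows.

Section Multiplicative.
Variables (A : countType) (B : comPzRingType).

(** With [mrow_up] and [mrow_cat], the condition [mrow_zero] makes rows without boxes invisible
    wherever they start, so [phi] does not notice trimming. *)
Record multiplicative_rows (phi : seq (trow A) -> B) : Prop := MultRows {
  mrow_nil : phi [::] = 1;
  mrow_zero : phi [:: (0%N, [::])] = 1;
  mrow_cat : forall t1 t2, skew_rows (t1 ++ t2) -> cutok t1 t2 ->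
    phi (t1 ++ t2) = phi t1 * phi t2;
  mrow_up : forall m t, skew_rows t -> phi (up m t) = phi t }.

Section Theory.
Implicit Types (r : trow A) (t : seq (trow A)).
Variables (phi : seq (trow A) -> B) (phiP : multiplicative_rows phi).

Lemma mrow_boxless t : skew_rows t -> boxless t -> phi t = 1.
Proof.
elim: t => [|r t IH] st bt; first by rewrite (mrow_nil phiP).
move: (bt) => /= /andP[/eqP/size0nil r0 bt'].
have [st1 st2] := @skew_cat _ [:: r] t st.
rewrite -cat1s (mrow_cat phiP) // ?IH //; last first.
  case/andP: st => /(order_path_min (@geq_trans)) s1 _; rewrite /cutok allrel1l.
  apply/allP => r' r't; move: (allP s1 (row_start r')); rewrite map_f // => /(_ isT).
  by have /eqP/size0nil r'0 := allP bt' r' r't; rewrite /= /row_end r'0 addn0.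
have -> : [:: r] = up r.1 [:: (0%N, [::]) : trow A] by rewrite /up /= add0n -r0; case: (r).
by rewrite (mrow_up phiP) // (mrow_zero phiP) mulr1.
Qed.

Lemma mrow_trim t : skew_rows t -> phi (trim t) = phi t.
Proof.
move=> st; rewrite [in RHS](trim_split st) mrow_cat -?trim_split //; last first.
  by apply/allrelP => r r' _; rewrite mem_filter => /andP[/eqP->].
rewrite [phi (filter _ _)]mrow_boxless ?mulr1 //.
  exact: skew_rows_subseq (filter_subseq _ _) st.
by apply/allP => r; rewrite mem_filter /row_end => /andP[]; lia.
Qed.

Lemma shift_rows_up t : skew_rows t -> up (last 0%N (starts t)) (shift_rows t) = t.
Proof.
case/andP=> s1 _; rewrite /up /shift_rows -map_comp -[RHS]map_id.
apply/eq_in_map => r rt /=; rewrite subnK; first by case: r {rt}.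
move: s1 rt; rewrite -/(starts t); elim/last_ind: t => [//|t x _].
rewrite /starts map_rcons last_rcons (sorted_pairwise geq_trans) pairwise_rcons.
case/andP=> /allP al _; rewrite mem_rcons inE => /orP[/eqP->//|rt].
by apply: al; apply: map_f.
Qed.

Lemma cut_rows_split r t : skew_rows (r :: t) ->
  let c := cut_rows (r :: t) in let p := head [::] c in
  [/\ r \in p, r :: t = p ++ flatten (behead c), cutok p (flatten (behead c))
    & behead c = cut_rows (flatten (behead c))].
Proof.
elim: t r => [|r' t IH] r st; first by rewrite /= inE eqxx; split=> //; apply: allrel0r.
have [_ st'] := @skew_cat _ [:: r] (r' :: t) st.
have := IH r' st'; rewrite cut_rows_cons2; cbv zeta.
set c := cut_rows (r' :: t); set p := head _ c => -[rp tE okp cE].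
case: ifP => rr' /=.
  have fc : flatten c = r' :: t by apply: flatten_cut_rows.
  rewrite inE eqxx fc; split=> //; rewrite /cutok allrel1l; apply/allP => x.
  case/andP: st => _ /= /andP[_ s2]; rewrite inE => /orP[/eqP->//|xt].
  apply: leq_trans rr'; have /allP/(_ (row_end x)) := order_path_min (@geq_trans) s2.
  by rewrite map_f // => /(_ isT).
rewrite inE eqxx tE; split=> //.
rewrite /cutok allrel_consl; apply/andP; split; last exact: okp.
apply/allP => x xf.
apply: leq_trans (allrelP okp _ _ rp xf) _.
by case/andP: st => /= /andP[].
Qed.

Lemma mrow_pieces t : skew_rows t -> phi t = \prod_(p <- cut_rows t) phi p.
Proof.
have [n] := ubnP (size t); elim: n => // n IH in t *.
case: t => [_ _|r t lt st]; first by rewrite (mrow_nil phiP) big_nil.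
have := cut_rows_split st; cbv zeta; case=> rp tE ok cE.
have [c0 cnil] : exists c0, cut_rows (r :: t) = head [::] (cut_rows (r :: t)) :: c0.
  by move: rp; case: (cut_rows (r :: t)) => [|p c] // _; exists c.
move: rp tE ok cE; rewrite cnil /=; set p := head _ _; move=> rp tE ok cE.
have [_ st2] := skew_cat (etrans (congr1 _ (esym tE)) st).
rewrite tE mrow_cat -?tE // big_cons; congr (_ * _); rewrite [in RHS]cE; apply: IH => //.
have p0 : (0 < size p)%N by case: (p) rp.
have := congr1 size tE; rewrite size_cat; move: lt; rewrite /=; lia.
Qed.

(** This is the relation divided out in the tableau algebra. Each piece of [SC h] is untrimmed by
    [mrow_trim] and moved back by [mrow_up]. *)
Lemma mrow_SC (h : tableau A) : phi h = \prod_(i <- SC h) phi i.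
Proof.
have /andP[sk _] := rowsP h.
rewrite (mrow_pieces sk) /SC big_map big_seq [RHS]big_seq; apply: eq_bigr => p pc.
have skp := skew_rows_piece sk pc.
rewrite rows_mktab ?skew_rows_shift // mrow_trim ?skew_rows_shift //.
by rewrite -[in LHS](shift_rows_up skp) mrow_up ?skew_rows_shift.
Qed.

End Theory.
End Multiplicative.

Section MonomialEvaluation.
Variables (I : choiceType) (B : comNzRingType) (phi : I -> B).

Definition meval (m : {cmonom I}) : B := \prod_(i <- finsupp m) phi i ^+ m i.

Lemma mevalEw (s : {fset I}) (m : {cmonom I}) : (finsupp m `<=` s)%fset ->
  meval m = \prod_(i <- s) phi i ^+ m i.
Proof.
move=> le; apply: big_fset_incl le _ => i _; rewrite -cmE_eq0 => /eqP->.
exact: expr0.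
Qed.

Fact meval_morphism : mmorphism meval.
Proof.
split=> [m n|]; last by rewrite /meval mdom1 big_seq_fset0.
rewrite (mevalEw (s := finsupp m `|` finsupp n)%fset) ?mdomD //.
rewrite [meval m](mevalEw (fsubsetUl _ (finsupp n))).
rewrite [meval n](mevalEw (fsubsetUr (finsupp m) _)) -big_split /=.
by apply: eq_bigr => i _; rewrite cmM exprD.
Qed.
HB.instance Definition _ := monalg.isMultiplicative.Build _ B meval meval_morphism.

Lemma mevalU i : meval (ucm i) = phi i.
Proof. by rewrite /meval mdomU big_seq_fset1 cmUU expr1. Qed.

End MonomialEvaluation.

Section UniversalProperty.
Variables (k : comNzRingType) (A : countType) (B : comAlgType k).
Variables (phi : seq (trow A) -> B) (phiP : multiplicative_rows phi).

Let ev : {rmorphism {malg k[{cmonom (tableau A)}]} -> B} :=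
  mmap (in_alg B : {rmorphism k -> B}) (meval (fun h : tableau A => phi h)).

(** Evaluating each variable [h] at [phi h] kills the generators of [cut_ideal]: the unit relation
    by [mrow_nil], the cut relations by [mrow_SC]. *)
Lemma tabalg_universal :
  exists f : {lrmorphism tabalg k A -> B}, forall h, f (tcls k h) = phi h.
Proof.
have evX h : ev (tvar k h) = phi h.
  by rewrite tvar.unlock /ev /= mmapU /= scale1r mul1r; apply: mevalU.
have ev0 p : cut_ideal p -> ev p = 0.
  elim=> [|h||x y _ IHx _ IHy|x y _ IHy].
  - by rewrite rmorphB evX rmorph1 (mrow_nil phiP) subrr.
  - rewrite rmorphB evX rmorph_prod (mrow_SC phiP).
    by rewrite [X in _ - X](eq_bigr (fun i : tableau A => phi i)) ?subrr.
  - exact: rmorph0.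
  - by rewrite rmorphB IHx IHy subrr.
  - by rewrite rmorphM IHy mulr0.
(* Evaluation of a chosen representative; [Fpi] shows independence of the choice. *)
pose F (x : tabalg k A) : B := ev (repr x).
have Fpi p : F (tabalg_pi p) = ev p.
  apply/eqP; rewrite -subr_eq0 -rmorphB; apply/eqP/ev0.
  suff : tabalg_pi (repr (tabalg_pi p)) = tabalg_pi p.
    by move/eqP; rewrite -Quotient.idealrBE => /asboolP.
  exact: tabalg_pi_repr.
have FB : zmod_morphism F.
  move=> x y; rewrite -[x]tabalg_pi_repr -[y]tabalg_pi_repr -rmorphB /= !Fpi.
  exact: rmorphB.
have FM : monoid_morphism F.
  split; first by rewrite -(rmorph1 (@tabalg_pi k A)) Fpi rmorph1.
  move=> x y; rewrite -[x]tabalg_pi_repr -[y]tabalg_pi_repr -rmorphM /= !Fpi.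
  exact: rmorphM.
have FZ : scalable F.
  move=> c x; rewrite -[c *: x]/(tabalg_C A c * x) FM.2 Fpi.
  by rewrite -mul_malgC mulr1 /ev /= mmapC mulr_algl.
pose FBi := GRing.isZmodMorphism.Build _ _ F FB.
pose FMi := GRing.isMonoidMorphism.Build _ _ F FM.
pose FZi := GRing.isScalable.Build _ _ _ _ F FZ.
pose G : {lrmorphism tabalg k A -> B} := HB.pack F FBi FMi FZi.
by exists G => h; rewrite tcls.unlock; apply: etrans (Fpi _) (evX _).
Qed.

End UniversalProperty.

Section Convolution.
Variables (A : countType) (B : comPzRingType).
Implicit Types (t : seq (trow A)) (phi psi : seq (trow A) -> B).

Definition convolution phi psi t : B :=
  \sum_(e <- cuts t) phi (top t e) * psi (bot t e).

(** By [cuts_cat] the sum over the cuts of a concatenation is a double sum, and commutativity of [B]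
    sorts its factors by piece. *)
Lemma multiplicative_convolution phi psi : multiplicative_rows phi ->
  multiplicative_rows psi -> multiplicative_rows (convolution phi psi).
Proof.
move=> phiP psiP; split.
- by rewrite /convolution big_seq1 /= (mrow_nil phiP) (mrow_nil psiP) mulr1.
- by rewrite /convolution big_seq1 /= (mrow_zero phiP) (mrow_zero psiP) mulr1.
- move=> t1 t2 st ok; have [st1 st2] := skew_cat st.
  rewrite /convolution (perm_big _ (cuts_cat ok)) big_allpairs_dep mulr_suml /=.
  rewrite big_seq [RHS]big_seq; apply: eq_bigr => e1 c1; rewrite mulr_sumr.
  rewrite big_seq [RHS]big_seq; apply: eq_bigr => e2 c2.
  have /andP[_ f1] : sorted geq e1 && fits t1 e1 by rewrite -mem_cuts.
  have /andP[_ f2] : sorted geq e2 && fits t2 e2 by rewrite -mem_cuts.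
  have c12 : e1 ++ e2 \in cuts (t1 ++ t2).
    by rewrite (perm_mem (cuts_cat ok)); apply/allpairsP; exists (e1, e2).
  rewrite top_cat ?(fits_size f1) // bot_cat ?(fits_size f1) //.
  rewrite (mrow_cat phiP) ?cutok_top //; last by rewrite -top_cat ?(fits_size f1) ?skew_top.
  rewrite (mrow_cat psiP) ?cutok_bot //; last by rewrite -bot_cat ?(fits_size f1) ?skew_bot.
  exact: mulrACA.
move=> m t st; rewrite /convolution cuts_up big_map big_seq [RHS]big_seq.
apply: eq_bigr => e ec; rewrite top_up bot_up (mrow_up phiP) ?skew_top //.
by rewrite (mrow_up psiP) ?skew_bot.
Qed.

Lemma multiplicative_rmorph (B' : comPzRingType) (f : B -> B') phi :
  monoid_morphism f -> multiplicative_rows phi -> multiplicative_rows (f \o phi).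
Proof.
move=> [f1 fM] phiP; split=> /=.
- by rewrite (mrow_nil phiP).
- by rewrite (mrow_zero phiP).
- by move=> t1 t2 st ok; rewrite (mrow_cat phiP).
by move=> m t st; rewrite (mrow_up phiP).
Qed.

Lemma multiplicative_boxless :
  multiplicative_rows (fun t : seq (trow A) => (boxless t)%:R : B).
Proof.
split=> // [t1 t2 _ _|m t _]; first by rewrite boxless_cat -mulnb natrM.
by rewrite boxless_up.
Qed.

End Convolution.

(** * Jacobi--Trudi determinants *)

Section CauchyBinet.
Variables (R : comPzRingType) (s N : nat).
Implicit Types (f g : {ffun 'I_s -> 'I_N}).

Definition increasing g := [forall i : 'I_s, forall j : 'I_s, (i < j)%N ==> (g i < g j)%N].

Lemma increasingP g :
  reflect (forall i j : 'I_s, (i < j)%N -> (g i < g j)%N) (increasing g).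
Proof.
apply: (iffP forallP) => [h i j ij|h i]; first by move/forallP/(_ j)/implyP: (h i); apply.
by apply/forallP => j; apply/implyP; apply: h.
Qed.

Lemma increasing_inj g : increasing g -> injective g.
Proof.
move/increasingP=> h i j gij; apply/val_inj; case: (ltngtP i j) => // /h.
  by rewrite gij ltnn.
by rewrite gij ltnn.
Qed.

Let leN : rel 'I_N := fun a b => (a <= b)%N.
Let ltN : rel 'I_N := fun a b => (a < b)%N.

Let sorted_fun f : s.-tuple 'I_N := sort_tuple leN [tuple f i | i < s].

(** An injective map into ['I_N] is an increasing one, its sorted list of values, preceded by a
    permutation. The default permutation is never reached, as [composeK] shows. *)
Let factor f : {ffun 'I_s -> 'I_N} * 'S_s :=
  let g := [ffun i => tnth (sorted_fun f) i] in
  (g, odflt 1%g [pick t : 'S_s | [forall i, g (t i) == f i]]).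

Let compose (p : {ffun 'I_s -> 'I_N} * 'S_s) : {ffun 'I_s -> 'I_N} :=
  [ffun i => p.1 (p.2 i)].

Let leN_total : total leN. Proof. by move=> a b; apply: leq_total. Qed.

Let composeK f : compose (factor f) = f.
Proof.
apply/ffunP => i; rewrite ffunE /factor /=; case: pickP => [t /forallP/(_ i)/eqP//|].
have : perm_eq [tuple f i | i < s] (sorted_fun f) by rewrite perm_sym perm_sort.
case/tuple_permP => p ep /(_ p) /forallP; case=> j; rewrite ffunE; apply/eqP.
have : tnth [tuple f i | i < s] j = tnth (sorted_fun f) (p j).
  by have /val_inj -> := ep; rewrite tnth_mktuple.
by rewrite tnth_mktuple.
Qed.

Let sorted_fun_compose g t : increasing g ->
  forall i, tnth (sorted_fun (compose (g, t))) i = g i.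
Proof.
move=> incr i; have leT : transitive leN by move=> a b c /=; apply: leq_trans.
have leA : antisymmetric leN by move=> a b /= /anti_leq /val_inj.
have -> : sorted_fun (compose (g, t)) = [tuple g i | i < s]; last by rewrite tnth_mktuple.
apply/val_inj/(sorted_eq leT leA); first exact: sort_sorted.
  rewrite sorted_pairwise //; apply/(pairwiseP (g i)) => a b.
  rewrite !inE !size_tuple => al bl ab; rewrite -[a]/(val (Ordinal al)) -[b]/(val (Ordinal bl)).
  rewrite -!tnth_nth !tnth_mktuple; apply: ltnW.
  by move/increasingP: incr; apply.
rewrite perm_sort; apply/tuple_permP; exists t; congr val; apply: eq_from_tnth => j.
by rewrite !tnth_mktuple ffunE.
Qed.

(** The side condition left by [reindex_onto]: the pairs that come from injective maps are those
    with increasing first component. *)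
Let factorK p : injectiveb (compose p) && (factor (compose p) == p) = increasing p.1.
Proof.
case: p => g t /=; apply/andP/idP => [[/injectiveP ci /eqP [<- _]]|incr].
  apply/increasingP => i j ij; rewrite !ffunE ltn_neqAle.
  set f := compose _; pose x0 := f i.
  have leT : transitive leN by move=> a b c /=; apply: leq_trans.
  rewrite !(tnth_nth x0); apply/andP; split.
    rewrite (inj_eq val_inj) nth_uniq ?size_tuple //; first by rewrite neq_ltn ij.
    by rewrite sort_uniq map_inj_uniq ?enum_uniq.
  have leR : reflexive leN by move=> a; apply: leqnn.
  have := sorted_leq_nth leT leR x0 (sort_sorted leN_total [tuple f i | i < s]).
  by apply; rewrite ?inE ?size_sort ?size_tuple //; apply: ltnW.
have gi := increasing_inj incr.
split; first by apply/injectiveP => i j; rewrite !ffunE /= => /gi /perm_inj.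
apply/eqP; rewrite /factor; congr (_, _).
  by apply/ffunP => i; rewrite ffunE sorted_fun_compose.
case: pickP => [t' /forallP tt'|/(_ t) /forallP []] /=; last first.
  by move=> i; rewrite !ffunE sorted_fun_compose.
apply/permP => i; move/eqP: (tt' i); rewrite !ffunE sorted_fun_compose //; exact: gi.
Qed.

(** Expand the rows of the product over all maps f. A map that is not injective gives a repeated row
    of [C]; an injective one is an increasing g preceded by a permutation, whose sign comes out of
    the minor of [C] and assembles the minor of [B]. *)
Lemma cauchy_binet (B : 'M[R]_(s, N)) (C : 'M[R]_(N, s)) :
  \det (B *m C) = \sum_(g | increasing g)
    \det (\matrix_(i, j) B i (g j)) * \det (\matrix_(i, j) C (g i) j).
Proof.
transitivity (\sum_(f : {ffun 'I_s -> 'I_N})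
    (\prod_i B i (f i)) * \det (\matrix_(i, j) C (f i) j)).
  rewrite /determinant; under eq_bigr => t _.
    under eq_bigr => i _ do rewrite mxE.
    rewrite bigA_distr_bigA mulr_sumr; over.
  rewrite exchange_big; apply: eq_bigr => f _; rewrite mulr_sumr.
  apply: eq_bigr => t _; rewrite big_split /= mulrCA; congr (_ * (_ * _)).
  by apply: eq_bigr => i _; rewrite mxE.
rewrite (bigID (fun f => injectiveb f)) /= [X in _ + X]big1 ?addr0; last first.
  move=> f /injectivePn [i [j ij fij]].
  rewrite (determinant_alternate ij) ?mulr0 // => l.
  by rewrite !mxE fij.
rewrite (reindex_onto compose factor); last by move=> f _; apply: composeK.
rewrite (eq_bigl (fun p => increasing p.1)); last exact: factorK.
transitivity (\sum_(g | increasing g) \sum_(t : 'S_s)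
    (\prod_i B i (compose (g, t) i)) * \det (\matrix_(i, j) C (compose (g, t) i) j)).
  by rewrite pair_big_dep; apply: eq_big => [[g t]|[g t] _] //=; rewrite andbT.
apply: eq_bigr => g _; rewrite [X in X * _]/determinant mulr_suml.
apply: eq_bigr => t _.
have -> : \matrix_(i, j) C (compose (g, t) i) j = row_perm t (\matrix_(i, j) C (g i) j).
  by apply/matrixP => i j; rewrite !mxE ffunE.
rewrite row_permE det_mulmx det_perm mulrA; congr (_ * _).
rewrite mulrC; congr (_ * _); apply: eq_bigr => i _.
by rewrite mxE ffunE.
Qed.

End CauchyBinet.

Section ConjugateParts.
Implicit Types (l : seq nat) (i j : nat).

(** In a decreasing list the parts larger than [j] form an initial segment, of length
    [conj_part l j]. *)
Lemma conj_part_nth l i j : sorted geq l -> (i < conj_part l j)%N = (j < nth 0%N l i)%N.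
Proof.
elim: l i => [|x l IH] i sl; first by rewrite nth_nil.
rewrite /conj_part /= -/(conj_part l j); have sl' := path_sorted sl.
case: (ltnP j x) => jx; first by case: i => [|i] //=; rewrite add1n ltnS IH.
have le y : y \in l -> (y <= j)%N.
  by move=> yl; apply: leq_trans jx; move/allP: (order_path_min (@geq_trans) sl); apply.
have -> : conj_part l j = 0%N.
  by apply/eqP; rewrite -leqn0 leqNgt -has_count; apply/hasPn => y /le; rewrite -leqNgt.
rewrite add0n ltn0; apply/esym/negbTE; rewrite -leqNgt.
case: i => [//|i] /=; case: (ltnP i (size l)) => il; first exact/le/mem_nth.
by rewrite nth_default.
Qed.

Lemma conj_part_size l j : (conj_part l j <= size l)%N.
Proof. exact: count_size. Qed.

Lemma conj_part_anti l i j : (i <= j)%N -> (conj_part l j <= conj_part l i)%N.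
Proof. by move=> ij; apply: sub_count => x /=; apply: leq_ltn_trans. Qed.

(** Conjugation back from the heights [c] of [s] columns to rows. The number [n] of rows is
    prescribed so that trailing zero parts are kept. *)
Definition unconj (n s : nat) (c : nat -> nat) : seq nat :=
  mkseq (fun i => \sum_(j < s) (i < c j))%N n.

Lemma sum_ltn s x : (x <= s -> \sum_(j < s) (j < x) = x)%N.
Proof.
move=> xs; rewrite -(subnKC xs) big_split_ord /=.
rewrite (eq_bigr (fun _ => 1%N)) => [|i _]; last by rewrite ltn_ord.
rewrite sum1_card card_ord big1 ?addn0 // => i _.
by rewrite ltnNge leq_addr.
Qed.

Lemma unconjK l n s : sorted geq l -> size l = n -> all (fun x => x <= s)%N l ->
  unconj n s (conj_part l) = l.
Proof.
move=> sl zl al; apply: (@eq_from_nth _ 0%N); rewrite size_mkseq ?zl // => i il.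
rewrite nth_mkseq // -[RHS](@sum_ltn s); last by apply: (allP al); rewrite mem_nth ?zl.
by apply: eq_bigr => j _; rewrite conj_part_nth.
Qed.

Lemma sorted_unconj n s c : sorted geq (unconj n s c).
Proof.
apply/(sortedP 0%N) => i; rewrite size_mkseq => il.
rewrite !nth_mkseq //; last exact: ltnW.
by apply: leq_sum => j _; case: (ltnP i.+1 (c j)) => // /ltnW ->.
Qed.

(** As [c] decreases, the columns higher than [i] form an initial segment; its length exceeds [j]
    exactly when column [j] belongs to it. *)
Lemma conj_unconj n s c j : (forall i j, i <= j -> c j <= c i)%N -> (j < s)%N ->
  (c j <= n)%N -> conj_part (unconj n s c) j = c j.
Proof.
move=> anti js cn; rewrite /conj_part /unconj count_map.
rewrite -[RHS](@sum_ltn n) // -sum1_count big_mkcond /= -[X in iota 0 X]subn0 -/(index_iota 0 n).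
rewrite big_mkord; apply: eq_bigr => i _ /=; congr nat_of_bool.
apply/idP/idP => [|ic].
  apply: contraTT; rewrite -!leqNgt => ci.
  apply: (@leq_trans (\sum_(l < s) (l < j))%N); last by rewrite sum_ltn // ltnW.
  apply: leq_sum => l _.
  case: (ltnP i (c l)) => // icl; rewrite ltnNge; case: (leqP j l) => // jl.
  by have := anti _ _ jl; lia.
apply: (@leq_trans (\sum_(l < s) (l < j.+1))%N); first by rewrite sum_ltn.
apply: leq_sum => l _.
by rewrite ltnS; case: (leqP l j) => // /anti; case: (ltnP i (c l)) => //; lia.
Qed.

End ConjugateParts.

Section Segments.
Variables (A : Type) (R : comPzRingType).
Implicit Types (g : nat -> option A) (f : seq A -> R) (s : seq (option A)).

(** The convention for missing diagonals: one [None] makes the whole matrix entry 0. *)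
Definition eval_word f s : R := if all isSome s then f (pmap id s) else 0.

Definition segment g (x y : nat) : seq (option A) := [seq g (x - l)%N | l <- iota 0 (x - y)].

Definition jt_entry f g (x y : nat) : R :=
  if (y <= x)%N then eval_word f (segment g x y) else 0.

(* f is the convolution of f1 and f2 for the deconcatenation coproduct. *)
Definition deconcatenates f f1 f2 : Prop := forall w,
  f w = \sum_(i < (size w).+1) f1 (take i w) * f2 (drop i w).

Lemma eval_word_deconcatenates f f1 f2 s : deconcatenates f f1 f2 ->
  eval_word f s = \sum_(i < (size s).+1) eval_word f1 (take i s) * eval_word f2 (drop i s).
Proof.
move=> fE; rewrite /eval_word; case: ifP => [as_|nas].
  have [w ->] : exists w, s = map Some w.
    elim: s as_ => [_|[a|] s IH] //=; first by exists [::].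
    by case/IH => w ->; exists (a :: w).
  have pmK u : pmap id [seq Some i | i <- u : seq A] = u by elim: u => //= a u ->.
  rewrite pmK fE size_map; apply: eq_bigr => i _.
  have al u : all isSome [seq Some i | i <- u : seq A] by elim: u.
  by rewrite -map_take -map_drop !al !pmK.
(* A missing letter lies in one of the two halves of every deconcatenation, so each summand is 0. *)
rewrite big1 // => i _; move: nas; rewrite -{1}(cat_take_drop i s) all_cat.
by case: ifP => //= _; [case: ifP => // _; rewrite mulr0|rewrite mul0r].
Qed.

Lemma take_segment g x y i : (i <= x - y)%N -> take i (segment g x y) = segment g x (x - i).
Proof.
move=> ile; rewrite /segment -map_take take_iota; congr map; congr iota.
by move: ile; rewrite /minn; case: ltnP; lia.
Qed.

Lemma drop_segment g x y i : (i <= x - y)%N -> drop i (segment g x y) = segment g (x - i) y.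
Proof.
move=> ile; rewrite /segment -map_drop drop_iota add0n.
rewrite (_ : x - y - i = x - i - y)%N; last lia.
rewrite -[i in iota i _]addn0 iotaDl -map_comp; apply: eq_map => l /=.
by rewrite subnDA.
Qed.

(** The middle index [c] is the diagonal at which the interval is cut; outside y <= c <= x one of
    the two factors has negative length. In this form deconcatenation is a matrix product. *)
Lemma jt_entry_deconcatenates f f1 f2 g N x y : deconcatenates f f1 f2 ->
  (x < N)%N -> (y < N)%N ->
  jt_entry f g x y = \sum_(c < N) jt_entry f1 g x c * jt_entry f2 g c y.
Proof.
move=> fE xN yN; rewrite {1}/jt_entry; case: leqP => yx; last first.
  rewrite big1 // => c _; rewrite /jt_entry; case: (leqP c x) => cx; last by rewrite mul0r.
  by rewrite leqNgt (leq_ltn_trans cx yx) mulr0.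
rewrite (eval_word_deconcatenates _ fE) size_map size_iota.
rewrite -(big_mkord xpredT (fun c => jt_entry f1 g x c * jt_entry f2 g c y)).
rewrite (big_cat_nat (n := y)) //=; last exact: ltnW.
rewrite (_ : \sum_(0 <= c < y) _ = 0) ?add0r; last first.
  by rewrite big_nat big1 // => c /= cy; rewrite /jt_entry [in X in _ * X]leqNgt (cy : c < y)%N mulr0.
rewrite (big_cat_nat (n := x.+1)) //=; last by rewrite leqW.
rewrite (_ : \sum_(x.+1 <= c < N) _ = 0) ?addr0; last first.
  by rewrite big_nat big1 // => c /andP[xc _]; rewrite /jt_entry leqNgt xc mul0r.
rewrite -[y in \big[_/_]_(y <= _ < _) _]add0n big_addn big_mkord.
(* Words are cut after [i] letters counted from [x] downwards, while [c] is counted upwards from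
   [y]; hence the reversal. *)
rewrite subSn // (reindex_inj rev_ord_inj); apply: eq_bigr => i _.
have il := ltn_ord i; rewrite /jt_entry /= subSS.
rewrite take_segment ?drop_segment //; try lia.
rewrite (_ : x - (x - y - i) = i + y)%N; last lia.
by rewrite leq_addl ifT //; lia.
Qed.

End Segments.

(** * Determinants whose entries are words read along intervals *)

Section SegmentDeterminants.
Variables (A : Type) (R : comPzRingType).
Implicit Types (g : nat -> option A) (f : seq A -> R) (x y : nat -> nat).

Definition seg_det f g s x y : R :=
  \det (\matrix_(i < s, j < s) jt_entry f g (x j) (y i)).

(** A permutation with an entry of negative length contributes 0 to both determinants, so the
    entries need to agree only along the other permutations. Single entries may well differ when
    some diagonals are missing. *)
Lemma seg_det_terms f g s x y f' g' x' y' :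
    (forall t : 'S_s, (forall i : 'I_s, y i <= x (t i))%N ->
      forall i : 'I_s, jt_entry f g (x (t i)) (y i) = jt_entry f' g' (x' (t i)) (y' i)) ->
    (forall i j, (i < s)%N -> (j < s)%N -> (y i <= x j) = (y' i <= x' j))%N ->
  seg_det f g s x y = seg_det f' g' s x' y'.
Proof.
move=> same le; apply: eq_bigr => t _; congr (_ * _).
have [/forallP tP|] := boolP [forall i : 'I_s, (y i <= x (t i))%N].
  by apply: eq_bigr => i _; rewrite !mxE same.
rewrite negb_forall => /existsP[i nle].
rewrite (bigD1 i) // [RHS](bigD1 i) //= !mxE /jt_entry -le ?ltn_ord //.
by rewrite (negPf nle) !mul0r.
Qed.

(* For a permutation contributing a nonzero term, the union of the intervals
   [y i, x (t i)[ is the same multiset as that of the intervals [y i, x i[. *)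
Lemma seg_det_column s (x y : nat -> nat) (t : 'S_s) (i : 'I_s) d :
    (forall i : 'I_s, y i <= x (t i))%N -> (y i < d <= x (t i))%N ->
  exists j : 'I_s, (y j < d <= x j)%N.
Proof.
move=> yx /andP[yd dx]; apply/existsP; apply: contraT => /existsPn none.
have lt : (#|[set j : 'I_s | x (t j) < d]| < #|[set j : 'I_s | y j < d]|)%N.
  apply: proper_card; apply/properP; split.
    by apply/subsetP => j; rewrite !inE; apply: leq_ltn_trans.
  by exists i; rewrite !inE // -leqNgt.
have : (#|[set j : 'I_s | y j < d]| <= #|[set j : 'I_s | x j < d]|)%N.
  apply/subset_leq_card/subsetP => j; rewrite !inE => yj.
  by have := none j; rewrite yj /= -ltnNge.
suff -> : (#|[set j : 'I_s | x j < d]| = #|[set j : 'I_s | x (t j) < d]|)%N by rewrite leqNgt lt.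
have -> : [set j : 'I_s | (x j < d)%N] = t @: [set j : 'I_s | (x (t j) < d)%N].
  apply/setP => j; rewrite inE; apply/idP/imsetP => [xj|[l + ->]]; last by rewrite inE.
  by exists ((t^-1)%g j); rewrite ?inE permKV.
by rewrite card_imset //; apply: perm_inj.
Qed.

(** Pigeonhole: if x i < y i and all lengths along [t] are nonnegative, the i + 1 values up to i
    would have to be taken by [t] on the i indices below i. In Cauchy--Binet this removes the
    sequences that do not come from a partition between mu and lam. *)
Lemma seg_det_eq0 f g s x y :
    (forall i j, i < j < s -> y i < y j)%N -> (forall i j, i < j < s -> x i < x j)%N ->
    (exists2 i, i < s & x i < y i)%N ->
  seg_det f g s x y = 0.
Proof.
move=> yincr xincr [i is_ xy]; apply: big1 => t _.
have [/forallP tP|] := boolP [forall i : 'I_s, (y i <= x (t i))%N]; last first.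
  rewrite negb_forall => /existsP[j nle].
  by rewrite (bigD1 j) //= !mxE /jt_entry (negPf nle) mul0r mulr0.
have sub : [set j : 'I_s | (j <= i)%N] \subset t @: [set j : 'I_s | (j < i)%N].
  apply/subsetP => j; rewrite inE => ji; apply/imsetP; exists ((t^-1)%g j); last by rewrite permKV.
  rewrite inE ltnNge; apply/negP => il.
  have := tP ((t^-1)%g j); rewrite permKV => yj.
  have yi : (y i <= y ((t^-1)%g j))%N.
    by move: il; rewrite leq_eqVlt => /orP[/eqP<-//|il]; rewrite ltnW // yincr // il ltn_ord.
  have xj : (x j <= x i)%N.
    by move: ji; rewrite leq_eqVlt => /orP[/eqP->//|ji]; rewrite ltnW // xincr // ji.
  by have := leq_trans yi (leq_trans yj xj); rewrite leqNgt xy.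
have := subset_leq_card sub; rewrite card_imset; last exact: perm_inj.
have pr : [set j : 'I_s | (j < i)%N] \proper [set j : 'I_s | (j <= i)%N].
  apply/properP; split; first by apply/subsetP => j; rewrite !inE; apply: ltnW.
  by exists (Ordinal is_); rewrite !inE /= ?ltnn.
by have := proper_card pr; rewrite ltnNge => /negP.
Qed.

Lemma seg_det_split f g a b x y :
    (forall i j, a <= i < a + b -> j < a -> x j < y i)%N ->
  seg_det f g (a + b) x y =
    seg_det f g a x y * seg_det f g b (fun j => x (a + j)%N) (fun i => y (a + i)%N).
Proof.
move=> zero; rewrite /seg_det; set M := \matrix_(i, j) _.
rewrite -[M]submxK.
have -> : dlsubmx M = 0.
  apply/matrixP => i j; rewrite !mxE /jt_entry leqNgt zero ?leq_addr //=.
  by rewrite ltn_add2l.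
rewrite det_ublock; congr (_ * _); congr (\det _); apply/matrixP => i j; rewrite !mxE //.
Qed.

Lemma seg_det_unit f g a x y : f [::] = 1 ->
    (forall i, i < a -> x i = y i)%N -> (forall i j, j < i < a -> x j < y i)%N ->
  seg_det f g a x y = 1.
Proof.
move=> f1 xy zero; rewrite /seg_det -det_tr det_trig.
  by apply: big1 => i _; rewrite !mxE /jt_entry xy // leqnn /segment subnn.
apply/is_trig_mxP => j i ij; rewrite !mxE /jt_entry leqNgt zero //.
by rewrite ij ltn_ord.
Qed.

Lemma eq_seg_det f g s x y x' y' : (forall j, j < s -> x j = x' j)%N ->
  (forall i, i < s -> y i = y' i)%N -> seg_det f g s x y = seg_det f g s x' y'.
Proof. by move=> ex ey; congr (\det _); apply/matrixP => i j; rewrite !mxE ex ?ey. Qed.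

End SegmentDeterminants.

(** The x_j for l = mu and the y_i for l = lam. The subtraction is never truncated when
    [size l <= n]. *)
Definition shifted (n : nat) (l : seq nat) (j : nat) : nat := (n + j - conj_part l j)%N.

(** * Diagonal constant fillings as functions of the diagonal *)

Section DiagonalReading.
Variable A : countType.
Implicit Types (t : seq (trow A)) (g : nat -> option A).

Definition rentry t (i j : nat) : option A :=
  let r := nth (0%N, [::]) t i in
  if (r.1 <= j)%N then onth r.2 (j - r.1) else None.

(* Entries of t are read off g along diagonals; the diagonal j - i is shifted by
   n, at least the number of rows, to be a natural number. *)
Definition along g (n : nat) t : Prop :=
  forall i j a, rentry t i j = Some a -> g (n + j - i)%N = Some a.

Definition reading t (d : nat) : option A :=
  ohead (pmap (fun i => if (size t <= d + i)%N then rentry t i (d + i - size t) else None)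
              (iota 0 (size t))).

(** Equivalent to [diagonal_constant] on tableaux ([diagonal_constantP]), but available for
    untrimmed row lists and with an explicit function from diagonals to letters. *)
Definition diagonal t : Prop := along (reading t) (size t) t.

Lemma rentry_size t i j a : rentry t i j = Some a -> (i < size t)%N.
Proof.
by rewrite /rentry; case: (ltnP i (size t)) => // le; rewrite nth_default //= onth0n.
Qed.

Lemma rentry_bound t i j a : rentry t i j = Some a ->
  (nth 0%N (starts t) i <= j < nth 0%N (ends t) i)%N.
Proof.
move=> ta; have it := rentry_size ta; move: ta; rewrite /rentry.
rewrite !(nth_map (0%N, [::])) //; case: ifP => // le ta.
rewrite /row_start /row_end /= -ltn_subLR //.
by case: ltnP => // si; move: ta; rewrite onth_default.
Qed.

Lemma rentryP t i j : (nth 0%N (starts t) i <= j < nth 0%N (ends t) i)%N ->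
  exists a, rentry t i j = Some a.
Proof.
case: (ltnP i (size t)) => it; last by rewrite [X in (_ < X)%N]nth_default ?size_map ?ltn0 ?andbF.
rewrite !(nth_map (0%N, [::])) // /rentry /row_end /row_start => /andP[le]; rewrite le => lt.
move: lt; rewrite -ltn_subLR // => lt.
have : onth (nth (0%N, [::]) t i).2 (j - (nth (0%N, [::]) t i).1) by rewrite onthTE.
by case: (onth _ _) => // a _; exists a.
Qed.

(** Lets a piece inherit diagonal constancy from the function of a larger row list, which also has
    values on diagonals the piece does not meet. *)
Lemma reading_along g n t : (size t <= n)%N -> along g n t -> diagonal t.
Proof.
move=> tn al i j a ta; have it := rentry_size ta; rewrite /reading.
set F := (F in pmap F _).
have Fi : F i = Some a by rewrite /F ifT; [rewrite (_ : _ - _ = j)%N //; lia|lia].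
have Fe l b : F l = Some b -> b = a.
  rewrite /F; case: ifP => // le /al; have := al _ _ _ ta => gb; rewrite (_ : n + _ - l = n + j - i)%N; last lia.
  by rewrite gb => -[].
have : a \in pmap F (iota 0 (size t)) by rewrite mem_pmap; apply/mapP; exists i; rewrite ?mem_iota.
case E: (pmap F _) => [//|b s] _ /=.
have : b \in pmap F (iota 0 (size t)) by rewrite E mem_head.
by rewrite mem_pmap => /mapP[l _ /esym/Fe ->].
Qed.

Lemma along_shift g n t c : (size t <= n)%N -> along g n t ->
  along (fun d => g (d - c)%N) (n + c) t.
Proof.
move=> tn al i j a ta; have it := rentry_size ta.
by rewrite (_ : _ - _ - c = n + j - i)%N ?(al _ _ _ ta) //; lia.
Qed.

Lemma rentry_top t e i j a : fits t e -> rentry (top t e) i j = Some a -> rentry t i j = Some a.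
Proof.
elim: t e i => [|r t IH] [|x e] [|i] //= /andP[/andP[rx xr] /IH]; last exact.
move=> _; rewrite /rentry /=; case: ifP => // le.
rewrite !onthE map_take; case: (ltnP (j - r.1) (x - r.1)) => lt; first by rewrite nth_take.
by rewrite nth_default // size_take size_map; case: ifP => //; lia.
Qed.

Lemma rentry_bot t e i j a : fits t e -> rentry (bot t e) i j = Some a -> rentry t i j = Some a.
Proof.
elim: t e i => [|r t IH] [|x e] [|i] //= /andP[/andP[rx xr] /IH]; last exact.
move=> _; rewrite /rentry /=; case: ifP => // le; rewrite (leq_trans rx le).
rewrite /row_start in rx *.
by rewrite !onthE map_drop nth_drop (_ : (x - r.1 + (j - x) = j - r.1)%N) //; lia.
Qed.

Lemma along_top g n t e : fits t e -> along g n t -> along g n (top t e).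
Proof. by move=> fe al i j a /(rentry_top fe)/al. Qed.

Lemma along_bot g n t e : fits t e -> along g n t -> along g n (bot t e).
Proof. by move=> fe al i j a /(rentry_bot fe)/al. Qed.

Lemma rentry_cat t1 t2 i j : rentry (t1 ++ t2) i j =
  if (i < size t1)%N then rentry t1 i j else rentry t2 (i - size t1) j.
Proof. by rewrite /rentry nth_cat; case: (i < size t1)%N. Qed.

Lemma along_cat g n t1 t2 : (size t1 <= n)%N ->
  along g n (t1 ++ t2) <-> along g n t1 /\ along g (n - size t1) t2.
Proof.
move=> le; split=> [al|[al1 al2] i j a]; last first.
  rewrite rentry_cat; case: ltnP => it; first exact: al1.
  by move/al2; rewrite (_ : _ - _ + j - _ = n + j - i)%N //; lia.
split=> i j a ta.
  by apply: (al i j a); rewrite rentry_cat (rentry_size ta).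
have := al (i + size t1)%N j a; rewrite rentry_cat ltnNge leq_addl addnK ta => /(_ erefl).
by rewrite (_ : n + j - _ = n - size t1 + j - i)%N //; lia.
Qed.

Lemma rentry_up m t i j : (i < size t)%N ->
  rentry (up m t) i j = if (m <= j)%N then rentry t i (j - m) else None.
Proof.
move=> it; rewrite /rentry (nth_map (0%N, [::])) //=.
case: (leqP m j) => mj; last by rewrite ifF //; lia.
set r := nth _ t i; rewrite (_ : (r.1 + m <= j) = (r.1 <= j - m))%N; last lia.
by rewrite (_ : j - (r.1 + m) = j - m - r.1)%N //; lia.
Qed.

Lemma along_up g n m t : (size t <= n)%N -> along g n (up m t) <-> along g (n + m) t.
Proof.
move=> tn; split=> al i j a ta; have it := rentry_size ta.
  rewrite -addnA; apply: (al i (m + j)%N a).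
  by rewrite rentry_up // leq_addr addKn.
move: it; rewrite size_map => it; move: ta; rewrite rentry_up //; case: ifP => // mj /al.
by rewrite (_ : n + m + _ - i = n + j - i)%N //; lia.
Qed.

Lemma ends_head t i j a : sorted geq (ends t) -> rentry t i j = Some a ->
  (j < head 0%N (ends t))%N.
Proof.
move=> st ta; have it := rentry_size ta; have /andP[_ jlt] := rentry_bound ta.
apply: leq_trans jlt _; case: (ends t) st i it ta => [|x s] st [|i] //= _ _.
have := order_path_min (@geq_trans) st; case: (ltnP i (size s)) => il.
  by move/allP; apply; apply: mem_nth.
by rewrite nth_default.
Qed.

(** [t1] lies above [t2] and in columns to the right of it, so no diagonal meets both, and functions
    for the two pieces can be glued. *)
Lemma diagonal_cat t1 t2 : skew_rows (t1 ++ t2) -> cutok t1 t2 ->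
  diagonal (t1 ++ t2) <-> diagonal t1 /\ diagonal t2.
Proof.
move=> sk ok; have [_ /andP[_ s2]] := skew_cat sk; split=> [d|[d1 d2]].
  have le : (size t1 <= size (t1 ++ t2))%N by rewrite size_cat leq_addr.
  have [al1 al2] := (along_cat (reading (t1 ++ t2)) t2 le).1 d.
  split; [apply: reading_along al1|apply: reading_along al2]; rewrite size_cat ?leq_addr //.
  by rewrite addKn.
(* With diagonals shifted by the total number of rows, the boxes of [t1] lie at or above this
   threshold and those of [t2] strictly below it. *)
pose g d := if (size t2 + head 0 (ends t2) <= d)%N then reading t1 (d - size t2) else reading t2 d.
apply: (@reading_along g (size (t1 ++ t2))) => //.
apply/along_cat; rewrite size_cat ?leq_addr // addKn; split=> i j a ta.
  have it := rentry_size ta; have /andP[sj _] := rentry_bound ta.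
  have le : (head 0 (ends t2) <= j)%N.
    apply: leq_trans sj; case E: (ends t2) => [//|x s] /=.
    move: ok; rewrite cutokE => /allrelP; apply; last by rewrite E mem_head.
    by apply: mem_nth; rewrite size_map.
  rewrite /g ifT; last lia.
  by rewrite (_ : _ - i - size t2 = size t1 + j - i)%N; [apply: d1|lia].
have it := rentry_size ta; have jlt := ends_head s2 ta.
by rewrite /g ifF; [apply: d2|lia].
Qed.

Lemma diagonal_up m t : diagonal (up m t) <-> diagonal t.
Proof.
split=> d.
  apply: (@reading_along (reading (up m t)) (size t + m)); first exact: leq_addr.
  by apply/along_up => //; move: d; rewrite /diagonal size_map.
apply: (@reading_along (fun d => reading t (d - m)%N) (size t)); rewrite ?size_map //.
by apply/along_up => //; apply: along_shift.
Qed.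

Lemma diagonal_top t e : fits t e -> diagonal t -> diagonal (top t e).
Proof.
by move=> fe d; apply: (@reading_along (reading t) (size t)); rewrite ?size_top //; apply: along_top.
Qed.

Lemma diagonal_bot t e : fits t e -> diagonal t -> diagonal (bot t e).
Proof.
by move=> fe d; apply: (@reading_along (reading t) (size t)); rewrite ?size_bot //; apply: along_bot.
Qed.

Lemma diagonal_constantP (h : tableau A) : diagonal_constant h <-> diagonal h.
Proof.
split=> [dc|d i j l m a b ha hb ijlm]; last first.
  have ih := rentry_size ha; have lh := rentry_size hb.
  have := d l m b hb; rewrite (_ : _ + m - l = size h + j - i)%N; last lia.
  by rewrite (d i j a ha) => -[].
move=> i j a ta; have it := rentry_size ta; rewrite /reading.
set F := (F in pmap F _).
have Fi : F i = Some a by rewrite /F ifT; [rewrite (_ : _ - _ = j)%N //; lia|lia].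
have Fe l b : F l = Some b -> b = a.
  by rewrite /F; case: ifP => // le lb; apply: (dc _ _ _ _ _ _ lb ta); lia.
have : a \in pmap F (iota 0 (size h)).
  by rewrite mem_pmap; apply/mapP; exists i; rewrite ?mem_iota.
case E: (pmap F _) => [//|b s] _ /=.
have : b \in pmap F (iota 0 (size h)) by rewrite E mem_head.
by rewrite mem_pmap => /mapP[l _ /esym/Fe ->].
Qed.

Lemma diagonal_column (w : seq A) : diagonal [seq (0%N, [:: a]) | a <- w].
Proof.
apply: (@reading_along (fun d => onth w (size w - d)) (size w)); rewrite ?size_map // => i j a ta.
have := rentry_bound ta; have it := rentry_size ta; rewrite size_map in it.
move: ta; rewrite /starts /ends -!map_comp !(nth_map a) // /rentry (nth_map a) //= subn0.
move=> oa; rewrite /row_end /= ltnS leqn0 => /eqP j0.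
move: oa; rewrite j0 addn0 subKn 1?ltnW // => -[<-].
by rewrite onthE (nth_map a).
Qed.

End DiagonalReading.

Lemma eq_unconj n s c c' : (forall j, j < s -> c j = c' j)%N -> unconj n s c = unconj n s c'.
Proof. by move=> cc; apply: eq_map => i; apply: eq_bigr => j _; rewrite cc. Qed.

Lemma fitsP (A : countType) (t : seq (trow A)) e :
  reflect (size e = size t /\ forall i, (i < size t)%N ->
             (nth 0 (starts t) i <= nth 0 e i <= nth 0 (ends t) i)%N) (fits t e).
Proof.
elim: t e => [|r t IH] [|x e]; try by constructor; case.
  by constructor; split.
apply: (iffP andP) => [[rx /IH [ze h]]|[[ze] h]].
  by split=> [/=|[|i] //= /h //]; rewrite ze.
by split; [apply: (h 0%N)|apply/IH; split=> // i it; apply: (h i.+1)].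
Qed.

Lemma conj_part_fits (A : countType) (t : seq (trow A)) e j : fits t e ->
  (conj_part (starts t) j <= conj_part e j <= conj_part (ends t) j)%N.
Proof.
elim: t e => [|r t IH] [|x e] //= /andP[/andP[rx xr] /IH]; rewrite /conj_part /=; lia.
Qed.

(** * Jacobi--Trudi determinants of row lists and their behaviour under cuts *)

Section JacobiTrudi.
Variables (A : countType) (R : comPzRingType).
Implicit Types (t : seq (trow A)) (g : nat -> option A) (f : seq A -> R).

(** The bound [n] on the rows, the number [s] of columns and the letters [g] are left free so that a
    piece can be evaluated with the data of the whole. By [jt_ext] and [jt_size] the value does not
    depend on them. *)
Definition jt f n s g t : R := seg_det f g s (shifted n (starts t)) (shifted n (ends t)).

Lemma shifted_ltn n l i j : (size l <= n)%N -> (i < j)%N -> (shifted n l i < shifted n l j)%N.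
Proof.
move=> ln ij; rewrite /shifted; have := conj_part_anti l (ltnW ij).
by have := conj_part_size l i; lia.
Qed.

(** A contributing permutation reads only diagonals that meet the shape, and there both [g] and [g']
    are forced by the entries of [t]. *)
Lemma jt_ext f n n' s g g' t : skew_rows t -> (size t <= n)%N -> (size t <= n')%N ->
  along g n t -> along g' n' t -> jt f n s g t = jt f n' s g' t.
Proof.
move=> /andP[s1 s2] tn tn' al al'.
have cs l : size l = size t -> forall j, (conj_part l j <= size t)%N.
  by move=> <- j; apply: conj_part_size.
have css := cs _ (size_map _ t : size (starts t) = _).
have cse := cs _ (size_map _ t : size (ends t) = _).
apply: seg_det_terms => [p yx i|i j is_ js]; last first.
  by rewrite /shifted; have := css j; have := cse i; lia.
have yxi := yx i; rewrite /jt_entry yxi.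
have -> : (shifted n' (ends t) i <= shifted n' (starts t) (p i))%N.
  by move: yxi; rewrite /shifted; have := css (p i); have := cse i; lia.
congr eval_word; rewrite /segment.
have -> : (shifted n' (starts t) (p i) - shifted n' (ends t) i =
           shifted n (starts t) (p i) - shifted n (ends t) i)%N.
  by rewrite /shifted; have := css (p i); have := cse i; lia.
apply/eq_in_map => l; rewrite mem_iota add0n => /andP[_ ll].
set d := (shifted n _ (p i) - l)%N.
(* Some column [j] of the shape has a box on the diagonal [d] that is being read. *)
have [j] : exists j : 'I_s, (shifted n (ends t) j < d <= shifted n (starts t) j)%N.
  by apply: (seg_det_column (i := i) (d := d) yx); rewrite /d; lia.
(* The box of column [j] on diagonal [d] lies in row n + j - d. *)
rewrite {1 2}/shifted => dj; set r := (n + j - d)%N.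
have cj := css j; have ce := cse j.
have [|a ra] := @rentryP _ t r j.
  rewrite leqNgt -!conj_part_nth //; rewrite /r; lia.
have := al r j a ra; have := al' r j a ra.
rewrite (_ : n + j - r = d)%N; last by rewrite /r; lia.
rewrite (_ : n' + j - r = shifted n' (starts t) (p i) - l)%N; first by move=> -> ->.
have dn : (d <= n + j)%N by case/andP: dj => _ dj; apply: leq_trans dj (leq_subr _ _).
have xx : (shifted n' (starts t) (p i) + n = shifted n (starts t) (p i) + n')%N.
  by rewrite /shifted; have := css (p i); lia.
move: dn ll xx; rewrite /r /d; move: (shifted n' _ _) (shifted n (starts t) _) => x' x.
by clear; lia.
Qed.

(** Cauchy--Binet over the intermediate diagonals. An increasing choice h of diagonals is
    [shifted n e] for a partition [e] between the two outlines, or else one of the two minors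
    vanishes by [seg_det_eq0]. *)
Lemma jt_deconcatenates f f1 f2 s g t : deconcatenates f f1 f2 -> skew_rows t ->
    (head 0 (ends t) <= s)%N ->
  jt f (size t) s g t =
    \sum_(e <- cuts t) jt f1 (size t) s g (top t e) * jt f2 (size t) s g (bot t e).
Proof.
move=> fE sk; move: (sk) => /andP[s1 s2] hs; set n := size t.
(* All diagonals n + j - (column height) with j < s are below n + s. *)
pose N := (n + s)%N.
have shN l (j : 'I_s) : (shifted n l j < N)%N.
  by rewrite /shifted /N; have := ltn_ord j; lia.
pose X1 : 'M[R]_(N, s) := \matrix_(c, j) jt_entry f1 g (shifted n (starts t) j) c.
(* Row i of the determinant carries y_i, the lower end of the interval, so the factor of [f2] comes
   first in the matrix product. *)
pose X2 : 'M[R]_(s, N) := \matrix_(i, c) jt_entry f2 g c (shifted n (ends t) i).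
transitivity (\det (X2 *m X1)).
  congr (\det _); apply/matrixP => i j; rewrite !mxE.
  rewrite (jt_entry_deconcatenates g fE (shN _ j) (shN _ i)).
  by apply: eq_bigr => c _; rewrite !mxE mulrC.
rewrite cauchy_binet.
pose gof e : {ffun 'I_s -> 'I_N} := [ffun j => Ordinal (shN e j)].
pose good (h : {ffun 'I_s -> 'I_N}) := [forall j : 'I_s,
  (shifted n (ends t) j <= h j <= shifted n (starts t) j)%N].
have zs : size (starts t) = n by rewrite size_map.
have ze : size (ends t) = n by rewrite size_map.
have le_s e : e \in cuts t -> all (fun x => x <= s)%N e.
  rewrite mem_cuts => /andP[se fe]; apply: (fits_le fe).
  have : sorted geq (ends t) := s2; case: (ends t) hs => //= x l xs /(order_path_min (@geq_trans)) xl.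
  by rewrite xs /=; apply: sub_all xl => y /= yx; apply: leq_trans yx xs.
have size_e e : e \in cuts t -> size e = n.
  by rewrite mem_cuts => /andP[_ /fits_size].
rewrite (bigID good) /= [X in _ + X]big1 ?addr0; last first.
  move=> h /andP[/increasingP hi]; rewrite negb_forall => /existsP[j0 nj].
  (* An extension of h to all naturals; only its values at indices below [s] are used. *)
  pose hn j := oapp (fun j' : 'I_s => h j' : nat) 0%N (insub j).
  have hnE (j : 'I_s) : hn j = h j by rewrite /hn valK.
  have hni i j : (i < j < s)%N -> (hn i < hn j)%N.
    case/andP=> ij js; have is_ := ltn_trans ij js.
    by rewrite -[i]/(val (Ordinal is_)) -[j]/(val (Ordinal js)) !hnE hi.
  have sinc l : size l = n -> forall i j, (i < j < s)%N -> (shifted n l i < shifted n l j)%N.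
    by move=> zl i j /andP[ij _]; apply: shifted_ltn; rewrite ?zl.
  move: nj; rewrite negb_and -!ltnNge => /orP[nj|nj].
    have -> : \det (\matrix_(i, j) X2 i (h j)) = seg_det f2 g s hn (shifted n (ends t)).
      by congr (\det _); apply/matrixP => i j; rewrite !mxE hnE.
    rewrite seg_det_eq0 ?mul0r //; first exact: sinc.
    by exists j0; rewrite ?hnE.
  have -> : \det (\matrix_(i, j) X1 (h i) j) = seg_det f1 g s (shifted n (starts t)) hn.
    by congr (\det _); apply/matrixP => i j; rewrite !mxE hnE.
  rewrite seg_det_eq0 ?mulr0 //; first exact: sinc.
  by exists j0; rewrite ?hnE.
pose F (h : {ffun 'I_s -> 'I_N}) :=
  \det (\matrix_(i, j) X1 (h i) j) * \det (\matrix_(i, j) X2 i (h j)).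
transitivity (\sum_(h <- map gof (cuts t)) F h); last first.
  rewrite big_map big_seq [RHS]big_seq; apply: eq_bigr => e; rewrite mem_cuts => /andP[se fe].
  rewrite /F /jt /seg_det starts_top // ends_top // starts_bot // ends_bot //.
  by congr (_ * _); congr (\det _); apply/matrixP => i j; rewrite !mxE ffunE.
rewrite -big_filter; under eq_bigr => h _ do rewrite mulrC -/(F h).
apply: perm_big; apply: uniq_perm; first exact/filter_uniq/index_enum_uniq.
  rewrite map_inj_in_uniq ?cuts_uniq // => e e' ec e'c /ffunP ee.
  move: (ec) (e'c); rewrite !mem_cuts => /andP[se fe] /andP[se' fe'].
  rewrite -(unconjK se (size_e _ ec) (le_s _ ec)) -(unconjK se' (size_e _ e'c) (le_s _ e'c)).
  apply: eq_unconj => j js; have := congr1 val (ee (Ordinal js)); rewrite !ffunE /= /shifted.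
  have := conj_part_size e j; have := conj_part_size e' j.
  rewrite !size_e //; lia.
move=> h; rewrite mem_filter mem_index_enum andbT; apply/andP/mapP => [[hi hg]|[e ec ->]].
  pose hn j := oapp (fun j' : 'I_s => h j' : nat) 0%N (insub j).
  have hnE (j : 'I_s) : hn j = h j by rewrite /hn valK.
  have hstep i j (ij : (i <= j)%N) : (j < s)%N -> (hn i + (j - i) <= hn j)%N.
    elim: j ij => [|j IH] ij js; first by move: ij; rewrite leqn0 => /eqP->; rewrite addn0.
    move: ij; rewrite leq_eqVlt => /orP[/eqP->|ij]; first by rewrite subnn addn0.
    have js' := ltnW js; have := IH ij js'.
    have : (hn j < hn j.+1)%N.
      rewrite -[X in hn X](erefl : val (Ordinal js') = j) -[j.+1](erefl : val (Ordinal js) = j.+1).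
      by rewrite !hnE; move/increasingP: hi; apply.
    by rewrite subSn //; lia.
  have hb (j : nat) : (j < s)%N -> (shifted n (ends t) j <= hn j <= shifted n (starts t) j)%N.
    by move=> js; rewrite -[j]/(val (Ordinal js)) hnE; move/forallP: hg; apply.
  (* Inverting [shifted]: these are the column heights of the partition sought. Strict increase of h
     makes them decrease, and the bounds [good] place them between those of mu and lam. *)
  pose c j := if (j < s)%N then (n + j - hn j)%N else 0%N.
  have cb j : (j < s)%N -> (conj_part (starts t) j <= c j <= conj_part (ends t) j)%N.
    move=> js; rewrite /c js; move: (hb _ js); rewrite /shifted.
    have := conj_part_size (starts t) j; have := conj_part_size (ends t) j; rewrite zs ze; lia.
  have canti i j : (i <= j)%N -> (c j <= c i)%N.
    move=> ij; rewrite /c; case: (ltnP j s) => // js; rewrite (leq_ltn_trans ij js).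
    by have := hstep _ _ ij js; lia.
  have cn j : (j < s)%N -> (c j <= n)%N.
    by move=> js; have /andP[_ h2] := cb _ js; apply: leq_trans h2 _; rewrite -ze conj_part_size.
  have ec : unconj n s c \in cuts t.
    rewrite mem_cuts sorted_unconj /=; apply/fitsP; rewrite size_mkseq; split=> // i it.
    rewrite -[starts t](unconjK s1 zs (le_s _ (starts_cuts sk))).
    rewrite -[ends t](unconjK s2 ze (le_s _ (ends_cuts sk))) !nth_mkseq //.
    apply/andP; split; apply: leq_sum => j _; have /andP[h1 h2] := cb j (ltn_ord j).
      by case: (ltnP i (conj_part (starts t) j)) => // /leq_trans/(_ h1) ->.
    by case: (ltnP i (c j)) => // /leq_trans/(_ h2) ->.
  exists (unconj n s c) => //; apply/ffunP => j; apply/val_inj; rewrite ffunE /=.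
  rewrite /shifted conj_unconj ?cn // /c ltn_ord -hnE.
  by have := hb j (ltn_ord j); rewrite /shifted; lia.
split.
  by apply/increasingP => i j ij; rewrite !ffunE /= shifted_ltn // size_e.
move: ec; rewrite mem_cuts => /andP[se fe]; apply/forallP => j; rewrite ffunE /=.
have := conj_part_fits j fe; rewrite /shifted; lia.
Qed.

End JacobiTrudi.

Lemma conj_part_eq0 l j : all (fun x => x <= j)%N l -> conj_part l j = 0%N.
Proof.
move=> al; apply/eqP; rewrite -leqn0 leqNgt -has_count; apply/hasPn => x xl.
by rewrite /= -leqNgt (allP al).
Qed.

Lemma conj_part_full l j : all (ltn j) l -> conj_part l j = size l.
Proof. by rewrite all_count => /eqP. Qed.

Lemma conj_part_cat l1 l2 j : conj_part (l1 ++ l2) j = (conj_part l1 j + conj_part l2 j)%N.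
Proof. exact: count_cat. Qed.

Lemma all_le_head l : sorted geq l -> all (fun x => x <= head 0 l)%N l.
Proof. by case: l => //= x l /(order_path_min (@geq_trans)); rewrite leqnn. Qed.

Section JacobiTrudiPieces.
Variables (A : countType) (R : comPzRingType) (f : seq A -> R).
Hypothesis f1 : f [::] = 1.
Implicit Types (t : seq (trow A)) (g : nat -> option A).

Lemma all_starts_le t m : all (fun x => x <= m)%N (ends t) -> all (fun x => x <= m)%N (starts t).
Proof. exact: fits_le (fits_starts t). Qed.

Lemma all_ends_gt t m : all (ltn m) (starts t) -> all (ltn m) (ends t).
Proof. exact: fits_ge (fits_ends t). Qed.

(** Beyond the shape x_i = y_i = n + i, so the additional columns form a unitriangular block. *)
Lemma jt_pad n s b g t : skew_rows t -> (size t <= n)%N -> (head 0 (ends t) <= s)%N ->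
  jt f n (s + b) g t = jt f n s g t.
Proof.
move=> /andP[_ s2] tn hs.
have le_s j : (s <= j)%N -> all (fun x => x <= j)%N (ends t).
  move=> sj; apply: sub_all (all_le_head s2) => x /leq_trans; apply.
  exact: leq_trans hs sj.
have ce j : (s <= j)%N -> shifted n (ends t) j = (n + j)%N.
  by move=> sj; rewrite /shifted conj_part_eq0 ?subn0 ?le_s.
have cs j : (s <= j)%N -> shifted n (starts t) j = (n + j)%N.
  by move=> sj; rewrite /shifted conj_part_eq0 ?subn0 ?all_starts_le ?le_s.
rewrite /jt seg_det_split => [|i j /andP[si _] js].
  rewrite [X in _ * X]seg_det_unit ?mulr1 // => [i ib|i j /andP[ji ib]].
    by rewrite ce ?cs ?leq_addr.
  by rewrite ce ?cs ?leq_addr //; lia.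
by rewrite ce // /shifted; lia.
Qed.

Lemma jt_size n s s' g t : skew_rows t -> (size t <= n)%N -> (head 0 (ends t) <= s)%N ->
  (head 0 (ends t) <= s')%N -> jt f n s g t = jt f n s' g t.
Proof.
move=> sk tn hs hs'; wlog le : s s' hs hs' / (s <= s')%N.
  by move=> wl; case/orP: (leq_total s s') => le; [|apply/esym]; apply: wl.
by rewrite -(subnKC le) jt_pad.
Qed.

(** The first m columns are now full in both outlines. They form a unitriangular block, and the
    diagonals of the other columns move by m. *)
Lemma jt_up n m s g t : skew_rows t -> (size t <= n)%N ->
  jt f n (m + s) g (up m t) = jt f (n + m) s g t.
Proof.
move=> sk tn; rewrite /jt.
have cu j l : (j < m)%N -> conj_part (map (addn m) l) j = size l.
  move=> jm; rewrite conj_part_full ?size_map // all_map; apply/allP => x _ /=.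
  by rewrite ltn_addr.
have cu' j l : conj_part (map (addn m) l) (m + j) = conj_part l j.
  by rewrite /conj_part count_map; apply: eq_count => x /=; rewrite ltn_add2l.
rewrite starts_up ends_up seg_det_split => [|i j /andP[mi _] jm].
  rewrite seg_det_unit // ?mul1r => [|i im|i j /andP[ji im]].
  - by apply: eq_seg_det => j _; rewrite /shifted cu' addnA.
  - by rewrite /shifted !cu // !size_map.
  - by rewrite /shifted !cu // ?size_map; [lia|exact: ltn_trans im].
rewrite /shifted cu // size_map; have := conj_part_size (map (addn m) (ends t)) i.
rewrite !size_map; lia.
Qed.

(** Below column [a], the first part of lam for [t2], all boxes belong to [t2]; from [a] on, to
    [t1]. The matrix is block triangular there, and in the matrix of each piece the block of the
    other piece is unitriangular. *)
Lemma jt_cat n s g t1 t2 : skew_rows (t1 ++ t2) -> cutok t1 t2 ->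
    (size (t1 ++ t2) <= n)%N -> (head 0 (ends (t1 ++ t2)) <= s)%N ->
  jt f n s g (t1 ++ t2) = jt f n s g t1 * jt f (n - size t1) s g t2.
Proof.
move=> sk ok tn hs; have [sk1 sk2] := skew_cat sk.
have /andP[_ se2] := sk2; have /andP[_ se] := sk.
set a := head 0%N (ends t2).
have as_ : (a <= s)%N.
  rewrite /a; case E: (ends t2) => [//|x l] /=; apply: leq_trans hs.
  move/allP: (all_le_head se); apply; rewrite -/(ends _) /ends map_cat mem_cat.
  by rewrite -/(ends t2) E mem_head orbT.
have e2 j : (a <= j)%N -> conj_part (ends t2) j = 0%N.
  move=> aj; rewrite conj_part_eq0 //; apply: sub_all (all_le_head se2) => x.
  by move=> /leq_trans; apply.
have s2 j : (a <= j)%N -> conj_part (starts t2) j = 0%N.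
  move=> aj; rewrite conj_part_eq0 // all_starts_le //.
  by apply: sub_all (all_le_head se2) => x /leq_trans; apply.
have al1 j : (j < a)%N -> all (ltn j) (starts t1).
  move=> ja; apply/allP => x x1; apply: leq_trans ja _; rewrite /a.
  case E: (ends t2) => [//|y l]; move: ok; rewrite cutokE => /allrelP; apply => //.
  by rewrite E mem_head.
have s1 j : (j < a)%N -> conj_part (starts t1) j = size t1.
  by move=> ja; rewrite conj_part_full ?size_map ?al1.
have e1 j : (j < a)%N -> conj_part (ends t1) j = size t1.
  by move=> ja; rewrite conj_part_full ?size_map ?all_ends_gt ?al1.
have sc j : conj_part (starts (t1 ++ t2)) j = (conj_part (starts t1) j + conj_part (starts t2) j)%N.
  by rewrite /starts map_cat conj_part_cat.
have ec j : conj_part (ends (t1 ++ t2)) j = (conj_part (ends t1) j + conj_part (ends t2) j)%N.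
  by rewrite /ends map_cat conj_part_cat.
have b1 j : (conj_part (ends t1) j <= size t1)%N.
  by rewrite (leq_trans (conj_part_size _ _)) ?size_map.
have b2 j : (conj_part (ends t2) j <= size t2)%N.
  by rewrite (leq_trans (conj_part_size _ _)) ?size_map.
move: tn; rewrite size_cat => tn.
rewrite /jt -(subnKC as_) !seg_det_split; last first.
- by move=> i j /andP[ai _] ja; rewrite /shifted sc ec s1 // e2 //; have := b1 i; lia.
- by move=> i j /andP[ai _] ja; rewrite /shifted s1 //; have := b1 i; lia.
- by move=> i j /andP[ai _] ja; rewrite /shifted e2 //; lia.
rewrite (@seg_det_unit _ _ f g a (shifted n (starts t1))) //; last first.
- by move=> i j /andP[ji ia]; rewrite /shifted s1 ?e1 //; lia.
- by move=> i ia; rewrite /shifted s1 ?e1.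
rewrite mul1r (@seg_det_unit _ _ f g (s - a) (fun j => shifted (n - size t1) (starts t2) (a + j)%N)) //; last first.
- by move=> i j /andP[ji ia]; rewrite /shifted s2 ?e2 //; lia.
- by move=> i ia; rewrite /shifted s2 ?e2; lia.
rewrite mulr1 [RHS]mulrC; congr (_ * _); apply: eq_seg_det => j ja; rewrite /shifted ?sc ?ec.
- by rewrite s1 //; lia.
- by rewrite e1 //; lia.
- by rewrite s2 ?leq_addr // addn0.
- by rewrite e2 ?leq_addr // addn0.
Qed.

(** Extension by 0 outside the diagonal row lists is compatible with cuts by [diagonal_cat]. *)
Definition jtrows t : R :=
  if `[<diagonal t>] then jt f (size t) (head 0%N (ends t)) (reading t) t else 0.

Lemma jtrowsE n s g t : skew_rows t -> along g n t -> (size t <= n)%N ->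
  (head 0 (ends t) <= s)%N -> jtrows t = jt f n s g t.
Proof.
move=> sk al tn hs; have d := reading_along tn al.
rewrite /jtrows (asboolT d) (@jt_size _ _ s) //.
exact: jt_ext.
Qed.

Lemma jtrows0 t : ~ diagonal t -> jtrows t = 0.
Proof. by move=> nd; rewrite /jtrows (asboolF nd). Qed.

Lemma multiplicative_jtrows : multiplicative_rows jtrows.
Proof.
have d0 : diagonal ([::] : seq (trow A)) by move=> i j a; rewrite /rentry nth_nil /= onth0n.
split.
- by rewrite /jtrows (asboolT d0) /jt /seg_det det_mx00.
- have dz : diagonal [:: (0%N, [::]) : trow A].
    by case=> [|i] j a; rewrite /rentry /= ?nth_nil /= onth0n.
  by rewrite /jtrows (asboolT dz) /jt /seg_det det_mx00.
- move=> t1 t2 sk ok; have [sk1 sk2] := skew_cat sk.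
  have [d|nd] := pselect (diagonal (t1 ++ t2)); last first.
    rewrite (jtrows0 nd); have [d1|nd1] := pselect (diagonal t1); last by rewrite (jtrows0 nd1) mul0r.
    have [d2|nd2] := pselect (diagonal t2); last by rewrite (jtrows0 nd2) mulr0.
    by case: nd; apply/diagonal_cat.
  set n := size (t1 ++ t2); have le1 : (size t1 <= n)%N by rewrite /n size_cat leq_addr.
  have [al1 al2] := (along_cat (reading (t1 ++ t2)) t2 le1).1 d.
  have hs r : {subset ends r <= ends (t1 ++ t2)} ->
      (head 0 (ends r) <= head 0 (ends (t1 ++ t2)))%N.
    case: (ends r) => [//|x l] /= sub; have /andP[_ se] := sk.
    by move/allP: (all_le_head se); apply; apply: sub; apply: mem_head.
  rewrite (jtrowsE sk d (leqnn _) (leqnn _)) jt_cat //; congr (_ * _).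
    apply/esym/jtrowsE => //; apply: hs => x.
    by rewrite /ends map_cat mem_cat => ->.
  apply/esym/jtrowsE => //; first by rewrite /n size_cat addKn.
  by apply: hs => x; rewrite /ends map_cat mem_cat orbC => ->.
move=> m t sk; have [d|nd] := pselect (diagonal t); last first.
  by rewrite !jtrows0 // => /diagonal_up.
have du : diagonal (up m t) by apply/diagonal_up.
have al : along (reading (up m t)) (size t + m) t.
  by apply/along_up => //; move: du; rewrite /diagonal size_map.
rewrite (jtrowsE (n := size t + m) (s := head 0%N (ends t)) sk al) ?leq_addr //.
rewrite -jt_up // -(jtrowsE (t := up m t)) ?skew_up ?size_map //.
  by move: du; rewrite /diagonal size_map.
by rewrite ends_up; case: (ends t).
Qed.

End JacobiTrudiPieces.

(** * The cut coproduct *)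

Section TableauClasses.
Variables (k : comNzRingType) (A : countType).
Implicit Types (t : seq (trow A)) (h : tableau A).
Local Notation tcls := (@tcls k A).

Lemma tabalg_pi_ideal p q : cut_ideal (p - q) -> tabalg_pi p = tabalg_pi q :> tabalg k A.
Proof. by move=> pq; apply/eqP; rewrite -Quotient.idealrBE; apply/asboolP. Qed.

Lemma tcls_empty : tcls (empty_tab A) = 1.
Proof.
rewrite tcls.unlock -(rmorph1 (@tabalg_pi k A)).
exact/tabalg_pi_ideal/cut_ideal_unit.
Qed.

Lemma tcls_SC h : tcls h = \prod_(i <- SC h) tcls i.
Proof.
rewrite tcls.unlock -(rmorph_prod (@tabalg_pi k A)).
exact/tabalg_pi_ideal/cut_ideal_SC.
Qed.

Definition rcls t : tabalg k A := tcls (mktab t).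

Lemma cut_rows_cat t1 t2 : cutok t1 t2 -> cut_rows (t1 ++ t2) = cut_rows t1 ++ cut_rows t2.
Proof.
elim: t1 => [//|r t1 IH]; rewrite /cutok allrel_consl => /andP[rok ok].
case: t1 IH ok => [|r1 t1] IH ok.
  case: t2 rok {IH ok} => [//|r' t2] /andP[rr' _].
  by rewrite cat1s cut_rows_cons2 rr'.
rewrite !cat_cons !cut_rows_cons2 -cat_cons IH //.
have [p [c ->]] : exists p c, cut_rows (r1 :: t1) = p :: c.
  case: t1 {IH ok} => [|r2 t1]; first by exists [:: r1], [::].
  case: (cut_rows _) (cut_rows_cons2 r1 r2 t1) => [|p c] E; last by exists p, c.
  by move: E; cbv zeta; case: ifP.
by cbv zeta; case: ifP.
Qed.

Lemma trim_cat t1 t2 : trim (t1 ++ t2) = trim t1 ++ trim t2.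
Proof. exact: filter_cat. Qed.

Lemma skew_trim t : skew_rows t -> skew_rows (trim t).
Proof. exact/skew_rows_subseq/filter_subseq. Qed.

Lemma rclsE t : skew_rows t -> rcls t = \prod_(p <- cut_rows (trim t)) rcls (shift_rows p).
Proof. by move=> sk; rewrite /rcls tcls_SC /SC rows_mktab // big_map. Qed.

Lemma rcls_cat t1 t2 : skew_rows (t1 ++ t2) -> cutok t1 t2 ->
  rcls (t1 ++ t2) = rcls t1 * rcls t2.
Proof.
move=> sk /allrelP ok; have [sk1 sk2] := skew_cat sk.
rewrite !rclsE // trim_cat cut_rows_cat ?big_cat //.
by apply/allrelP => r1 r2; rewrite !mem_filter => /andP[_ r1t] /andP[_ r2t]; apply: ok.
Qed.

Lemma rcls_empty_row n : rcls [:: (n, [::])] = 1.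
Proof.
have r0 : rcls [:: (0%N, [::])] = 1.
  rewrite /rcls; have -> : mktab [:: (0%N, [::])] = empty_tab A by apply/val_inj/rows_mktab.
  exact: tcls_empty.
case: n => [//|n]; rewrite rclsE // /trim /= big_seq1 /shift_rows /= subnn.
exact: r0.
Qed.

Lemma rcls_boxless t : skew_rows t -> boxless t -> rcls t = 1.
Proof.
elim: t => [|r t IH] sk bl.
  rewrite /rcls; have -> : mktab [::] = empty_tab A by apply/val_inj/rows_mktab.
  exact: tcls_empty.
move: (bl) => /= /andP[/eqP/size0nil r0 bt]; have [sk1 sk2] := @skew_cat _ [:: r] t sk.
rewrite -cat1s rcls_cat ?IH // ?mulr1; last first.
  case/andP: sk => /(order_path_min (@geq_trans)) s1 _; rewrite /cutok allrel1l.
  apply/allP => r' r't; move: (allP s1 (row_start r')); rewrite map_f // => /(_ isT).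
  by have /eqP/size0nil r'0 := allP bt r' r't; rewrite /= /row_end r'0 addn0.
by case: r r0 {sk sk1 bl} => n s /= ->; apply: rcls_empty_row.
Qed.

Lemma cut_rows_up m t : cut_rows (up m t) = map (up m) (cut_rows t).
Proof.
elim: t => [//|r [//|r' t] IH].
rewrite -[up m _]/(((r.1 + m)%N, r.2) :: ((r'.1 + m)%N, r'.2) :: up m t) !cut_rows_cons2.
have -> : (row_end ((r'.1 + m)%N, r'.2) <= row_start ((r.1 + m)%N, r.2))%N =
    (row_end r' <= row_start r)%N.
  by rewrite /row_end /row_start /= addnAC leq_add2r.
cbv zeta; move: IH; rewrite -[up m (r' :: t)]/(((r'.1 + m)%N, r'.2) :: up m t) => ->.
move: (cut_rows (r' :: t)) (row_end r' <= row_start r)%N => c b.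
by case: b => //=; case: c.
Qed.

Lemma shift_rows_of_up m t : shift_rows (up m t) = shift_rows t.
Proof.
rewrite /shift_rows -[map row_start (up m t)]/(starts (up m t)) starts_up.
case: t => [//|r t]; rewrite /up -map_comp; apply: eq_map => x /=; congr (_, _).
by rewrite last_map addnC subnDl.
Qed.

(** A row ending in 0 is trimmed from [t] but not from its translate. Such rows are split off first;
    having no boxes, they contribute 1 on both sides. *)
Lemma rcls_up m t : skew_rows t -> rcls (up m t) = rcls t.
Proof.
move=> sk; case: m => [|m].
  by congr rcls; rewrite /up -[RHS]map_id; apply: eq_map => -[a s] /=; rewrite addn0.
have ts := trim_split sk; have skt := skew_trim sk.
set z := filter _ _ in ts; have bz : boxless z.
  by apply/allP => r; rewrite mem_filter /row_end => /andP[]; lia.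
have cz : cutok (trim t) z.
  by apply/allrelP => r r' _; rewrite mem_filter => /andP[/eqP->].
have skz : skew_rows z by apply: skew_rows_subseq (filter_subseq _ _) sk.
rewrite ts [up _ _]map_cat -!/(up _ _) !rcls_cat -?ts //; last 2 first.
- by move: sk; rewrite -(skew_up m.+1) {1}ts [up _ _]map_cat.
- rewrite cutokE starts_up ends_up allrel_mapl allrel_mapr.
  by move: cz; rewrite cutokE; apply: sub_allrel => x y /=; rewrite leq_add2l.
rewrite [rcls z]rcls_boxless // [rcls (up _ z)]rcls_boxless ?skew_up ?boxless_up // !mulr1.
rewrite rclsE ?skew_up // [RHS]rclsE //.
have -> : trim (up m.+1 (trim t)) = up m.+1 (trim t).
  by apply/all_filterP; rewrite all_map; apply/allP => r _ /=; rewrite /row_end /=; lia.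
have -> : trim (trim t) = trim t by rewrite /trim filter_id.
by rewrite cut_rows_up big_map; apply: eq_bigr => p _; rewrite shift_rows_of_up.
Qed.

Lemma multiplicative_rcls : multiplicative_rows rcls.
Proof.
split; [exact: rcls_boxless|exact: rcls_boxless|exact: rcls_cat|exact: rcls_up].
Qed.

End TableauClasses.

Section DiagonalClasses.
Variables (k : comNzRingType) (A : countType).
Implicit Types (t : seq (trow A)) (h : tableau A).
Local Notation D := (diagalg k A).
Local Notation tcls := (@tcls k A).
Local Notation dcls := (@dcls k A).

Lemma boxless_diagonal t : boxless t -> diagonal t.
Proof.
move=> bt i j a ta; have it := rentry_size ta; move: ta; rewrite /rentry.
have /eqP/size0nil -> := allP bt _ (mem_nth (0%N, [::]) it).
by rewrite onth0n; case: ifP.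
Qed.

Lemma diagonal_trim t : skew_rows t -> diagonal (trim t) <-> diagonal t.
Proof.
move=> sk; have ts := trim_split sk; set z := filter _ _ in ts.
have cz : cutok (trim t) z.
  by apply/allrelP => r r' _; rewrite mem_filter => /andP[/eqP->].
rewrite [X in _ <-> diagonal X]ts diagonal_cat // -?ts //; split=> [d|[]//]; split=> //.
by apply: boxless_diagonal; apply/allP => r; rewrite mem_filter /row_end => /andP[]; lia.
Qed.

Lemma diagonal_constant_mktab t : skew_rows t -> diagonal_constant (mktab t) <-> diagonal t.
Proof. by move=> sk; rewrite diagonal_constantP rows_mktab // diagonal_trim. Qed.

Lemma mktab_rows h : mktab h = h.
Proof.
have /andP[sk pos] := rowsP h; apply/val_inj; rewrite /= rows_mktab //.
exact/all_filterP.
Qed.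

Lemma diagval_inj : injective (@diagval k A).
Proof. exact: val_inj. Qed.

Definition dcl t : D := if `[<diagonal t>] then dcls (mktab t) else 0.

Lemma diagval_dcl t : skew_rows t -> diagonal t -> diagval (dcl t) = rcls k t.
Proof.
by move=> sk d; rewrite /dcl asboolT // diagval_dcls //; apply/diagonal_constant_mktab.
Qed.

Lemma dcl0 t : ~ diagonal t -> dcl t = 0.
Proof. by move=> d; rewrite /dcl asboolF. Qed.

Lemma dcl_rows h : diagonal_constant h -> dcl h = dcls h.
Proof. by move/diagonal_constantP=> d; rewrite /dcl asboolT // mktab_rows. Qed.

Lemma diagval_is_monoid_morphism : monoid_morphism (@diagval k A).
Proof. by split. Qed.

Lemma multiplicative_dcl : multiplicative_rows dcl.
Proof.
split.
- apply: diagval_inj; rewrite diagval_dcl //; last exact: boxless_diagonal.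
  exact: mrow_nil (multiplicative_rcls k A).
- apply: diagval_inj; rewrite diagval_dcl //; last exact: boxless_diagonal.
  exact: mrow_zero (multiplicative_rcls k A).
- move=> t1 t2 sk ok; have [sk1 sk2] := skew_cat sk.
  have [d|nd] := pselect (diagonal (t1 ++ t2)).
    have [d1 d2] := (diagonal_cat sk ok).1 d.
    apply: diagval_inj; rewrite (diagval_is_monoid_morphism.2 (dcl t1) (dcl t2)).
    by rewrite !diagval_dcl // rcls_cat.
  rewrite dcl0 //; have [d1|nd1] := pselect (diagonal t1); last by rewrite (dcl0 nd1) mul0r.
  have [d2|nd2] := pselect (diagonal t2); last by rewrite (dcl0 nd2) mulr0.
  by case: nd; apply/diagonal_cat.
move=> m t sk; have [d|nd] := pselect (diagonal t); last first.
  by rewrite !dcl0 // => /diagonal_up.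
apply: diagval_inj; rewrite !diagval_dcl ?skew_up ?rcls_up //.
exact/diagonal_up.
Qed.

(** Place [h1] above [h2] and to the right of its longest row: the joint is a cut, so the class of
    the result is the product. *)
Lemma tcls_mul_diagonal h1 h2 : diagonal_constant h1 -> diagonal_constant h2 ->
  exists2 h, diagonal_constant h & tcls h1 * tcls h2 = tcls h.
Proof.
move=> /diagonal_constantP d1 /diagonal_constantP d2.
have /andP[sk1 _] := rowsP h1; have /andP[sk2 _] := rowsP h2; move: (sk2) => /andP[_ se2].
set t := up (head 0%N (ends h2)) h1 ++ h2.
have ok : cutok (up (head 0%N (ends h2)) h1) h2.
  rewrite cutokE starts_up; apply/allrelP => x y /mapP[x' _ ->] yh.
  by apply: leq_trans (leq_addr _ _); apply: (allP (all_le_head se2)).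
have sk : skew_rows t.
  have sk1' : skew_rows (up (head 0%N (ends h2)) h1) by rewrite skew_up.
  rewrite /skew_rows /t !map_cat; apply/andP; split; rewrite sorted_cat_geq.
  - by case/andP: sk1' => -> _; case/andP: sk2.
  - apply: (cutok_fits _ _ ok); [exact: fits_starts|exact: fits_starts].
  - by case/andP: sk1' => _ ->.
  - apply: (cutok_fits _ _ ok); [exact: fits_ends|exact: fits_ends].
exists (mktab t); first by apply/diagonal_constant_mktab => //; apply/diagonal_cat => //; split=> //; apply/diagonal_up.
rewrite -/(rcls k t) rcls_cat // rcls_up // /rcls !mktab_rows //.
Qed.

(** Since products of diagonal constant tableaux are again such tableaux, the generated subalgebra
    is a span; linear identities on [D] can thus be tested on single tableaux ([diagalg_span]). *)
Lemma diag_gen_span (x : tabalg k A) : diag_gen x ->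
  exists2 s : seq (k * tableau A), (forall p, p \in s -> diagonal_constant p.2) &
    x = \sum_(p <- s) p.1 *: tcls p.2.
Proof.
elim=> [h hd||c y z _ [s sd ->] _ [s' sd' ->]|y z _ [s sd ->] _ [s' sd' ->]].
- exists [:: (1, h)]; first by move=> p; rewrite inE => /eqP->.
  by rewrite big_seq1 scale1r.
- exists [:: (1, empty_tab A)]; last by rewrite big_seq1 scale1r tcls_empty.
  by move=> p; rewrite inE => /eqP->; apply/diagonal_constantP/boxless_diagonal.
- exists ([seq (c * p.1, p.2) | p <- s] ++ s').
    by move=> p; rewrite mem_cat => /orP[/mapP[q /sd qd ->]|/sd'].
  rewrite big_cat big_map scaler_sumr; congr (_ + _); apply: eq_bigr => p _.
  by rewrite scalerA.
have [s2 h2 ->] : exists2 s2 : seq (k * tableau A), (forall p, p \in s2 -> diagonal_constant p.2) &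
    (\sum_(p <- s) p.1 *: tcls p.2) * (\sum_(p <- s') p.1 *: tcls p.2) =
    \sum_(p <- s2) p.1 *: tcls p.2; last by exists s2.
elim: s sd => [|p s IH] sd; first by exists [::] => //; rewrite !big_nil mul0r.
have [|s2 h2 E] := IH; first by move=> q qs; apply: sd; rewrite inE qs orbT.
have pd : diagonal_constant p.2 by apply: sd; rewrite mem_head.
rewrite big_cons mulrDl E.
have [s3 h3 ->] : exists2 s3 : seq (k * tableau A), (forall p, p \in s3 -> diagonal_constant p.2) &
    (p.1 *: tcls p.2) * (\sum_(p <- s') p.1 *: tcls p.2) = \sum_(p <- s3) p.1 *: tcls p.2.
  elim: s' sd' {IH E} => [|q s' IH] sd'; first by exists [::] => //; rewrite !big_nil mulr0.
  have [|s3 h3 E] := IH; first by move=> r rs; apply: sd'; rewrite inE rs orbT.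
  have [h hd hE] := tcls_mul_diagonal pd (sd' q (mem_head _ _)).
  exists ((p.1 * q.1, h) :: s3); first by move=> r; rewrite inE => /orP[/eqP->|/h3].
  rewrite !big_cons mulrDr E; congr (_ + _).
  by rewrite -scalerAl -scalerAr scalerA hE.
exists (s3 ++ s2); last by rewrite big_cat.
by move=> q; rewrite mem_cat => /orP[/h3|/h2].
Qed.

Lemma diagalg_span (P : D -> Prop) : P 0 -> (forall c x y, P x -> P y -> P (c *: x + y)) ->
  (forall h, diagonal_constant h -> P (dcls h)) -> forall x, P x.
Proof.
move=> P0 PD Ph x; have /asboolP/diag_gen_span [s sd xE] := diagvalP x.
have -> : x = \sum_(p <- s) p.1 *: dcls p.2.
  apply: diagval_inj; rewrite xE.
  have sumE r : diagval (\sum_(p <- r) p.1 *: dcls p.2) = \sum_(p <- r) p.1 *: diagval (dcls p.2).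
    elim: r => [|p r IH]; first by rewrite !big_nil.
    by rewrite !big_cons -IH.
  rewrite sumE big_seq [RHS]big_seq; apply: eq_bigr => p /sd pd.
  by rewrite diagval_dcls.
elim: s sd {xE} => [|p s IH] sd; first by rewrite big_nil.
rewrite big_cons; apply: PD; first by apply/Ph/sd/mem_head.
by apply: IH => q qs; apply: sd; rewrite inE qs orbT.
Qed.

End DiagonalClasses.

Section Counit.
Variables (k : comNzRingType) (A : countType).
Local Notation D := (diagalg k A).

Lemma counit_exists :
  exists f : {lrmorphism tabalg k A -> k^o}, forall h, f (tcls k h) = (boxless h)%:R.
Proof.
have [f fE] := tabalg_universal (B := k^o) (@multiplicative_boxless A k^o).
by exists f.
Qed.

(** A copy of [talg D D] which is registered as a nonzero ring, as [tabalg_universal] asks of its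
    target. *)
Definition dtens : Type := talg D D.
HB.instance Definition _ := GRing.Lmodule.on dtens.
HB.instance Definition _ := GRing.ComPzRing.on dtens.

(** The product of the counit values on the two tensor factors is a functional sending 1 to 1. *)
Lemma dtens1_neq0 : 1 != 0 :> dtens.
Proof.
have [f _] := counit_exists.
pose b (x y : D) : k^o := f (diagval x) * f (diagval y).
have fP c (x y : D) : f (diagval (c *: x + y)) = c * f (diagval x) + f (diagval y).
  exact: (linearP f c (diagval x) (diagval y)).
have b_l y : linear (fun x => b x y) by move=> c x x'; rewrite /b fP mulrDl -mulrA.
have b_r x : linear (b x) by move=> c y y'; rewrite /b fP mulrDr mulrCA.
apply/eqP => /(congr1 (tlift b)); rewrite [tlift b 0](_ : _ = 0); last first.
  by have := tlift_linear b_l b_r (-1) 0 0; rewrite !scaleN1r !addNr.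
rewrite [LHS](tlift_pure b_l b_r 1 1) /b [diagval 1]/(1 : tabalg k A) rmorph1 mulr1 => /eqP.
by rewrite oner_eq0.
Qed.
HB.instance Definition _ := GRing.PzSemiRing_isNonZero.Build dtens dtens1_neq0.

Fact dtens_scaleAl (c : k) (x y : dtens) : c *: (x * y) = (c *: x : dtens) * y.
Proof. exact: (tmulZl (c) (x : talg D D) (y : talg D D)). Qed.
HB.instance Definition _ := GRing.Lmodule_isLalgebra.Build k dtens dtens_scaleAl.
HB.instance Definition _ := GRing.Lalgebra_isComAlgebra.Build k dtens.

Lemma restrict_rows_starts (h : tableau A) e : fits h e ->
  restrict_rows h (inner h) e = top h e.
Proof.
move=> fe; apply: (@eq_from_nth _ (0%N, [::])); first by rewrite size_map size_iota size_top.
move=> i; rewrite size_map size_iota => ih; rewrite (nth_map 0%N) ?size_iota // nth_iota //.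
rewrite (nth_map ((0%N, [::]), 0%N)); last by rewrite size_zip (fits_size fe) minnn.
rewrite nth_zip /=; last by rewrite (fits_size fe).
by rewrite /inner (nth_map (0%N, [::])) // subnn drop0.
Qed.

Lemma restrict_rows_ends (h : tableau A) e : fits h e ->
  restrict_rows h e (outer h) = bot h e.
Proof.
move=> fe; apply: (@eq_from_nth _ (0%N, [::])); first by rewrite size_map size_iota size_bot.
move=> i; rewrite size_map size_iota => ih; rewrite (nth_map 0%N) ?size_iota // nth_iota //.
rewrite (nth_map ((0%N, [::]), 0%N)); last by rewrite size_zip (fits_size fe) minnn.
rewrite nth_zip /=; last by rewrite (fits_size fe).
by rewrite /outer (nth_map (0%N, [::])) // /row_end addKn take_size.
Qed.

Lemma between_cuts (h : tableau A) e : between h e = (e \in cuts h).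
Proof.
rewrite mem_cuts /between; congr (_ && _); rewrite /part_sub /fits /inner /outer.
elim: (rows h) e => [|r t IH] [|x e] //; rewrite [LHS]/= [RHS]/= -IH.
exact: andbACA.
Qed.

Lemma parts_inj (h : tableau A) : injective (@parts A h).
Proof. by move=> e f /(inj_map val_inj)/val_inj. Qed.

Lemma parts_surj (h : tableau A) e : e \in cuts h -> exists f : box h, parts f = e.
Proof.
move=> ec; move: (ec); rewrite mem_cuts => /andP[_ fe]; have ze := fits_size fe.
have le : all (fun x => x < (largest_part h).+1)%N e.
  have /andP[_ se] : skew_rows h by case/andP: (rowsP h).
  apply: (fits_le (x := largest_part h) fe).
  exact: all_le_head.
have [s sE] : exists s : seq 'I_(largest_part h).+1, map val s = e.
  elim: e le {ec fe ze} => [_|x e IH] /=; first by exists [::].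
  by case/andP=> xl /IH [s <-]; exists (Ordinal xl :: s).
have sz : size s == size h by rewrite -ze -sE size_map.
by exists (Tuple sz).
Qed.

(** Bridge from sums over the finite type of bounded sequences to sums over the explicit list
    [cuts h]. *)
Lemma big_box (V : nmodType) (h : tableau A) (P : pred (seq nat)) (F : seq nat -> V) :
    (forall e, P e -> e \in cuts h) ->
  \sum_(e : box h | P (parts e)) F (parts e) = \sum_(e <- cuts h | P e) F e.
Proof.
move=> Pc; rewrite -[RHS]big_filter -(big_map (@parts A h) P F).
rewrite -[LHS]big_filter; apply: perm_big; apply: uniq_perm.
- by rewrite filter_uniq // map_inj_uniq ?index_enum_uniq //; apply: parts_inj.
- exact/filter_uniq/cuts_uniq.
move=> e; rewrite mem_filter [RHS]mem_filter; case Pe: (P e) => //=.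
rewrite Pc //; have [f <-] := parts_surj (Pc _ Pe).
by rewrite map_f // mem_index_enum.
Qed.

Lemma big_between (V : nmodType) (h : tableau A) (F G : seq nat -> V) :
    {in cuts h, F =1 G} ->
  \sum_(e : box h | between h (parts e)) F (parts e) = \sum_(e <- cuts h) G e.
Proof.
move=> FG; rewrite (big_box F) => [|e]; last by rewrite between_cuts.
rewrite big_seq_cond [RHS]big_seq; apply: eq_big => [e|e /andP[/FG //]].
by rewrite between_cuts andbb.
Qed.

(** The cut coproduct as the convolution of the two inclusions of [D] into the tensor product; its
    multiplicativity then comes from [multiplicative_convolution]. *)
Definition cut_product (t : seq (trow A)) : dtens :=
  convolution (fun t => tpr (dcl k t) 1 : dtens) (fun t => tpr 1 (dcl k t) : dtens) t.

Lemma multiplicative_cut_product : multiplicative_rows cut_product.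
Proof.
apply: multiplicative_convolution.
- apply: (multiplicative_rmorph (f := fun x : D => tpr x 1 : dtens)); last exact: multiplicative_dcl.
  by split=> // x y; apply: (etrans _ (esym (tprM x y 1 1))); rewrite mulr1.
apply: (multiplicative_rmorph (f := fun x : D => tpr 1 x : dtens)); last exact: multiplicative_dcl.
by split=> // x y; apply: (etrans _ (esym (tprM 1 1 x y))); rewrite mulr1.
Qed.

Lemma cut_productE t : cut_product t =
  \sum_(e <- cuts t) tpure (dcl k (top t e)) (dcl k (bot t e)).
Proof.
apply: eq_bigr => e _; apply: (etrans (tprM _ _ _ _)).
by rewrite mulr1 mul1r.
Qed.

Lemma coproduct_exists : exists f : {lrmorphism tabalg k A -> dtens},
  forall h, f (tcls k h) = \sum_(e <- cuts h) tpure (dcl k (top h e)) (dcl k (bot h e)).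
Proof.
have [f fE] := tabalg_universal multiplicative_cut_product.
by exists f => h; rewrite fE cut_productE.
Qed.

Lemma dcl_restrict_starts (h : tableau A) e : diagonal h -> e \in cuts h ->
  dcls k (restrict h (inner h) e) = dcl k (top h e).
Proof.
move=> d; rewrite mem_cuts => /andP[_ fe]; rewrite /restrict restrict_rows_starts //.
by rewrite /dcl asboolT //; apply: diagonal_top.
Qed.

Lemma dcl_restrict_ends (h : tableau A) e : diagonal h -> e \in cuts h ->
  dcls k (restrict h e (outer h)) = dcl k (bot h e).
Proof.
move=> d; rewrite mem_cuts => /andP[_ fe]; rewrite /restrict restrict_rows_ends //.
by rewrite /dcl asboolT //; apply: diagonal_bot.
Qed.

Lemma cut_coproductP (Delta : D -> tens D D) :
  (forall h, diagonal_constant h -> Delta (dcls k h) =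
    \sum_(e <- cuts h) tpure (dcl k (top h e)) (dcl k (bot h e))) <->
  is_cut_coproduct Delta.
Proof.
suff E (h : tableau A) : diagonal h ->
    \sum_(e : box h | between h (parts e))
      tpure (dcls k (restrict h (inner h) (parts e))) (dcls k (restrict h (parts e) (outer h))) =
    \sum_(e <- cuts h) tpure (dcl k (top h e)) (dcl k (bot h e)).
  by split=> DE h hd; rewrite DE // E //; apply/diagonal_constantP.
move=> d; pose F e := tpure (dcls k (restrict h (inner h) e)) (dcls k (restrict h e (outer h))).
apply: (big_between (F := F)) => e ec.
have E1 := dcl_restrict_starts d ec. have E2 := dcl_restrict_ends d ec.
exact: (f_equal2 (@tpure k D D) E1 E2).
Qed.

End Counit.

(** * Linearization *)

Section HorizontalStrips.
Variable A : countType.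
Implicit Types (t : seq (trow A)).

Definition strip t : bool := horizontal_strip (ends t) (starts t).

Lemma conj_part_fit t j : (conj_part (starts t) j <= conj_part (ends t) j)%N.
Proof. by have /andP[/leq_trans h /h] := conj_part_fits j (fits_ends t). Qed.

Lemma count_column t j :
  count (fun i => nth 0%N (starts t) i <= j < nth 0%N (ends t) i)%N (iota 0 (size (ends t))) =
  (conj_part (ends t) j - conj_part (starts t) j)%N.
Proof.
elim: t => [//|r t IH]; have -> : iota 0 (size (ends (r :: t))) = 0%N :: map (addn 1) (iota 0 (size (ends t))).
  by rewrite -iotaDl.
rewrite [LHS]/= count_map (eq_count (a2 := fun i => (nth 0%N (starts t) i <= j < nth 0%N (ends t) i)%N)) // IH.
rewrite /conj_part /= -!/(conj_part _ _); have := conj_part_fit t j.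
have := leq_addr (size r.2) r.1; rewrite -/(row_end r) -/(row_start r); lia.
Qed.

Lemma stripP t : skew_rows t ->
  reflect (forall j, conj_part (ends t) j <= (conj_part (starts t) j).+1)%N (strip t).
Proof.
case/andP=> _ se; apply: (iffP allP) => h j.
  case: (ltnP j (head 0%N (ends t))) => jh.
    by have := h j; rewrite mem_iota jh count_column => /(_ isT); lia.
  rewrite conj_part_eq0 //; apply: sub_all (all_le_head se) => x.
  by move=> /leq_trans; apply.
by move=> _; rewrite count_column; have := h j; lia.
Qed.

(** As for determinants, each column has boxes in only one of the two pieces. *)
Lemma strip_cat t1 t2 : skew_rows (t1 ++ t2) -> cutok t1 t2 ->
  strip (t1 ++ t2) = strip t1 && strip t2.
Proof.
move=> sk ok; have [sk1 sk2] := skew_cat sk.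
have /andP[_ se2] := sk2; set a := head 0%N (ends t2).
have e2 j : (a <= j)%N -> conj_part (ends t2) j = 0%N.
  move=> aj; rewrite conj_part_eq0 //; apply: sub_all (all_le_head se2) => x.
  by move=> /leq_trans; apply.
have s1 j : (j < a)%N -> conj_part (starts t1) j = size t1.
  move=> ja; rewrite conj_part_full ?size_map //; apply/allP => x x1.
  apply: leq_trans ja _; rewrite /a.
  case E: (ends t2) => [//|y l]; move: ok; rewrite cutokE => /allrelP; apply => //.
  by rewrite E mem_head.
have b1 j : (conj_part (ends t1) j <= size t1)%N.
  by rewrite (leq_trans (conj_part_size _ _)) ?size_map.
have cc j := (conj_part_cat (starts t1) (starts t2) j, conj_part_cat (ends t1) (ends t2) j).
apply/(stripP sk)/andP => [h|[/(stripP sk1) h1 /(stripP sk2) h2] j].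
  split; [apply/(stripP sk1)|apply/(stripP sk2)] => j; have := h j;
    rewrite /ends /starts !map_cat !cc -!/(starts _) -!/(ends _);
    have := conj_part_fit t1 j; have := conj_part_fit t2 j;
    (case: (ltnP j a) => [/s1 c1|/e2 c2]; [rewrite !c1; have := b1 j|rewrite !c2]); lia.
rewrite /ends /starts !map_cat !cc -!/(starts _) -!/(ends _).
have := h1 j; have := h2 j; have := conj_part_fit t1 j; have := conj_part_fit t2 j.
by (case: (ltnP j a) => [/s1 c1|/e2 c2]; [rewrite !c1; have := b1 j|rewrite !c2]); lia.
Qed.

Lemma strip_up m t : skew_rows t -> strip (up m t) = strip t.
Proof.
move=> sk; have sku : skew_rows (up m t) by rewrite skew_up.
have cu j l : conj_part (map (addn m) l) (m + j) = conj_part l j.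
  by rewrite /conj_part count_map; apply: eq_count => x /=; rewrite ltn_add2l.
apply/(stripP sku)/(stripP sk) => h j.
  by have := h (m + j)%N; rewrite starts_up ends_up !cu.
rewrite starts_up ends_up; case: (leqP m j) => mj; first by rewrite -(subnKC mj) !cu.
rewrite (conj_part_full (l := map (addn m) (starts t))).
  by rewrite ltnW // ltnS (leq_trans (conj_part_size _ _)) // !size_map.
by rewrite all_map; apply/allP => x _ /=; rewrite ltn_addr.
Qed.

(** If a later row reached past the start of [r], the column [row_start r] would contain two boxes.
    A horizontal strip is therefore a product of single rows. *)
Lemma strip_cutok r t : skew_rows (r :: t) -> strip (r :: t) -> cutok [:: r] t.
Proof.
move=> sk /(stripP sk) /(_ (row_start r)); rewrite /cutok allrel1l => h.
apply/allP => r' r't; rewrite leqNgt; apply/negP => lt.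
have /andP[/(order_path_min (@geq_trans)) sm /(order_path_min (@geq_trans)) em] := sk.
have s0 : conj_part (starts (r :: t)) (row_start r) = 0%N.
  by rewrite conj_part_eq0 //= leqnn; apply: sub_all sm.
have rr : (row_start r < row_end r)%N.
  by apply: leq_trans lt _; apply: (allP em); apply: map_f.
move: h; rewrite s0 /conj_part /= rr add1n ltnS leqn0 => /eqP c0.
suff : (0 < count (ltn (row_start r)) (map row_end t))%N by rewrite c0.
by rewrite -has_count; apply/hasP; exists (row_end r') => //; apply: map_f.
Qed.

End HorizontalStrips.

Section StripValue.
Variables (k : comNzRingType) (A : countType) (d : comm_product k A).
Implicit Types (t : seq (trow A)).
Local Notation U := (unitization d).

Definition content t : seq A := flatten (map snd t).

Lemma content_cat t1 t2 : content (t1 ++ t2) = content t1 ++ content t2.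
Proof. by rewrite /content map_cat flatten_cat. Qed.

Lemma content_nil t : boxless t = (content t == [::]).
Proof. by elim: t => //= -[n s] t ->; rewrite /content /=; case: s. Qed.

Definition letter (a : A) : U := uletter d << a >>.

Lemma dia_prodE a s : uletter d (dia_prod d (a :: s)) = \prod_(b <- a :: s) letter b.
Proof.
rewrite /=; elim/last_ind: s => [|s b IH]; first by rewrite big_seq1.
by rewrite foldl_rcons -uletterM IH -rcons_cons big_rcons /= mulrC.
Qed.

(** Valued in k + kA so that shapes without boxes get 1; [dia_prod] has no meaningful value on the
    empty sequence. *)
Definition strip_value t : U := if strip t then \prod_(a <- content t) letter a else 0.

Lemma strip_value_boxless t : skew_rows t -> boxless t -> strip_value t = 1.
Proof.
move=> sk bt; rewrite /strip_value ifT.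
  by move: bt; rewrite content_nil => /eqP ->; rewrite big_nil.
have es : ends t = starts t.
  by elim: (t) bt => //= r u IH /andP[/eqP r0 /IH ->]; rewrite /row_end r0 addn0.
by apply/stripP => // j; rewrite es.
Qed.

Lemma strip_valueE t : ~~ boxless t ->
  strip_value t = if strip t then uletter d (dia_prod d (content t)) else 0.
Proof.
rewrite content_nil /strip_value; case: (content t) => // a s _.
by rewrite dia_prodE.
Qed.

Lemma multiplicative_strip_value : multiplicative_rows strip_value.
Proof.
split; [exact: strip_value_boxless|exact: strip_value_boxless| |].
  move=> t1 t2 sk ok; rewrite /strip_value strip_cat // content_cat big_cat /=.
  by case: (strip t1); case: (strip t2) => /=; rewrite ?mulr0 ?mul0r.
move=> m t sk; rewrite /strip_value strip_up //; congr (if _ then _ else _).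
by congr bigop; rewrite /content /up -map_comp.
Qed.

(** The heads that [dsplit] can take off a word: nothing, one letter, never more. *)
Definition column_value (w : seq A) : U :=
  match w with [::] => 1 | [:: a] => letter a | _ => 0 end.

Lemma column_value1 : column_value [::] = 1. Proof. by []. Qed.

Lemma column_value_eq0 g x y : ~~ (y <= x <= y.+1)%N -> jt_entry column_value g x y = 0.
Proof.
rewrite /jt_entry; case: leqP => //= yx; rewrite -ltnNge => yx2.
rewrite /eval_word /segment; have -> : (x - y = (x - y).-2.+2)%N by lia.
by rewrite /=; case: ifP => //=; case: (g _) => //= a; case: (g _).
Qed.

(* The indices of the rows and columns of the matrix increase, so a permutation
   with a nonzero term is increasing, hence trivial. *)
Lemma jt_column_value n s g t : skew_rows t -> (size t <= n)%N ->
  jt column_value n s g t =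
    \prod_(i < s) jt_entry column_value g (shifted n (starts t) i) (shifted n (ends t) i).
Proof.
move=> sk tn; rewrite /jt /seg_det /determinant (bigD1 (1%g : 'S_s)) //=.
rewrite odd_perm1 mul1r [X in _ + X]big1 ?addr0.
  by apply: eq_bigr => i _; rewrite mxE perm1.
move=> p p1; set x := shifted _ _; set y := shifted _ _.
have [/forallP h|] := boolP [forall i : 'I_s, (y i <= x (p i) <= (y i).+1)%N]; last first.
  rewrite negb_forall => /existsP[i nle].
  by rewrite (bigD1 i) //= mxE column_value_eq0 // mul0r mulr0.
have yi i j : (i < j)%N -> (y i < y j)%N by apply: shifted_ltn; rewrite size_map.
have xi i j : (i < j)%N -> (x i < x j)%N by apply: shifted_ltn; rewrite size_map.
have pm (i j : 'I_s) : (i < j)%N -> (p i < p j)%N.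
  move=> ij; case: (ltngtP (p i) (p j)) => // [ji|/val_inj/perm_inj e].
    have /andP[_ h1] := h i; have /andP[h2 _] := h j.
    by have := xi _ _ ji; have := yi _ _ ij; lia.
  by rewrite e ltnn in ij.
case/eqP: p1; apply/permP => i; rewrite perm1; apply/val_inj => /=.
have ge (q : 'S_s) : (forall i j : 'I_s, (i < j)%N -> (q i < q j)%N) -> forall i : 'I_s, (i <= q i)%N.
  move=> qm [j js]; elim: j js => [//|j IH] js /=.
  by apply: leq_ltn_trans (IH (ltnW js)) _; apply: qm.
apply/eqP; rewrite eqn_leq ge // andbT.
have := ge (p^-1)%g _ (p i); rewrite permK; apply=> a b ab.
case: (ltngtP ((p^-1)%g a) ((p^-1)%g b)) => // [/pm|/val_inj/perm_inj e].
  by rewrite !permKV; lia.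
by rewrite e ltnn in ab.
Qed.

(** Only the diagonal term survives. If the shape is not a strip, a column with two boxes makes one
    factor 0; if it is, [strip_cutok] reduces to one row, whose diagonal entries are its letters. *)
Lemma jt_strip_value t : skew_rows t -> diagonal t -> jtrows column_value t = strip_value t.
Proof.
elim: t => [|r t IH] sk dt.
  rewrite (mrow_nil multiplicative_strip_value).
  by rewrite (mrow_nil (multiplicative_jtrows column_value1)).
have [st|nst] := boolP (strip (r :: t)); last first.
  rewrite /strip_value (negPf nst) (jtrowsE column_value1 sk dt (leqnn _) (leqnn _)) jt_column_value //.
  have [j jb] : exists j, ((conj_part (starts (r :: t)) j).+1 < conj_part (ends (r :: t)) j)%N.
    apply: contrapT => none; case/stripP: nst => // j; rewrite leqNgt; apply/negP => lt.
    by apply: none; exists j.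
  have js : (j < head 0%N (ends (r :: t)))%N.
    rewrite ltnNge; apply/negP => le; move: jb; rewrite [conj_part (ends _) _]conj_part_eq0 //.
    case/andP: sk => _ se; apply: sub_all (all_le_head se) => x.
    by move=> /leq_trans; apply.
  rewrite (bigD1 (Ordinal js)) //= column_value_eq0 ?mul0r // /shifted.
  have := conj_part_size (ends (r :: t)) j; rewrite [size (ends _)]/= size_map.
  by move: jb; rewrite -[_ && _]/(_ && _)%N; move: (conj_part _ _) (conj_part _ _) => a b; lia.
have ok := strip_cutok sk st.
have sk' : skew_rows ([:: r] ++ t) by [].
have [d1 d2] := (diagonal_cat sk' ok).1 dt; have [sk1 sk2] := skew_cat sk'.
have mj := multiplicative_jtrows column_value1.
rewrite -cat1s (mrow_cat mj) // (mrow_cat multiplicative_strip_value) // IH //; congr (_ * _).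
have rE : [:: r] = up r.1 [:: (0%N, r.2)] by case: (r) => n s; rewrite /up /= add0n.
rewrite rE (mrow_up mj) // (mrow_up multiplicative_strip_value) //.
have dr : diagonal [:: (0%N, r.2)] by move: d1; rewrite rE => /diagonal_up.
case: r.2 dr {sk dt st ok sk' d1 sk1 rE} => [|a s] dr; first by rewrite (mrow_zero mj) (mrow_zero multiplicative_strip_value).
rewrite (jtrowsE column_value1 _ dr (leqnn _) (leqnn _)) // jt_column_value //.
rewrite /strip_value ifT; last by apply/stripP => // j; rewrite /conj_part /=; lia.
rewrite /content /= cats0 (big_nth a) big_mkord; apply: eq_bigr => i _.
rewrite /jt_entry /shifted /conj_part /= !addn0 subn0.
rewrite (ltn_ord i) addKn leq_addl /segment addnK /=.
have := dr 0%N i (nth a (a :: s) i); rewrite /rentry /= !subn0 => -> //.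
by rewrite onthE (nth_map a) // -[(size s).+1]/(size (a :: s)) (leq_trans (ltn_ord i)).
Qed.

End StripValue.

Section BoxCount.
Variable A : countType.
Implicit Types (t : seq (trow A)).

Definition boxcount t : nat := size (content t).

Lemma boxcount_cut t e : fits t e ->
  boxcount t = (boxcount (top t e) + boxcount (bot t e))%N.
Proof.
rewrite /boxcount; elim: t e => [|r t IH] [|x e] //= /andP[rx /IH {}IH].
rewrite /content /= !size_cat -!/(content _) IH -[in LHS](cat_take_drop (x - r.1) r.2) size_cat.
by rewrite addnACA.
Qed.

Lemma boxless_top t e : fits t e -> boxless (top t e) = (e == starts t).
Proof.
elim: t e => [|r t IH] [|x e] //= /andP[/andP[rx xr] /IH ->]; rewrite eqseq_cons.
congr (_ && _); rewrite /row_start /row_end in rx xr *.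
by rewrite size_takel; [lia|lia].
Qed.

Lemma boxcount0 t : (boxcount t == 0%N) = boxless t.
Proof. by rewrite content_nil -size_eq0. Qed.

Lemma boxcount_bot t e : fits t e -> e != starts t -> (boxcount (bot t e) < boxcount t)%N.
Proof.
move=> fe ne; rewrite (boxcount_cut fe) -[X in (X < _)%N]add0n ltn_add2r.
by rewrite lt0n boxcount0 boxless_top.
Qed.

End BoxCount.

(* The recursion is solved in abstract rings because the concrete ones (words,
   their tensor product) are expensive to unify. *)
Section AbstractLinearization.
Variables (A : countType) (U Q T K : comPzRingType).
(** These stand for [strip_value], prefixing the product of the entries of a strip, [tpr], [dsplit],
    [headsplit], [concat_head] and the coefficient of the empty word. *)
Variables (sv : seq (trow A) -> U) (cat_top : seq (trow A) -> Q -> Q).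
Variables (tp : U -> Q -> T) (delta head_part : Q -> T) (kap : T -> Q) (eps : Q -> K).
Implicit Types (t : seq (trow A)).

Hypothesis svP : multiplicative_rows sv.
Hypothesis sv0 : forall t, ~~ strip t -> sv t = 0.
Hypothesis tpM : forall x x' y y', tp x y * tp x' y' = tp (x * x') (y * y').
Hypothesis tp0 : forall y, tp 0 y = 0.
Hypothesis deltaE : forall y, delta y = tp 1 y + head_part y.
Hypothesis delta1 : delta 1 = 1.
Hypothesis tp1 : tp 1 1 = 1.
Hypothesis deltaM : {morph delta : x y / x * y}.
Hypothesis head_partD : {morph head_part : x y / x + y}.
Hypothesis head_part0 : head_part 0 = 0.
Hypothesis head_cat : forall t y, strip t -> ~~ boxless t -> head_part (cat_top t y) = tp (sv t) y.
Hypothesis kapD : {morph kap : x y / x + y}.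
Hypothesis kap_tp1 : forall y, kap (tp 1 y) = 0.
Hypothesis eps1 : eps 1 = 1.
Hypothesis epsM : {morph eps : x y / x * y}.
Hypothesis epsD : {morph eps : x y / x + y}.
Hypothesis eps0 : eps 0 = 0.
Hypothesis eps_cat : forall t y, eps (cat_top t y) = 0.
Hypothesis split_inj : forall x y, eps x = eps y -> kap (delta x) = kap (delta y) -> x = y.

(** Recursion on the first strip. What remains has fewer boxes without being a subterm; the value 0
    is not reached if [n] is at least the number of boxes. *)
Fixpoint alin_fuel (n : nat) t : Q :=
  if boxless t then 1 else
  if n is n'.+1 then
    \sum_(e <- cuts t | (e != starts t) && strip (top t e)) cat_top (top t e) (alin_fuel n' (bot t e))
  else 0.

Definition alin t : Q := alin_fuel (boxcount t) t.

Lemma eq_alin_fuel m n t : (boxcount t <= m)%N -> (boxcount t <= n)%N ->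
  alin_fuel m t = alin_fuel n t.
Proof.
have nil j r : boxless r -> alin_fuel j r = 1 by case: j => [|j] /= ->.
elim: m n t => [|m IH] n t tm tn.
  by move: tm; rewrite leqn0 boxcount0 => b; rewrite !nil.
case: n tn => [|n] tn; first by move: tn; rewrite leqn0 boxcount0 => b; rewrite !nil.
rewrite /=; case: ifP => // nb.
rewrite big_seq_cond [RHS]big_seq_cond; apply: eq_bigr => e /and3P[ec ne _].
move: ec; rewrite mem_cuts => /andP[_ fe]; congr cat_top; apply: IH;
  have := boxcount_bot fe ne; lia.
Qed.

Lemma alin_boxless t : boxless t -> alin t = 1.
Proof. by rewrite /alin; case: (boxcount t) => [|n] /= ->. Qed.

Lemma alinE t : ~~ boxless t -> alin t =
  \sum_(e <- cuts t | (e != starts t) && strip (top t e)) cat_top (top t e) (alin (bot t e)).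
Proof.
move=> nb; rewrite /alin (eq_alin_fuel (n := (boxcount t).+1)) //= (negPf nb).
rewrite big_seq_cond [RHS]big_seq_cond; apply: eq_bigr => e /and3P[ec ne _].
move: ec; rewrite mem_cuts => /andP[_ fe]; congr cat_top; apply: eq_alin_fuel => //.
exact/ltnW/boxcount_bot.
Qed.

Lemma eps_alin t : eps (alin t) = (boxless t)%:R.
Proof.
have [b|nb] := boolP (boxless t); first by rewrite alin_boxless.
rewrite alinE // (big_morph eps epsD eps0) big1 // => e _; exact: eps_cat.
Qed.

Definition splits (X : seq (trow A) -> Q) t : Prop :=
  delta (X t) = \sum_(e <- cuts t) tp (sv (top t e)) (X (bot t e)).

Lemma cuts_boxless t : skew_rows t -> boxless t -> cuts t = [:: starts t].
Proof.
move=> sk bt; apply: perm_small_eq => //; apply: uniq_perm; rewrite ?cuts_uniq //.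
move=> e; rewrite inE mem_cuts; apply/andP/eqP => [[_ fe]|->]; last first.
  by apply/andP; rewrite -mem_cuts starts_cuts.
apply/eqP; rewrite -boxless_top // -boxcount0.
have := boxcount_cut fe; move: bt; rewrite -boxcount0; lia.
Qed.

Lemma sv_starts t : skew_rows t -> sv (top t (starts t)) = 1.
Proof.
by move=> sk; rewrite (mrow_boxless svP) ?top_starts ?skew_top ?starts_cuts.
Qed.

(** The cut with nothing above it gives [tp 1 (alin t)], and [head_part] of the recursion gives the
    strips. The sum extends to all cuts because [sv] vanishes on the other shapes. *)
Lemma alin_splits t : skew_rows t -> splits alin t.
Proof.
move=> sk; rewrite /splits; have [b|nb] := boolP (boxless t).
  by rewrite cuts_boxless // big_seq1 bot_starts sv_starts // alin_boxless // tp1.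
rewrite (bigD1_seq (starts t)) ?starts_cuts ?cuts_uniq //= bot_starts sv_starts //.
rewrite deltaE; congr (_ + _); rewrite alinE // (big_morph head_part head_partD head_part0).
rewrite big_mkcondr /=; rewrite big_seq_cond [RHS]big_seq_cond.
apply: eq_bigr => e /andP[ec ne]; case: ifPn => st; last by rewrite sv0 ?tp0.
by rewrite head_cat // boxless_top //; move: ec; rewrite mem_cuts => /andP[].
Qed.

(** The only summand in which [X] is taken at [t] itself has head 1, and [kap] kills it. *)
Lemma kap_splits (X Y : seq (trow A) -> Q) t : skew_rows t -> splits X t -> splits Y t ->
    (forall e, e \in cuts t -> e != starts t -> X (bot t e) = Y (bot t e)) ->
  kap (delta (X t)) = kap (delta (Y t)).
Proof.
move=> sk -> -> XY; rewrite !(bigD1_seq (starts t)) ?starts_cuts ?cuts_uniq //=.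
rewrite sv_starts // !kapD !kap_tp1; congr (_ + kap _).
rewrite big_seq_cond [RHS]big_seq_cond; apply: eq_bigr => e /andP[ec ne].
by rewrite XY.
Qed.

(** The class [C] need only be stable under [bot]: skew row lists for translation invariance,
    diagonal ones for the comparison with determinants. *)
Lemma splits_unique (C : seq (trow A) -> Prop) (X Y : seq (trow A) -> Q) :
    (forall t, C t -> skew_rows t) ->
    (forall t e, C t -> e \in cuts t -> C (bot t e)) ->
    (forall t, C t -> splits X t) -> (forall t, C t -> splits Y t) ->
    (forall t, C t -> eps (X t) = eps (Y t)) ->
  forall t, C t -> X t = Y t.
Proof.
move=> Csk Cbot sX sY eXY t; have [n] := ubnP (boxcount t); elim: n => // n IH in t *.
move=> tn Ct; apply: split_inj; first exact: eXY.
apply: kap_splits; [exact: Csk|exact: sX|exact: sY|move=> e ec ne].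
apply: IH; last exact: Cbot.
have fe : fits t e by move: ec; rewrite mem_cuts => /andP[].
exact: leq_trans (boxcount_bot fe ne) tn.
Qed.

(** As [delta] and [sv] are multiplicative, the product on the right satisfies the recursion of the
    concatenation; [split_inj] concludes by induction on the number of boxes. *)
Lemma alin_cat t1 t2 : skew_rows (t1 ++ t2) -> cutok t1 t2 ->
  alin (t1 ++ t2) = alin t1 * alin t2.
Proof.
have [n] := ubnP (boxcount (t1 ++ t2)); elim: n => // n IH in t1 t2 *.
move=> tn sk ok; have [sk1 sk2] := skew_cat sk; apply: split_inj.
  by rewrite epsM !eps_alin boxless_cat -natrM mulnb.
rewrite deltaM !alin_splits // (perm_big _ (cuts_cat ok)) big_allpairs_dep /= mulr_suml.
have kap0 : kap 0 = 0 by apply: (addrI (kap 0)); rewrite -kapD !addr0.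
rewrite !(big_morph kap kapD kap0) big_seq [RHS]big_seq; apply: eq_bigr => e1 c1.
rewrite mulr_sumr !(big_morph kap kapD kap0) big_seq [RHS]big_seq; apply: eq_bigr => e2 c2.
have f1 : fits t1 e1 by move: c1; rewrite mem_cuts => /andP[].
have f2 : fits t2 e2 by move: c2; rewrite mem_cuts => /andP[].
have c12 : e1 ++ e2 \in cuts (t1 ++ t2).
  by rewrite (perm_mem (cuts_cat ok)); apply/allpairsP; exists (e1, e2).
have f12 : fits (t1 ++ t2) (e1 ++ e2) by move: c12; rewrite mem_cuts => /andP[].
rewrite tpM -(mrow_cat svP) ?cutok_top //; last by rewrite -top_cat ?(fits_size f1) ?skew_top.
rewrite -top_cat ?(fits_size f1) //.
have [e12|ne] := eqVneq (e1 ++ e2) (starts (t1 ++ t2)).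
  by rewrite e12 sv_starts // !kap_tp1.
congr (kap (tp _ _)); rewrite bot_cat ?(fits_size f1) //; apply: IH.
- by rewrite -bot_cat ?(fits_size f1) // (leq_trans (boxcount_bot f12 ne)).
- by rewrite -bot_cat ?(fits_size f1) ?skew_bot.
exact: cutok_bot.
Qed.

Lemma alin_up m t : skew_rows t -> alin (up m t) = alin t.
Proof.
move: t; apply: splits_unique => //.
- by move=> t e; apply: skew_bot.
- move=> t sk; rewrite /splits alin_splits ?skew_up // cuts_up big_map big_seq [RHS]big_seq.
  by apply: eq_bigr => e ec; rewrite top_up bot_up (mrow_up svP) ?skew_top.
- exact: alin_splits.
by move=> t _; rewrite !eps_alin boxless_up.
Qed.

Lemma multiplicative_alin : multiplicative_rows alin.
Proof.
split; [exact: alin_boxless|exact: alin_boxless|exact: alin_cat|exact: alin_up].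
Qed.

End AbstractLinearization.

(** * From chains of horizontal strips to the recursion on the first strip *)

Section StripChains.
Variables (A : countType) (W : pzRingType).
Variables (wt : seq (trow A) -> W) (a : seq (trow A) -> W).
Implicit Types (t : seq (trow A)).
Hypothesis a_boxless : forall t, boxless t -> a t = 1.
Hypothesis aE : forall t, ~~ boxless t -> a t =
  \sum_(e <- cuts t | (e != starts t) && strip (top t e)) wt (top t e) * a (bot t e).
Variable h : tableau A.

Let step e f : W := wt (restrict_rows h e f).

Definition chain_sum (r : nat) (e : seq nat) : W :=
  \sum_(c : r.-tuple (box h) |
      path strip_step e (map (@parts A h) c) && (last e (map (@parts A h) c) == outer h))
    \prod_(x <- pairmap step e (map (@parts A h) c)) x.

Lemma chain_sum0 e : chain_sum 0 e = if e == outer h then 1 else 0.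
Proof.
rewrite /chain_sum; case: eqVneq => [->|ne]; last first.
  by apply: big1 => c; rewrite tuple0 /= (negPf ne).
rewrite (big_pred1 [tuple]) => [|c]; first by rewrite big_nil.
by rewrite tuple0 /= eqxx; apply/esym/eqP; rewrite [RHS]tuple0.
Qed.

Lemma chain_sumS r e : chain_sum r.+1 e =
  \sum_(f : box h | strip_step e (parts f)) step e (parts f) * chain_sum r (parts f).
Proof.
rewrite /chain_sum (reindex (fun p : box h * r.-tuple (box h) => [tuple of p.1 :: p.2])) /=; last first.
  exists (fun c : r.+1.-tuple (box h) => (thead c, [tuple of behead c])) => [[f c] _|c _] /=.
    by rewrite theadE; congr (_, _); apply/val_inj.
  by apply/val_inj; rewrite /= [in RHS](tuple_eta c).
under [RHS]eq_bigr => f _ do rewrite mulr_sumr.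
rewrite pair_big_dep /=; apply: eq_big => [[f c]|[f c] _] /=; first by rewrite andbA.
by rewrite big_cons.
Qed.

Lemma part_sub_refl e : part_sub e e.
Proof. by elim: e => //= x e ->; rewrite leqnn. Qed.

Lemma part_sub_trans e f g : part_sub e f -> part_sub f g -> part_sub e g.
Proof.
elim: e f g => [|x e IH] [|y f] [|z g] //= /andP[xy ef] /andP[yz fg].
by rewrite (leq_trans xy yz) (IH f).
Qed.

Lemma part_sub_anti e f : part_sub e f -> part_sub f e -> e = f.
Proof.
elim: e f => [|x e IH] [|y f] //= /andP[xy ef] /andP[yx fe].
by congr (_ :: _); [apply/eqP; rewrite eqn_leq xy|exact: IH].
Qed.

Lemma part_sub_nth e f i : part_sub e f -> (nth 0 e i <= nth 0 f i)%N.
Proof.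
elim: e f i => [|x e IH] [|y f] [|i] //= /andP[xy ef] //.
exact: IH.
Qed.

Lemma strip_path_sub e c : path strip_step e c -> part_sub e (last e c).
Proof.
elim: c e => [|f c IH] e /=; first by rewrite part_sub_refl.
by case/andP=> /and4P[_ ef _ _] /IH; apply: part_sub_trans.
Qed.

Lemma chain_sum_eq0 r e : ~~ part_sub e (outer h) -> chain_sum r e = 0.
Proof.
move=> ns; apply: big1 => c /andP[/strip_path_sub sub /eqP l].
by rewrite -l sub in ns.
Qed.

Lemma fits_part_sub t f : fits t f = part_sub (starts t) f && part_sub f (ends t).
Proof.
elim: t f => [|r t IH] [|x f] //; rewrite [LHS]/= [RHS]/= IH; exact: andbACA.
Qed.

Lemma fits_bot t e f : fits t e -> fits (bot t e) f = part_sub e f && part_sub f (ends t).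
Proof. by move=> fe; rewrite fits_part_sub starts_bot // ends_bot. Qed.

Lemma top_bot e f : fits h e -> part_sub e f -> part_sub f (outer h) ->
  top (bot h e) f = restrict_rows h e f.
Proof.
move=> fe ef fo; have zf : size f = size h.
  by move: fo; rewrite /part_sub all2E size_map => /andP[/eqP].
have ff : fits (bot h e) f by rewrite fits_bot ?ef.
apply: (@eq_from_nth _ (0%N, [::])); first by rewrite size_top // size_bot // size_map size_iota.
move=> i; rewrite size_top // size_bot // => ih.
rewrite [RHS](nth_map 0%N) ?size_iota // nth_iota // add0n.
rewrite (nth_map ((0%N, [::]), 0%N)); last by rewrite size_zip size_bot // zf minnn.
rewrite nth_zip /=; last by rewrite size_bot ?zf.
rewrite (nth_map ((0%N, [::]), 0%N)); last by rewrite size_zip (fits_size fe) minnn.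
rewrite nth_zip /=; last by rewrite (fits_size fe).
congr (_, _); set r := nth _ h i; have /fitsP[_ /(_ i ih)] := fe.
rewrite (nth_map (0%N, [::])) // -/r => /andP[re _].
have efi := part_sub_nth i ef.
rewrite take_drop; congr (drop _ (take _ _)).
by rewrite /row_start in re; lia.
Qed.

Lemma bot_bot e f : fits h e -> part_sub e f -> part_sub f (outer h) ->
  bot (bot h e) f = bot h f.
Proof.
move=> fe ef fo; have zf : size f = size h.
  by move: fo; rewrite /part_sub all2E size_map => /andP[/eqP].
have zb := size_bot fe; rewrite /bot.
apply: (@eq_from_nth _ (0%N, [::])); rewrite !size_map !size_zip !size_map ?size_zip ?zf ?(fits_size fe) ?minnn // => i ih.
rewrite !(nth_map ((0%N, [::]), 0%N)) ?size_zip ?size_map ?size_zip ?zf ?(fits_size fe) ?minnn //.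
rewrite !nth_zip ?size_map ?size_zip ?zf ?(fits_size fe) ?minnn //=.
rewrite (nth_map ((0%N, [::]), 0%N)) ?size_zip ?(fits_size fe) ?minnn // nth_zip ?(fits_size fe) //=.
congr (_, _); set r := nth _ h i; have /fitsP[_ /(_ i ih)] := fe.
rewrite (nth_map (0%N, [::])) // -/r => /andP[re _].
have efi := part_sub_nth i ef.
rewrite drop_drop; congr drop; rewrite /row_start in re; lia.
Qed.

Lemma boxless_ends t : boxless t -> ends t = starts t.
Proof.
by elim: t => //= r t IH /andP[/eqP r0 /IH ->]; rewrite /row_end r0 addn0.
Qed.

(** Steps are strict, so no chain of positive length goes from lam to lam. *)
Lemma chain_sumS_outer r : chain_sum r.+1 (outer h) = 0.
Proof.
rewrite chain_sumS big1 // => f /and4P[_ ef ne _].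
have [fo|/chain_sum_eq0 ->] := boolP (part_sub (parts f) (outer h)); last by rewrite mulr0.
by move: ne; rewrite (part_sub_anti ef fo) eqxx.
Qed.

(** Split off the first step from e to f. The remaining chain starts at f, and the part below f has
    fewer boxes, so the lengths up to [n] exhaust all chains. *)
Lemma chain_sums n e : e \in cuts h -> (boxcount (bot h e) <= n)%N ->
  \sum_(r < n.+1) chain_sum r e = a (bot h e).
Proof.
elim: n e => [|n IH] e ec be; have /andP[se fe] : sorted geq e && fits h e by rewrite -mem_cuts.
  have b : boxless (bot h e) by rewrite -boxcount0 -leqn0.
  have eo : e = outer h by rewrite -[LHS](starts_bot fe) -(boxless_ends b) (ends_bot fe).
  by rewrite big_ord1 chain_sum0 eo eqxx a_boxless // -eo.
have [b|nb] := boolP (boxless (bot h e)).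
  have eo : e = outer h by rewrite -[LHS](starts_bot fe) -(boxless_ends b) (ends_bot fe).
  rewrite big_ord_recl chain_sum0 eo eqxx big1 ?addr0 => [|r _]; last exact: chain_sumS_outer.
  by rewrite a_boxless // -eo.
rewrite aE // big_ord_recl chain_sum0 ifF ?add0r; last first.
  by apply: contraNF nb => /eqP ->; apply: bot_ends.
under eq_bigr => r _ do rewrite lift0 chain_sumS.
rewrite exchange_big /=; under eq_bigr => f _ do rewrite -mulr_sumr.
(* A first step leaving lam cannot be completed to a chain, so only f inside lam matter. *)
rewrite (bigID (fun f : box h => part_sub (parts f) (outer h))) /= [X in _ + X]big1 ?addr0; last first.
  by move=> f /andP[_ ns]; rewrite big1 ?mulr0 // => r _; apply: chain_sum_eq0.
pose P f := strip_step e f && part_sub f (outer h).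
pose F f := step e f * \sum_(r < n.+1) chain_sum r f.
rewrite (big_box (P := P) F); last first.
  move=> f /andP[/and4P[sf ef _ _] fo]; rewrite -between_cuts /between sf fo andbT /=.
  by apply: part_sub_trans ef; move: ec; rewrite -between_cuts => /and3P[].
have memE : [seq f <- cuts h | P f] =i
    [seq f <- cuts (bot h e) | (f != starts (bot h e)) && strip (top (bot h e) f)].
  move=> f; rewrite [LHS]mem_filter [RHS]mem_filter !mem_cuts starts_bot // fits_bot // /P /strip_step.
  rewrite fits_part_sub.
  have [ef|] := boolP (part_sub e f); last by rewrite ?(andbF, andFb).
  have [fo|] := boolP (part_sub f (outer h)); last by rewrite ?(andbF, andFb).
  have ff : fits (bot h e) f by rewrite fits_bot ?ef.
  rewrite /strip starts_top // ends_top // starts_bot // eq_sym.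
  have -> : part_sub (starts h) f.
    by apply: part_sub_trans ef; move: ec; rewrite -between_cuts => /and3P[].
  by case: (sorted geq f); case: (f != e); case: (horizontal_strip f e).
rewrite -[RHS]big_filter.
transitivity (\sum_(f <- [seq f <- cuts h | P f]) F f); first by rewrite big_filter.
rewrite (perm_big _ (uniq_perm (filter_uniq _ (cuts_uniq h)) (filter_uniq _ (cuts_uniq _)) memE)).
rewrite big_seq [RHS]big_seq; apply: eq_bigr => f; rewrite -memE mem_filter => /andP[Pf fc].
have /andP[/and4P[_ ef ne _] fo] := Pf.
have ff : fits (bot h e) f by rewrite fits_bot ?ef.
rewrite /F /step -top_bot // bot_bot // IH // -(bot_bot fe ef fo).
have lt := @boxcount_bot _ (bot h e) f ff.
by rewrite -ltnS; apply: leq_trans be; apply: lt; rewrite starts_bot // eq_sym.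
Qed.

Lemma chain_sums_total :
  \sum_(r < (nboxes h).+1)
    \sum_(c : r.-tuple (box h) | strip_chain h (map (@parts A h) c))
      \prod_(x <- pairmap step (inner h) (map (@parts A h) c)) x = a h.
Proof.
have sk : skew_rows h by case/andP: (rowsP h).
rewrite -[in RHS](bot_starts h) -(@chain_sums (nboxes h)) ?starts_cuts //.
by rewrite bot_starts /boxcount /content size_flatten /shape -map_comp.
Qed.

End StripChains.

Section RingMorphisms.
Variables (A : countType) (R S : comPzRingType) (phi : {rmorphism R -> S}).
Implicit Types (t : seq (trow A)) (f : seq A -> R).

Lemma jt_rmorph f n s g t : phi (jt f n s g t) = jt (phi \o f) n s g t.
Proof.
rewrite /jt /seg_det -det_map_mx; congr (\det _); apply/matrixP => i j; rewrite !mxE.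
rewrite /jt_entry /eval_word; case: ifP => _; last exact: rmorph0.
by case: ifP => _ //; apply: rmorph0.
Qed.

Lemma jtrows_rmorph f t : phi (jtrows f t) = jtrows (phi \o f) t.
Proof. by rewrite /jtrows; case: ifP => _; rewrite ?jt_rmorph ?rmorph0. Qed.

End RingMorphisms.

Lemma eq_jtrows (A : countType) (R : comPzRingType) (f f' : seq A -> R) t :
  f =1 f' -> jtrows f t = jtrows f' t.
Proof. by move=> /funext ->. Qed.

(** Used for both [dsplit] and the cut coproduct. After [jt_deconcatenates] the pieces are evaluated
    with the rows, columns and letters of [t]; [jtrowsE] replaces these by their own. *)
Lemma jtrows_splits (A : countType) (U Q T : comPzRingType) (delta : {rmorphism Q -> T})
    (i1 : {rmorphism U -> T}) (i2 : {rmorphism Q -> T}) (f : seq A -> Q) (c : seq A -> U) t :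
    f [::] = 1 -> c [::] = 1 -> deconcatenates (delta \o f) (i1 \o c) (i2 \o f) ->
    skew_rows t -> diagonal t ->
  delta (jtrows f t) = \sum_(e <- cuts t) i1 (jtrows c (top t e)) * i2 (jtrows f (bot t e)).
Proof.
move=> f1 c1 dec sk dt; rewrite (jtrowsE f1 sk dt (leqnn _) (leqnn _)) jt_rmorph.
rewrite (jt_deconcatenates _ dec sk) // big_seq [RHS]big_seq; apply: eq_bigr => e ec.
have fe : fits t e by move: ec; rewrite mem_cuts => /andP[].
have [_ se] := andP sk; have all_le := fits_le fe (all_le_head se).
rewrite (jtrowsE (t := top t e) (n := size t) (s := head 0%N (ends t)) (g := reading t) c1);
  rewrite ?skew_top ?size_top ?ends_top //; last 2 first.
- exact: along_top.
- by case: (e) all_le => //= x l /andP[].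
rewrite (jtrowsE (t := bot t e) (n := size t) (s := head 0%N (ends t)) (g := reading t) f1);
  rewrite ?skew_bot ?size_bot ?ends_bot //; last exact: along_bot.
by rewrite !jt_rmorph.
Qed.

(** The integer diagonal n is the natural number n + [size h]; with this shift the lengths agree,
    negative ones included. *)
Lemma jt_word_entry (A : countType) (R : comPzRingType) (f : seq A -> R) (h : tableau A) i j :
  oapp f 0 (jt_word h i j) =
    jt_entry f (reading h) (shifted (size h) (starts h) j) (shifted (size h) (ends h) i).
Proof.
have cs := conj_part_size (starts h) j; have ce := conj_part_size (ends h) i.
rewrite size_map in cs; rewrite size_map in ce.
have ih : inner h = starts h by [].
have oh : outer h = ends h by [].
have diagE (d : nat) : diag_entry h (d%:Z - (size h)%:Z) = reading h d.
  rewrite /diag_entry /reading; congr ohead; apply: eq_pmap => l.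
  case: leqP => dl.
    have -> : d%:Z - (size h)%:Z + l%:Z = (d + l - size h)%N%:Z by lia.
    by [].
  have -> : d%:Z - (size h)%:Z + l%:Z = Negz (size h - (d + l)).-1 by lia.
  by [].
rewrite /jt_word /jt_entry /shifted.
case: leqP => le.
  have -> : jt_length h i j = (size h + j - conj_part (starts h) j - (size h + i - conj_part (ends h) i))%N%:Z.
    by rewrite /jt_length ih oh; lia.
  rewrite /eval_word /segment.
  set s1 := map _ _; set s2 := map _ _.
  have -> : s1 = s2.
    apply/eq_in_map => l; rewrite mem_iota add0n => /andP[_ ll]; rewrite -diagE; congr diag_entry.
    rewrite ih; lia.
  by case: ifP.
have -> : jt_length h i j = Negz ((size h + i - conj_part (ends h) i) - (size h + j - conj_part (starts h) j)).-1.
  by rewrite /jt_length ih oh; lia.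
by [].
Qed.

Lemma jtrows_det (A : countType) (R : comPzRingType) (f : seq A -> R) (h : tableau A) :
  diagonal h -> jtrows f h =
    \det (\matrix_(i < largest_part h, j < largest_part h) oapp f 0 (jt_word h i j)).
Proof.
move=> dh; rewrite /jtrows asboolT // /jt /seg_det; congr (\det _).
by apply/matrixP => i j; rewrite !mxE jt_word_entry.
Qed.

Section TensorInclusions.
Variables (R : comNzRingType) (M N : comAlgType R).

Definition tinl (x : M) : talg M N := tpr x 1.
Definition tinr (y : N) : talg M N := tpr 1 y.

Lemma tinl_zmod : zmod_morphism tinl.
Proof.
move=> x y; have := tpureDl (x - y) y (1 : N); rewrite subrK => E.
by apply/esym/eqP; rewrite subr_eq; apply/eqP.
Qed.
Lemma tinr_zmod : zmod_morphism tinr.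
Proof.
move=> x y; have := tpureDr (1 : M) (x - y) y; rewrite subrK => E.
by apply/esym/eqP; rewrite subr_eq; apply/eqP.
Qed.
Lemma tinl_monoid : monoid_morphism tinl.
Proof. by split=> // x y; apply: (etrans _ (esym (tprM x y 1 1))); rewrite mulr1. Qed.
Lemma tinr_monoid : monoid_morphism tinr.
Proof. by split=> // x y; apply: (etrans _ (esym (tprM 1 1 x y))); rewrite mulr1. Qed.

HB.instance Definition _ := GRing.isZmodMorphism.Build M (talg M N) tinl tinl_zmod.
HB.instance Definition _ := GRing.isMonoidMorphism.Build M (talg M N) tinl tinl_monoid.
HB.instance Definition _ := GRing.isZmodMorphism.Build N (talg M N) tinr tinr_zmod.
HB.instance Definition _ := GRing.isMonoidMorphism.Build N (talg M N) tinr tinr_monoid.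

Lemma tinlr x y : tinl x * tinr y = tpr x y.
Proof. by apply: (etrans (tprM _ _ _ _)); rewrite mulr1 mul1r. Qed.

End TensorInclusions.

Lemma sum_take_drop_head (A : Type) (R : comPzRingType) (f1 f2 : seq A -> R) a w :
    (forall b c u, f1 [:: b, c & u] = 0) ->
  \sum_(i < (size (a :: w)).+1) f1 (take i (a :: w)) * f2 (drop i (a :: w)) =
    f1 [::] * f2 (a :: w) + f1 [:: a] * f2 w.
Proof.
move=> f10; rewrite 2!big_ord_recl big1 ?addr0 => [|i _]; first by rewrite /= take0 drop0.
by case: w i => [|b w] [i ilt] //=; rewrite f10 mul0r.
Qed.

Section QuasiShuffleLinearization.
Variables (k : comNzRingType) (A : countType) (d : comm_product k A).
Implicit Types (t : seq (trow A)).
Local Notation words := (words k A).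
Local Notation word := (@word k A).
Local Notation Q := (qwords d).
Local Notation U := (unitization d).
Local Notation T := (talg U Q).

Lemma linear_zmod (V W : lmodType k) (f : V -> W) : linear f -> zmod_morphism f.
Proof.
by move=> lf x y; rewrite -scaleN1r addrC lf scaleN1r addrC.
Qed.

HB.instance Definition _ :=
  GRing.isZmodMorphism.Build Q T (@dsplit k A d) (linear_zmod (@dsplit_linear k A d)).
HB.instance Definition _ :=
  GRing.isMonoidMorphism.Build Q T (@dsplit k A d) (dsplit1 d, @dsplitM k A d).

Definition empty_coef (w : Q) : k^o := mcoeff (FMonom [::]) (w : words).

Lemma empty_coef_word u : empty_coef (word u) = (u == [::])%:R.
Proof. by rewrite /empty_coef /Defs.word mcoeffU1 -(inj_eq val_inj). Qed.

Lemma empty_coef_linear : linear empty_coef.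
Proof. by move=> c x y; rewrite /empty_coef mcoeffD mcoeffZ. Qed.

Lemma empty_coef_lcat x w : empty_coef (lcat x w) = 0.
Proof.
have z : linear (fun _ : words => 0 : k^o) by move=> c u v; rewrite scaler0 addr0.
have z' : linear (fun _ : {malg k[A]} => 0 : k^o) by move=> c u v; rewrite scaler0 addr0.
have l1 : linear (fun x => empty_coef (lcat x w)).
  by move=> c u v; rewrite lcat_linear_l empty_coef_linear.
move: x; apply: (malg_linear_eq (V := k^o) l1 z') => a.
have l2 : linear (fun w => empty_coef (lcat << a >> w)).
  by move=> c u v; rewrite lcat_linear_r empty_coef_linear.
move: w {l1}; apply: (words_linear_eq (V := k^o) l2 z) => u.
by rewrite lcat_word empty_coef_word.
Qed.

Lemma empty_coefD : {morph empty_coef : x y / x + y}.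
Proof. exact: linear_funD empty_coef_linear. Qed.

(** A quasi-shuffle of two words has a constant term only if both are empty, since each summand of
    the recursion starts with a letter. *)
Lemma empty_coefM : {morph empty_coef : x y / x * y}.
Proof.
move=> x y; have el := empty_coef_linear.
have l1 : linear (fun x : words => empty_coef ((x : Q) * y)).
  move=> c u v; apply: (etrans (congr1 empty_coef _) (el c _ _)).
  exact: (qsh_linear_l d y c u v).
have l2 : linear (fun x : words => empty_coef x * empty_coef y).
  by move=> c u v; rewrite el mulrDl -mulrA.
move: x; apply: (words_linear_eq (V := k^o) l1 l2) => u.
have l3 : linear (fun y : words => empty_coef ((word u : Q) * (y : Q))).
  move=> c v w; apply: (etrans (congr1 empty_coef _) (el c _ _)).
  exact: (qsh_linear_r d (word u) c v w).
have l4 : linear (fun y : words => empty_coef (word u) * empty_coef y).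
  by move=> c v w; rewrite el mulrDr mulrCA.
move: y {l1 l2}; apply: (words_linear_eq (V := k^o) l3 l4) => v.
case: u {l3 l4} => [|a u].
  apply: (etrans (congr1 empty_coef (qsh1 d (word v)))).
  by rewrite (empty_coef_word [::]) eqxx mul1r.
rewrite (empty_coef_word (_ :: _)) mul0r; case: v => [|b v].
  exact: (etrans (congr1 empty_coef (qsh_nil_r d (a :: u))) (empty_coef_word (a :: u))).
apply: (etrans (congr1 empty_coef (qsh_cons d a u b v))).
have e0 x w := empty_coef_lcat x w; have eD := empty_coefD.
apply: (etrans (eD _ _)).
apply: (etrans (f_equal2 +%R (etrans (eD _ _) (f_equal2 +%R (e0 _ _) (e0 _ _))) (e0 _ _))).
by rewrite !addr0.
Qed.

Lemma empty_coef1 : empty_coef 1 = 1.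
Proof. exact: (empty_coef_word [::]). Qed.

HB.instance Definition _ :=
  GRing.isZmodMorphism.Build Q k^o empty_coef (linear_zmod empty_coef_linear).
HB.instance Definition _ :=
  GRing.isMonoidMorphism.Build Q k^o empty_coef (empty_coef1, empty_coefM).

Lemma words_split_inj (x y : Q) : empty_coef x = empty_coef y ->
  concat_head (dsplit x) = concat_head (dsplit y) -> x = y.
Proof.
move=> exy e.
have E : (x : words) - empty_coef x *: word [::] = (y : words) - empty_coef y *: word [::].
  exact: (etrans (esym (concat_head_dsplit x)) (etrans e (concat_head_dsplit y))).
by move: E; rewrite exy; apply: addIr.
Qed.

Definition content_lcat t (w : Q) : Q := lcat (dia_prod d (content t)) w.

Definition lin_rows : seq (trow A) -> Q := alin content_lcat.

Lemma head_content_lcat t y : strip t -> ~~ boxless t ->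
  headsplit d (content_lcat t y) = tpr (strip_value d t) y.
Proof. by move=> st nb; rewrite strip_valueE // st; apply: headsplit_lcat. Qed.

Lemma strip_value0 t : ~~ strip t -> strip_value d t = 0.
Proof. by rewrite /strip_value => /negPf ->. Qed.

Lemma concat_head_tinr (y : Q) : concat_head (tpr (1 : U) y) = 0 :> Q.
Proof.
rewrite concat_head_pure.
exact: (linear_fun0 (@lcat_linear_l k A y)).
Qed.

Lemma concat_headD : {morph (@concat_head k A d : T -> Q) : x y / x + y}.
Proof. exact: (linear_funD (@concat_head_linear k A d)). Qed.

Lemma headsplit0 : headsplit d (0 : Q) = 0.
Proof. exact: (linear_fun0 (@headsplit_linear k A d)). Qed.

Lemma empty_coef_content_lcat t y : empty_coef (content_lcat t y) = 0.
Proof. exact: empty_coef_lcat. Qed.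

Lemma multiplicative_lin_rows : multiplicative_rows lin_rows.
Proof.
exact: (multiplicative_alin (T := T) (K := k^o) (multiplicative_strip_value d) strip_value0
  (@tprM k U Q) (@tpure0l k U Q) (fun y => erefl) (dsplit1 d) erefl (@dsplitM k A d)
  (@headsplitD k A d) headsplit0 head_content_lcat concat_headD concat_head_tinr
  empty_coef1 empty_coefM empty_coefD (linear_fun0 empty_coef_linear) empty_coef_content_lcat
  words_split_inj).
Qed.

Lemma lin_rows_splits t : skew_rows t ->
  splits (strip_value d) (@tpr k U Q) (@dsplit k A d) lin_rows t.
Proof.
apply: (alin_splits (T := T) (tp := @tpr k U Q) (delta := @dsplit k A d) (head_part := @headsplit k A d)
  (multiplicative_strip_value d) strip_value0 (@tpure0l k U Q)
  (fun y => erefl) (dsplit1 d) erefl (@headsplitD k A d) headsplit0 head_content_lcat).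
Qed.

Lemma empty_coef_lin_rows t : empty_coef (lin_rows t) = (boxless t)%:R.
Proof.
exact: (eps_alin empty_coef1 empty_coefD (linear_fun0 empty_coef_linear) empty_coef_content_lcat).
Qed.

Lemma lin_tabE (h : tableau A) : lin_tab d h = lin_rows h.
Proof.
have lE t : ~~ boxless t -> (lin_rows t : words) =
    \sum_(e <- cuts t | (e != starts t) && strip (top t e))
      letters (dia_prod d (content (top t e))) * (lin_rows (bot t e) : words).
  exact: (alinE content_lcat).
have l1 t : boxless t -> (lin_rows t : words) = 1.
  by move=> b; apply: (etrans (alin_boxless content_lcat b)); apply: word1.
pose wt t : words := letters (dia_prod d (content t)).
exact: (chain_sums_total (W := words) (wt := wt) (a := lin_rows) l1 lE h).
Qed.

Lemma linearization_exists : exists f : {lrmorphism tabalg k A -> Q},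
  forall h, f (tcls k h) = lin_tab d h.
Proof.
have [f fE] := tabalg_universal multiplicative_lin_rows.
by exists f => h; rewrite fE lin_tabE.
Qed.

Lemma qword1 : (word [::] : Q) = 1. Proof. by []. Qed.

Definition jt_words : seq (trow A) -> Q := jtrows (word : seq A -> Q).

(** Since [column_value] vanishes beyond length 1, only the cuts after zero or one letter remain,
    and they are the two terms of [dsplit]. *)
Lemma deconcatenates_word : deconcatenates (@dsplit k A d \o (word : seq A -> Q))
  (@tinl k U Q \o @column_value k A d) (@tinr k U Q \o (word : seq A -> Q)).
Proof.
move=> w; apply: esym; case: w => [|a w].
  apply: (etrans (big_ord1 _ _)); apply: (etrans (tinlr _ _)); exact: esym (dsplit1 d).
apply: (etrans (sum_take_drop_head _ _ _ _)) => [b c u|].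
  exact: (raddf0 (@tinl k U Q)).
apply: (etrans (f_equal2 +%R (tinlr _ _) (tinlr _ _))); exact: esym (dsplit_word d a w).
Qed.

Lemma jt_words_splits t : skew_rows t -> diagonal t ->
  splits (strip_value d) (@tpr k U Q) (@dsplit k A d) jt_words t.
Proof.
move=> sk dt.
apply: (etrans (jtrows_splits (delta := @dsplit k A d) qword1 (column_value1 d)
  deconcatenates_word sk dt)).
rewrite big_seq [RHS]big_seq; apply: eq_bigr => e ec.
have fe : fits t e by move: ec; rewrite mem_cuts => /andP[].
by rewrite tinlr jt_strip_value ?skew_top //; apply: diagonal_top.
Qed.

Definition unit_coef (x : U) : k^o := x.1.
Lemma unit_coef_zmod : zmod_morphism unit_coef. Proof. by []. Qed.
Lemma unit_coef_monoid : monoid_morphism unit_coef. Proof. by []. Qed.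
HB.instance Definition _ := GRing.isZmodMorphism.Build U k^o unit_coef unit_coef_zmod.
HB.instance Definition _ := GRing.isMonoidMorphism.Build U k^o unit_coef unit_coef_monoid.

Lemma unit_coef_column_value w : unit_coef (column_value d w) = (w == [::])%:R.
Proof. by case: w => [|a [|b w]]. Qed.

Lemma unit_coef_strip_value t : skew_rows t -> unit_coef (strip_value d t) = (boxless t)%:R.
Proof.
move=> sk; have [b|nb] := boolP (boxless t); first by rewrite strip_value_boxless.
by rewrite strip_valueE //; case: ifP.
Qed.

(* For a character e of the ring containing the columns, this computes e of the
   Jacobi--Trudi determinant. *)
Lemma jtrows_boxless (e : seq A -> k^o) t : (forall w, e w = (w == [::])%:R) ->
  skew_rows t -> diagonal t -> jtrows e t = (boxless t)%:R.
Proof.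
move=> eE sk dt; rewrite -unit_coef_strip_value // -jt_strip_value // jtrows_rmorph.
by apply: eq_jtrows => w; rewrite eE /= unit_coef_column_value.
Qed.

(** Determinant and linearization split in the same way and have the same constant term, so
    [splits_unique] applies. *)
Lemma jt_wordsE t : skew_rows t -> diagonal t -> jt_words t = lin_rows t.
Proof.
move=> sk dt; pose C t := skew_rows t /\ diagonal t.
apply: (splits_unique (multiplicative_strip_value d) concat_headD concat_head_tinr
  words_split_inj (C := C)) => //.
- by move=> u [].
- move=> u e [sku du] ec; split; first exact: skew_bot.
  by apply: diagonal_bot => //; move: ec; rewrite mem_cuts => /andP[].
- by move=> u [sku du]; apply: jt_words_splits.
- by move=> u [sku _]; apply: lin_rows_splits.
move=> u [sku du]; rewrite empty_coef_lin_rows /jt_words jtrows_rmorph.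
by apply: jtrows_boxless => // w; apply: empty_coef_word.
Qed.

Lemma qsh_detE n (M : 'M[words]_n) : qsh_det d M = \det (M : 'M[Q]_n).
Proof.
apply: eq_bigr => s _.
exact: (etrans (scaler_sign s (\prod_i (M : 'M[Q]_n) i (s i))) (esym (mulr_sign s _))).
Qed.

Lemma jt_word_detE (h : tableau A) : diagonal h -> jt_word_det d h = jt_words h.
Proof. by move=> dh; rewrite /jt_word_det qsh_detE /jt_words jtrows_det. Qed.

End QuasiShuffleLinearization.

(** * The Jacobi--Trudi map *)

Section Columns.
Variable A : countType.
Implicit Types (u v w : seq A).

Definition column_rows w : seq (trow A) := [seq (0%N, [:: a]) | a <- w].

Lemma starts_column w : starts (column_rows w) = nseq (size w) 0%N.
Proof. by elim: w => //= a w ->. Qed.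

Lemma ends_column w : ends (column_rows w) = nseq (size w) 1%N.
Proof. by elim: w => //= a w ->. Qed.

Lemma sorted_nseq n x : sorted geq (nseq n x).
Proof. by case: n => //= n; elim: n => //= n ->; rewrite leqnn. Qed.

Lemma skew_column w : skew_rows (column_rows w).
Proof. by rewrite /skew_rows -/(starts _) -/(ends _) starts_column ends_column !sorted_nseq. Qed.

Lemma fits_column w e : fits (column_rows w) e -> sorted geq e ->
  exists2 i, (i <= size w)%N & e = nseq i 1%N ++ nseq (size w - i) 0%N.
Proof.
elim: w e => [|a w IH] [|x e] //=; first by exists 0%N.
case/andP=> xb fe se; have [i iw eE] := IH e fe (path_sorted se).
have : (x == 0%N) || (x == 1%N) by move: xb; rewrite /row_start /row_end /=; case: x {se} => [|[|x]].
case/orP=> /eqP x01; last by exists i.+1 => //=; rewrite x01 eE subSS.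
exists 0%N => //; rewrite subn0 /= x01; congr (_ :: _).
have : all (geq 0%N) e by move: se; rewrite x01; apply: order_path_min; apply: geq_trans.
move: fe => /fits_size; rewrite size_map => <- {se eE IH}.
by elim: e => //= y e IH /andP[]; rewrite leqn0 => /eqP -> /IH <-.
Qed.

Lemma column_cat u v : column_rows (u ++ v) = column_rows u ++ column_rows v.
Proof. exact: map_cat. Qed.

Lemma column_cuts u v :
  nseq (size u) 1%N ++ nseq (size v) 0%N \in cuts (column_rows (u ++ v)).
Proof.
rewrite mem_cuts column_cat fits_cat ?size_nseq ?size_map //.
rewrite -starts_column fits_starts -ends_column fits_ends andbT sorted_cat_geq.
  by rewrite ends_column starts_column !sorted_nseq.
by rewrite ends_column starts_column; apply/allrelP => x y /nseqP[-> _] /nseqP[-> _].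
Qed.

(** The partitions inside a column are the shorter columns. *)
Lemma big_cuts_column (V : nmodType) (F : seq nat -> V) w :
  \sum_(e <- cuts (column_rows w)) F e =
    \sum_(i < (size w).+1) F (nseq i 1%N ++ nseq (size w - i) 0%N).
Proof.
pose s := [seq nseq i 1%N ++ nseq (size w - i) 0%N | i : 'I_(size w).+1 <- index_enum 'I_(size w).+1].
transitivity (\sum_(e <- s) F e); last by rewrite big_map.
apply: perm_big; apply: uniq_perm; first exact: cuts_uniq.
  rewrite map_inj_uniq ?index_enum_uniq // => i j /(congr1 sumn).
  by rewrite !sumn_cat !sumn_nseq !mul1n !mul0n !addn0 => /val_inj.
move=> e; apply/idP/mapP => [|[i _ ->]].
  rewrite mem_cuts => /andP[se fe]; have [i iw ->] := fits_column fe se.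
  by exists (Ordinal (iw : (i < (size w).+1)%N)); rewrite ?mem_index_enum.
have iw : (i <= size w)%N by rewrite -ltnS.
by have := column_cuts (take i w) (drop i w); rewrite cat_take_drop size_takel // size_drop.
Qed.

Lemma mrow_top_column (B : comPzRingType) (phi : seq (trow A) -> B) u v :
  multiplicative_rows phi ->
  phi (top (column_rows (u ++ v)) (nseq (size u) 1%N ++ nseq (size v) 0%N)) = phi (column_rows u).
Proof.
move=> phiP; have sk := skew_top (skew_column (u ++ v)) (column_cuts u v).
move: sk; rewrite column_cat top_cat ?size_nseq ?size_map // => sk.
have [sk1 sk2] := skew_cat sk.
have f1 : fits (column_rows u) (nseq (size u) 1%N) by rewrite -ends_column fits_ends.
have f2 : fits (column_rows v) (nseq (size v) 0%N) by rewrite -starts_column fits_starts.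
rewrite (mrow_cat phiP) //; last first.
  rewrite cutokE starts_top // ends_top // starts_column.
  by apply/allrelP => x y /nseqP[-> _] /nseqP[-> _].
rewrite [phi (top (column_rows v) _)](mrow_boxless phiP) ?mulr1 //.
  by rewrite -ends_column top_ends.
by rewrite -starts_column top_starts.
Qed.

Lemma mrow_bot_column (B : comPzRingType) (phi : seq (trow A) -> B) u v :
  multiplicative_rows phi ->
  phi (bot (column_rows (u ++ v)) (nseq (size u) 1%N ++ nseq (size v) 0%N)) = phi (column_rows v).
Proof.
move=> phiP; have sk := skew_bot (skew_column (u ++ v)) (column_cuts u v).
move: sk; rewrite column_cat bot_cat ?size_nseq ?size_map // => sk.
have [sk1 sk2] := skew_cat sk.
have f1 : fits (column_rows u) (nseq (size u) 1%N) by rewrite -ends_column fits_ends.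
have f2 : fits (column_rows v) (nseq (size v) 0%N) by rewrite -starts_column fits_starts.
rewrite (mrow_cat phiP) //; last first.
  rewrite cutokE starts_bot // ends_bot // ends_column.
  by apply/allrelP => x y /nseqP[-> _] /nseqP[-> _].
rewrite [phi (bot (column_rows u) _)](mrow_boxless phiP) ?mul1r //.
  by rewrite -starts_column bot_starts.
by rewrite -ends_column bot_ends.
Qed.

Lemma boxless_column w : boxless (column_rows w) = (w == [::]).
Proof. by case: w. Qed.

End Columns.

Section JacobiTrudiMap.
Variables (k : comNzRingType) (A : countType).
Implicit Types (t : seq (trow A)) (h : tableau A).
Local Notation D := (diagalg k A).
Local Notation dcls := (@dcls k A).

Definition column_class (w : seq A) : D := dcl k (column_rows w).

Lemma column_class1 : column_class [::] = 1.
Proof. exact: mrow_nil (multiplicative_dcl k A). Qed.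

Lemma diagval_column_class w : diagval (column_class w) = tcls k (column w).
Proof. by rewrite diagval_dcl //; [apply: skew_column|apply: diagonal_column]. Qed.

Lemma jacobi_trudi_exists : exists J : {lrmorphism tabalg k A -> D},
  forall t, skew_rows t -> diagonal t -> J (diagval (dcl k t)) = jtrows column_class t.
Proof.
have mj := multiplicative_jtrows (A := A) column_class1.
have [J JE] := tabalg_universal mj; exists J => t sk dt.
by rewrite diagval_dcl // /rcls JE rows_mktab // (mrow_trim mj).
Qed.

Section Coproduct.
Variables (G : {lrmorphism tabalg k A -> dtens k A}).
Hypothesis GE : forall h,
  G (tcls k h) = \sum_(e <- cuts h) tpure (dcl k (top h e)) (dcl k (bot h e)).

Definition dcoproduct (x : D) : talg D D := G (diagval x).

Lemma dcoproduct_zmod : zmod_morphism dcoproduct.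
Proof. by move=> x y; apply: (raddfB G (diagval x) (diagval y)). Qed.
Lemma dcoproduct_monoid : monoid_morphism dcoproduct.
Proof.
split; first exact: (rmorph1 G).
by move=> x y; apply: (rmorphM G (diagval x) (diagval y)).
Qed.
HB.instance Definition _ := GRing.isZmodMorphism.Build D (talg D D) dcoproduct dcoproduct_zmod.
HB.instance Definition _ := GRing.isMonoidMorphism.Build D (talg D D) dcoproduct dcoproduct_monoid.

Lemma dcoproduct_dcl t : skew_rows t -> diagonal t ->
  dcoproduct (dcl k t) = \sum_(e <- cuts t) tpr (dcl k (top t e)) (dcl k (bot t e)).
Proof.
move=> sk dt; rewrite /dcoproduct diagval_dcl // /rcls.
apply: (etrans (GE _)).
apply: (etrans (esym (cut_productE _ _))).
rewrite rows_mktab // (mrow_trim (multiplicative_cut_product k A)) //.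
exact: cut_productE.
Qed.

(** Cutting a column is deconcatenating its word; the empty rows left in the two halves are
    invisible to [dcl]. *)
Lemma deconcatenates_column :
  deconcatenates (dcoproduct \o column_class) (@tinl k D D \o column_class) (@tinr k D D \o column_class).
Proof.
move=> w; apply: (etrans (dcoproduct_dcl (skew_column w) (@diagonal_column A w))).
apply: (etrans (big_cuts_column _ _)); apply: eq_bigr => i _.
apply: (etrans _ (esym (tinlr _ _))).
have iw : (i <= size w)%N by rewrite -ltnS.
have zi : size (take i w) = i by rewrite size_takel.
have zd : size (drop i w) = (size w - i)%N by rewrite size_drop.
have := mrow_top_column (take i w) (drop i w) (multiplicative_dcl k A).
have := mrow_bot_column (take i w) (drop i w) (multiplicative_dcl k A).
rewrite cat_take_drop zi zd => Eb Et.
exact: (f_equal2 (@tpr k D D) Et Eb).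
Qed.

Lemma dcoproduct_jtrows t : skew_rows t -> diagonal t ->
  dcoproduct (jtrows column_class t) =
    \sum_(e <- cuts t) tpr (jtrows column_class (top t e)) (jtrows column_class (bot t e)).
Proof.
move=> sk dt.
apply: (etrans (jtrows_splits (delta := dcoproduct) column_class1 column_class1
  deconcatenates_column sk dt)).
by apply: eq_bigr => e _; apply: tinlr.
Qed.

End Coproduct.

End JacobiTrudiMap.

(** * Convolution inverses and compatibility with antipodes *)

Section ConvolutionInverses.
Variables (k : comNzRingType) (H : comAlgType k).
Implicit Types (f g : {linear H -> H}).

Lemma convolution_bilinear f g : (forall y, linear (fun x => f x * g y)) /\
  (forall x, linear (fun y => f x * g y)).
Proof.
split=> y c x x'; rewrite linearP; first by rewrite mulrDl scalerAl.
by rewrite mulrDr scalerAr.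
Qed.

Lemma tlift_sum_pure (M N V : lmodType k) (b : M -> N -> V) I (r : seq I) (F : I -> M) (F' : I -> N) :
    (forall y, linear (b^~ y)) -> (forall x, linear (b x)) ->
  tlift b (\sum_(i <- r) tpure (F i) (F' i)) = \sum_(i <- r) b (F i) (F' i).
Proof.
move=> bl br; have lb := tlift_linear bl br.
rewrite (big_morph (tlift b) (linear_funD lb) (linear_fun0 lb)).
by apply: eq_bigr => i _; apply: tlift_pure.
Qed.

Lemma tlift_comp (M N V V' : lmodType k) (b : M -> N -> V) (f : {linear V -> V'}) (t : tens M N) :
    (forall y, linear (b^~ y)) -> (forall x, linear (b x)) ->
  f (tlift b t) = tlift (fun x y => f (b x y)) t.
Proof.
move=> bl br; move: t; apply: tens_linear_eq => [c x y|c x y|x y].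
- by rewrite (tlift_linear bl br) linearP.
- by apply: tlift_linear => [z e u v|z e u v]; rewrite ?bl ?br linearP.
rewrite (tlift_pure bl br) tlift_pure // => [z e u v|z e u v].
  by rewrite bl linearP.
by rewrite br linearP.
Qed.

Lemma tlift_tmap (M N M' N' V : lmodType k) (b : M' -> N' -> V)
    (f : {linear M -> M'}) (g : {linear N -> N'}) (t : tens M N) :
    (forall y, linear (b^~ y)) -> (forall x, linear (b x)) ->
  tlift b (tmap f g t) = tlift (fun x y => b (f x) (g y)) t.
Proof.
move=> bl br; have b_l y : linear (fun x => b (f x) (g y)) by move=> c u v; rewrite linearP bl.
have b_r x : linear (fun y => b (f x) (g y)) by move=> c u v; rewrite linearP br.
move: t; apply: tens_linear_eq => [c x y|c x y|x y].
- by rewrite tmap_linear (tlift_linear bl br).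
- exact: tlift_linear.
by rewrite tmap_pure (tlift_pure bl br) (tlift_pure b_l b_r).
Qed.

Lemma tliftB (M N V : lmodType k) (b b' : M -> N -> V) (t : tens M N) :
  tlift (fun x y => b x y - b' x y) t = tlift b t - tlift b' t.
Proof.
rewrite /tlift /mlift -sumrB; apply: eq_bigr => p _.
by rewrite scalerBr.
Qed.

End ConvolutionInverses.

Section Antipodes.
Variables (k : comNzRingType) (A : countType).
Local Notation D := (diagalg k A).
Variables (Delta : D -> tens D D).
Hypothesis DeltaE : forall t, skew_rows t -> diagonal t ->
  Delta (dcl k t) = \sum_(e <- cuts t) tpure (dcl k (top t e)) (dcl k (bot t e)).

(** Convolution with [f] is unitriangular for the number of boxes: the cut with everything above
    gives [w] of the tableau itself, every other cut gives [w] of fewer boxes. *)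
Lemma convolution_cancel (w f : {linear D -> D}) : f 1 = 1 ->
  (forall x, tlift (fun a b => w a * f b) (Delta x) = 0) -> forall x, w x = 0.
Proof.
move=> f1 wf; have [bl br] := convolution_bilinear w f.
have wt t : skew_rows t -> diagonal t -> w (dcl k t) = 0.
  have [n] := ubnP (boxcount t); elim: n => // n IH in t *; move=> tn sk dt.
  have := wf (dcl k t); rewrite DeltaE // (tlift_sum_pure _ _ _ bl br).
  rewrite (bigD1_seq (ends t)) ?ends_cuts ?cuts_uniq //= top_ends.
  have -> : dcl k (bot t (ends t)) = 1.
    by apply: (mrow_boxless (multiplicative_dcl k A)); rewrite ?bot_ends ?skew_bot ?ends_cuts.
  rewrite f1 mulr1 big_seq_cond big1 ?addr0 // => e /andP[ec ne].
  have fe : fits t e by move: ec; rewrite mem_cuts => /andP[].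
  rewrite IH ?mul0r ?skew_top //; last exact: diagonal_top.
  apply: (@leq_trans (boxcount t)); last exact: tn.
  rewrite [X in (_ <= X)%N](boxcount_cut fe) -addn1 leq_add2l lt0n boxcount0.
  apply: contraNN ne => /boxless_ends; rewrite ends_bot // starts_bot // => ->.
  exact: eqxx.
apply: diagalg_span => [|c x y wx wy|h /[dup] hd /diagonal_constantP dh].
- exact: linear0.
- by rewrite linearP wx wy scaler0 addr0.
by rewrite -dcl_rows // wt //; case/andP: (rowsP h).
Qed.

(** Both J S and S' J are left convolution inverses of J, the former because J is an algebra map,
    the latter because J respects coproduct and counit. Their difference is cancelled by
    [convolution_cancel]. *)
Lemma antipode_morphism (eps : D -> k) (J S S' : {linear D -> D}) : monoid_morphism J ->
    (forall x, Delta (J x) = tmap J J (Delta x)) -> (forall x, eps (J x) = eps x) ->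
    is_antipode Delta eps S -> is_antipode Delta eps S' ->
  forall x, J (S x) = S' (J x).
Proof.
move=> [J1 JM] JDelta Jeps SP S'P x.
pose W x := J (S x) - S' (J x).
have Wlin : linear W.
  move=> c u v; have E1 : J (S (c *: u + v)) = c *: J (S u) + J (S v) by rewrite !linearP.
  have E2 : S' (J (c *: u + v)) = c *: S' (J u) + S' (J v) by rewrite !linearP.
  by rewrite /W E1 E2 scalerBr opprD addrACA.
pose Wi := GRing.isLinear.Build _ _ _ _ W Wlin.
pose w : {linear D -> D} := HB.pack W Wi.
apply/eqP; rewrite -subr_eq0 -[_ - _]/(w x); apply/eqP; move: x.
apply: (convolution_cancel (f := J) J1) => x.
rewrite (_ : (fun a b => w a * J b) = (fun a b => J (S a) * J b - S' (J a) * J b)); last first.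
  by apply/funext => a; apply/funext => b; rewrite -mulrBl.
rewrite tliftB.
have idl : linear (@idfun D) by [].
have [bl br] := convolution_bilinear S (idfun : {linear D -> D}).
have [bl' br'] := convolution_bilinear S' (idfun : {linear D -> D}).
have -> : tlift (fun a b => J (S a) * J b) (Delta x) = (eps x)%:A.
  have [E _] := SP x.
  have := tlift_comp J (Delta x) bl br; rewrite [tlift _ _]E linearZ /= J1 => ->.
  by congr tlift; apply/funext => a; apply/funext => b; rewrite JM.
have -> : tlift (fun a b => S' (J a) * J b) (Delta x) = (eps x)%:A.
  have [E _] := S'P (J x); move: E; rewrite JDelta Jeps => <-.
  by have := tlift_tmap J J (Delta x) bl' br' => /= ->.
exact: subrr.
Qed.

End Antipodes.

Lemma rows_column (A : countType) (w : seq A) : rows (column w) = column_rows w.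
Proof.
rewrite /column rows_mktab; last exact: skew_column.
by apply/all_filterP/allP => r /mapP[a _ ->].
Qed.

(** A column has width 1, so the determinant is its single entry, the column read from top to
    bottom. *)
Lemma jtrows_column (A : countType) (R : comPzRingType) (f : seq A -> R) w :
  f [::] = 1 -> jtrows f (column_rows w) = f w.
Proof.
move=> f1; have hd : (head 0%N (ends (column_rows w)) <= 1)%N by case: w.
rewrite (jtrowsE f1 (skew_column w) (@diagonal_column A w) (leqnn _) hd).
rewrite /jt /seg_det det_mx11 mxE /shifted starts_column ends_column addn0.
have -> : conj_part (nseq (size w) 0%N) 0 = 0%N by rewrite /conj_part count_nseq.
have -> : conj_part (nseq (size w) 1%N) 0 = size w by rewrite /conj_part count_nseq mul1n.
rewrite subn0 size_map subnn /jt_entry /= /segment subn0.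
have -> : [seq reading (column_rows w) (size w - l) | l <- iota 0 (size w)] = map Some w.
  apply: (@eq_from_nth _ None); rewrite !size_map size_iota // => i iw.
  case: w iw {hd} => // a w iw; set u := a :: w.
  rewrite (nth_map 0%N) ?size_iota // nth_iota // (nth_map a) // add0n.
  have ri : rentry (column_rows u) i 0 = Some (nth a u i).
    by rewrite /rentry /column_rows (nth_map a).
  by have := diagonal_column ri; rewrite size_map addn0.
rewrite /eval_word ifT; first by congr f; elim: w {hd} => //= a w ->.
by elim: w {hd}.
Qed.

Lemma nboxes_boxless (A : countType) (h : tableau A) : boxless h = (nboxes h == 0%N).
Proof. by rewrite -boxcount0 /boxcount /content size_flatten /shape -map_comp. Qed.

Theorem theorem3 (k : comNzRingType) (A : countType)
    (dia : {malg k[A]} -> {malg k[A]} -> {malg k[A]})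
    (dia_linear_l : forall y, linear (fun x => dia x y))
    (dia_linear_r : forall x, linear (dia x))
    (diaC : commutative dia)
    (diaA : associative dia) :
  exists (Delta : {linear diagalg k A -> tens (diagalg k A) (diagalg k A)})
         (eps : {linear diagalg k A -> k^o})
         (L : {linear tabalg k A -> words k A})
         (J : {linear diagalg k A -> diagalg k A}),
    [/\ is_cut_coproduct Delta,
        is_cut_counit eps,
        is_linearization dia L
      & is_jacobi_trudi J] /\
    [/\ hopf_morphism Delta eps Delta eps J,
        forall h : diagalg k A, L (diagval (J h) - diagval h) = 0
      & forall h : tableau A, diagonal_constant h ->
          lin_tab dia h = jt_word_det dia h].
Proof.
pose d := CommProduct dia_linear_l dia_linear_r diaC diaA.
have [G GE] := coproduct_exists k A.
have [c cE] := counit_exists k A.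
have [Lq LE] := linearization_exists d.
have [Jt JtE] := jacobi_trudi_exists k A.
pose DeltaF (x : diagalg k A) : tens (diagalg k A) (diagalg k A) := G (diagval x).
have Delta_lin : linear DeltaF by move=> a x y; apply: (linearP G a (diagval x) (diagval y)).
pose Delta : {linear diagalg k A -> tens (diagalg k A) (diagalg k A)} :=
  HB.pack DeltaF (GRing.isLinear.Build _ _ _ _ DeltaF Delta_lin).
pose epsF (x : diagalg k A) : k^o := c (diagval x).
have eps_lin : linear epsF by move=> a x y; apply: (linearP c a (diagval x) (diagval y)).
pose eps : {linear diagalg k A -> k^o} :=
  HB.pack epsF (GRing.isLinear.Build _ _ _ _ epsF eps_lin).
pose LF (x : tabalg k A) : words k A := Lq x.
have L_lin : linear LF by move=> a x y; apply: (linearP Lq a x y).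
pose L : {linear tabalg k A -> words k A} :=
  HB.pack LF (GRing.isLinear.Build _ _ _ _ LF L_lin).
pose JF (x : diagalg k A) : diagalg k A := Jt (diagval x).
have J_lin : linear JF by move=> a x y; apply: (linearP Jt a (diagval x) (diagval y)).
pose J : {linear diagalg k A -> diagalg k A} :=
  HB.pack JF (GRing.isLinear.Build _ _ _ _ JF J_lin).
have sk (h : tableau A) : skew_rows h by case/andP: (rowsP h).
have J_dcl t : skew_rows t -> diagonal t -> J (dcl k t) = jtrows (@column_class k A) t.
  exact: JtE.
have J_dcls h : diagonal_constant h -> J (dcls k h) = jtrows (@column_class k A) h.
  by move=> hd; rewrite -(dcl_rows k hd) J_dcl //; apply/diagonal_constantP.
have Delta_dcl t : skew_rows t -> diagonal t ->
    Delta (dcl k t) = \sum_(e <- cuts t) tpure (dcl k (top t e)) (dcl k (bot t e)).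
  exact: (dcoproduct_dcl GE).
have J_mon : monoid_morphism J.
  by split=> [|x y]; [apply: (rmorph1 Jt)|apply: (rmorphM Jt (diagval x) (diagval y))].
pose dvM := GRing.isMonoidMorphism.Build _ _ _ (diagval_is_monoid_morphism k A).
have dvZ : zmod_morphism (@diagval k A) by [].
pose dv : {rmorphism diagalg k A -> tabalg k A} :=
  HB.pack (@diagval k A) (GRing.isZmodMorphism.Build _ _ _ dvZ) dvM.
have diagval_jtrows t : diagval (jtrows (@column_class k A) t) = jtrows (fun w => tcls k (column w)) t.
  by rewrite [LHS](jtrows_rmorph dv); apply: eq_jtrows => w; apply: diagval_column_class.
have lin_word h : diagonal_constant h -> lin_tab dia h = jt_word_det dia h.
  move=> /diagonal_constantP hd.
  exact: (etrans (lin_tabE d h) (etrans (esym (jt_wordsE d (sk h) hd)) (esym (jt_word_detE d hd)))).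
have JDelta x : Delta (J x) = tmap J J (Delta x).
  move: x; apply: diagalg_span => [|a x y Ex Ey|h hd].
  - rewrite !linear0; exact: esym (linear_fun0 (tmap_linear J J)).
  - by rewrite !linearP Ex Ey; apply: esym; apply: (tmap_linear J J).
  have dh : diagonal h by apply/diagonal_constantP.
  rewrite (J_dcls _ hd) -(dcl_rows k hd) (Delta_dcl _ (sk h) dh).
  apply: (etrans (dcoproduct_jtrows GE (sk h) dh)).
  rewrite (big_morph _ (linear_funD (tmap_linear J J)) (linear_fun0 (tmap_linear J J))).
  rewrite big_seq [RHS]big_seq; apply: eq_bigr => e ec.
  have fe : fits h e by move: ec; rewrite mem_cuts => /andP[].
  rewrite tmap_pure; apply: esym; apply: (f_equal2 (@tpure k _ _)); apply: J_dcl.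
  - by rewrite skew_top.
  - exact: diagonal_top.
  - by rewrite skew_bot.
  - exact: diagonal_bot.
have Jeps x : eps (J x) = eps x.
  move: x; apply: diagalg_span => [|a x y Ex Ey|h hd]; first by rewrite !linear0.
    by rewrite !linearP Ex Ey.
  have dh : diagonal h by apply/diagonal_constantP.
  rewrite J_dcls // /eps /= /epsF diagval_jtrows jtrows_rmorph diagval_dcls // cE.
  (* The counit is a character with value 1 on the empty column and 0 on the others. *)
  apply: (jtrows_boxless d) => // w.
  by rewrite /= cE rows_column boxless_column.
(* The linearization of a column is its word, read off from the 1 by 1 determinant. *)
have Lword w : Lq (tcls k (column w)) = word k w.
  rewrite LE lin_tabE rows_column -jt_wordsE ?skew_column //; last exact: diagonal_column.
  exact: jtrows_column.
exists Delta, eps, L, J; split; split.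
- apply/cut_coproductP => h hd; rewrite -(dcl_rows k hd) Delta_dcl //.
  exact/diagonal_constantP.
- move=> h hd; rewrite /eps /= /epsF diagval_dcls // cE; congr (nat_of_bool _)%:R.
  exact: nboxes_boxless.
- by move=> h; apply: LE.
- move=> h hd; rewrite J_dcls // diagval_jtrows jtrows_det //.
  exact/diagonal_constantP.
- split=> //.
  by move=> S S' SP S'P; apply: (antipode_morphism Delta_dcl J_mon JDelta Jeps SP S'P).
- apply: diagalg_span => [|a x y Ex Ey|h hd].
  + by rewrite [J 0]linear0 subrr linear0.
  + have -> : diagval (J (a *: x + y)) - diagval (a *: x + y) =
        a *: (diagval (J x) - diagval x) + (diagval (J y) - diagval y).
      by rewrite linearP scalerBr [in LHS]opprD addrACA.
    by rewrite linearP Ex Ey scaler0 addr0.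
  have dh : diagonal h by apply/diagonal_constantP.
  rewrite linearB J_dcls // diagval_jtrows diagval_dcls //.
  apply/eqP; rewrite subr_eq0; apply/eqP.
  (* [Lq] is a ring morphism for the quasi-shuffle product, so it passes inside the determinant and
     turns each column into its word. *)
  have E1 := jtrows_rmorph Lq (fun w => tcls k (column w)) h.
  have E2 := etrans (LE h) (etrans (lin_tabE d h) (esym (jt_wordsE d (sk h) dh))).
  have E3 := eq_jtrows h Lword.
  exact: (etrans E1 (etrans E3 (esym E2))).
exact: lin_word.
Qed.
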